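(* There exist universal constants $C,c>0$ such that the following holds. Let $n\geq 1$, $N\geq n$, and let $G_0,\dots,G_N$ be independent standard gaussian vectors in $\mathbb{R}^n$. Denote $$\mathcal K=\mathrm{conv}\{G_0,\dots,G_N\}\quad\text{and}\quad \mathcal T=\mathrm{conv}\{\pm G_1,\dots,\pm G_N\}.$$ Then, with probability greater than $1-Ce^{-cn}$, $$L_{\mathcal K}<C\quad\text{and}\quad L_{\mathcal T}<C.$$
   Context: A standard gaussian vector in $\mathbb{R}^n$ is a random vector whose coordinates are independent standard normal random variables; $\mathrm{conv}$ denotes convex hull. For a convex body $\mathcal K\subset\mathbb{R}^n$ (compact convex set with nonempty interior), the isotropic constant $L_{\mathcal K}$ is defined by $$nL_{\mathcal K}^2=\inf_{T}\frac{1}{\mathrm{vol}_n(\mathcal K)^{1+2/n}}\int_{\mathcal K}|Tx|^2\,dx,$$ where the infimum runs over all volume-preserving affine maps $T:\mathbb{R}^n\to\mathbb{R}^n$ and $|\cdot|$ is the Euclidean norm. Universal constants are independent of $n$, $N$. *)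

(* Defs.v *)
From HB Require Import structures.
From mathcomp Require Import all_boot all_order all_algebra.
From mathcomp Require Import all_classical all_reals all_analysis.
Set Implicit Arguments. Unset Strict Implicit. Unset Printing Implicit Defensive.
Import Order.TTheory GRing.Theory Num.Theory.
Import numFieldNormedType.Exports.
Local Open Scope classical_set_scope.
Local Open Scope ring_scope.

Definition sqnorm {R : realType} {n : nat} (x : 'cV[R]_n) : R :=
  \sum_(i < n) x i 0 ^+ 2.

(* Lebesgue integral on R^n of a nonnegative function, as the iterated
   integral over the coordinates w.r.t. the Lebesgue measure on R
   (equal to the integral w.r.t. Lebesgue measure on R^n by Tonelli
   for nonnegative measurable integrands). *)
Fixpoint iint {R : realType} (n : nat) : ('cV[R]_n -> \bar R) -> \bar R :=
  match n return ('cV[R]_n -> \bar R) -> \bar R with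
  | 0 => fun f => f 0
  | n'.+1 => fun f =>
      (\int[@lebesgue_measure R]_t iint (fun v : 'cV[R]_n' =>
          f (col_mx (const_mx t : 'cV[R]_1) v)))%E
  end.

Definition vol {R : realType} {n : nat} (K : set 'cV[R]_n) : \bar R :=
  iint (fun x => (\1_K x)%:E).

Definition convex_hull {R : realType} {n : nat} {I : finType} (p : I -> 'cV[R]_n)
  : set 'cV[R]_n :=
  [set x | exists l : I -> R, (forall i, 0 <= l i) /\ \sum_i l i = 1 /\
                              x = \sum_i l i *: p i].

Definition convex_body {R : realType} {n : nat} (K : set 'cV[R]_n) : Prop :=
  compact K /\ (forall x y (t : R), K x -> K y -> 0 <= t <= 1 ->
                 K (t *: x + (1 - t) *: y)) /\ (K° !=set0).

Definition iso_values {R : realType} {n : nat} (K : set 'cV[R]_n) : set R :=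
  [set r | exists (A : 'M[R]_n) (b : 'cV[R]_n), `|\det A| = 1 /\
     r = fine (iint (fun x => (\1_K x * sqnorm (A *m x + b))%:E))
         / (fine (vol K)) `^ (1 + 2 / n%:R)].

Definition isotropic_constant {R : realType} {n : nat} (K : set 'cV[R]_n) : R :=
  Num.sqrt (inf (iso_values K) / n%:R).

Definition std_gaussian_family {R : realType} {d : measure_display}
  {T : measurableType d} (P : probability T R) {m n : nat}
  (G : 'I_m -> T -> 'cV[R]_n) : Prop :=
  (forall i j, measurable_fun setT (fun w => G i w j ord0)) /\
  (forall i j (B : set R), measurable B ->
      P ((fun w => G i w j ord0) @^-1` B) = normal_prob 0 1 B) /\
  (forall B : 'I_m -> 'I_n -> set R, (forall i j, measurable (B i j)) ->
      P [set w | forall i j, B i j (G i w j ord0)] =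
      (\prod_(i < m) \prod_(j < n) P ((fun w => G i w j ord0) @^-1` B i j))%E).

(* Main.v *)
Require Import Defs.
From HB Require Import structures.
From mathcomp Require Import all_boot all_order all_algebra all_fingroup.
From mathcomp Require Import all_classical all_reals all_analysis.
From mathcomp Require Import measurable_realfun.
From mathcomp Require Import ring lra.
Set Implicit Arguments. Unset Strict Implicit. Unset Printing Implicit Defensive.
Import Order.TTheory GRing.Theory Num.Theory.
Import numFieldNormedType.Exports.
Local Open Scope classical_set_scope.
Local Open Scope ring_scope.

(** The infimum defining L_K is at most the value at T = id, so n L_K^2 is
    bounded by the mean of |x|^2 over K divided by vol(K)^(2/n).

    Second moment.  Lift the vertices to generic heights; the lower faces of
    the lifted hull project to a triangulation of K whose simplices have their
    vertices among the given points.  On a simplex with vertices p_0, ..., p_n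
    the mean of |x|^2 is (sum |p_i|^2 + |sum p_i|^2) / ((n+1)(n+2)), and
    exponential Markov with a union bound over sign patterns supported on at
    most n+1 indices bounds every numerator by C n^2 log(2N/n).

    Volume, N < e^7 n.  The simplex spanned by 0 or G_0 together with
    G_1, ..., G_n has volume at least |D| n^(-n), D being the determinant of
    the differences.  Expand D along its first column: the cofactor vector is
    not small because the inverse of its norm is a gaussian integral whose
    expectation is a product of one-dimensional Cauchy-type integrals, and its
    inner product with the first column satisfies a small ball estimate.

    Volume, N >= e^7 n.  For |x|^2 <= log(N/n)/2 a fraction p >= e^(-|x|^2-1/2)
    of the gaussian density is symmetric about x.  Reflecting that fraction
    gives a Wendel-type induction on subspaces, showing that x can be strictly_separated
    from G_1, ..., G_N with probability at most 2^n (1 - p/4)^N <= e^(-n).  By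
    Fubini the hull contains half of a cube of side of order
    sqrt(log(N/n)/n), which compensates the factor log(2N/n) above. *)

(** * Iterated Lebesgue integrals *)

(** [vol] is an iterated integral and [std_gaussian_family] only prices boxes, so both must be made
    calculable. Linear changes of variables for [iint] come from an LUP factorization. The gaussian
    hypothesis acts through resampling: under an expectation, an entry or a column of the matrix
    with columns [G i] may be replaced by a fresh one integrated against its density. Separation is
    measurable jointly in point and vertices because a strict separator can be taken rational.

    Two volume regimes are needed because one simplex does not compensate the logarithm in the
    second moment; it suffices only while log(N/n) stays bounded. Both bodies are treated at once:
    each contains the hull of G_1, ..., G_N, and each contains a simplex with apex [kap *: G ord0],
    with [kap] equal to 1 or 0. Repeated indices, which occur when both G_i and -G_i are vertices of
    one simplex, are handled by splitting the vertices by sign. All failure probabilities are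
    multiples of e^(-n) by at most n^2, and c = 1/2 absorbs this polynomial. *)

Section matrix_measurable.
Variables (R : realType) (m n : nat).

(** The sigma-algebra generated by the entries: measurability of a matrix-valued map is then checked
    entrywise, which is the only form in which the gaussian hypothesis provides it. *)
Definition mx_cylinders : set (set 'M[R]_(m, n)) :=
  [set A | exists i j, exists2 B : set (measurableTypeR R),
     measurable B & A = [set X : 'M[R]_(m, n) | B (X i j)]].

HB.instance Definition _ := @isMeasurable.Build default_measure_display
  'M[R]_(m, n) (<<s mx_cylinders >>) (@sigma_algebra0 _ setT _)
  (@sigma_algebraC _ _) (@sigma_algebra_bigcup _ setT _).

Lemma measurable_coord i j :
  measurable_fun [set: 'M[R]_(m, n)] (fun X => X i j : measurableTypeR R).
Proof.
move=> _ B mB; rewrite setTI; apply: sub_sigma_algebra.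
by exists i, j, B.
Qed.

Lemma measurable_mxP d (Z : measurableType d) (f : Z -> 'M[R]_(m, n)) :
  (forall i j, measurable_fun setT (fun z => f z i j : measurableTypeR R)) ->
  measurable_fun setT f.
Proof.
move=> mf; apply: (@measurability _ _ _ _ _ _ mx_cylinders) => //.
move=> A [_ [i [j [B mB ->]]] <-].
exact: mf.
Qed.

End matrix_measurable.

Section affine_1d.
Variable R : realType.
Notation mu := (@lebesgue_measure R).
Local Open Scope ereal_scope.

Lemma measurable_affine (a b : R) :
  measurable_fun setT (fun t : measurableTypeR R => (a * t + b)%R : measurableTypeR R).
Proof.
apply: measurable_funD => //; apply: measurable_funM => //.
Qed.

(** The pushforward of Lebesgue measure by t -> a t + b, scaled by |a|, gives half-open intervals
    their length, so it is Lebesgue measure by uniqueness. *)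
Lemma lebesgue_affine (a b : R) (f : R -> \bar R) : a != 0%R ->
  measurable_fun setT (f : measurableTypeR R -> \bar R) -> (forall t, 0 <= f t) ->
  \int[mu]_t f (a * t + b)%R = (`|a|^-1)%:E * \int[mu]_t f t.
Proof.
move=> a0 mf f0.
have na0 : (0 < `|a|)%R by rewrite normr_gt0.
pose phi : measurableTypeR R -> measurableTypeR R := fun t => (a * t + b)%R.
have mphi : measurable_fun setT phi by exact: measurable_affine.
have k0 : (0 <= `|a|)%R by [].
pose nu0 := mscale (NngNum k0) (pushforward mu phi).
pose nu : {measure set _ -> \bar R} := nu0 mphi.
have E A : measurable A -> mu A = nu A.
  apply: lebesgue_measure_unique => X [[x y] _ <-] /=.
  rewrite /nu /nu0 /mscale /= /pushforward /=.
  have [xy|yx] := ltP x y; last first.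
    by rewrite set_itv_ge ?bnd_simp -?leNgt// preimage_set0 !measure0 mule0.
  rewrite lebesgue_measure_itv/= lte_fin xy.
  have [ap|an|a0'] := ltgtP a 0%R; last by rewrite a0' eqxx in a0.
  - have -> : phi @^-1` `]x, y]%classic = `[((y - b) / a)%R, ((x - b) / a)%R[%classic.
      apply/seteqP; split => t /=; rewrite !in_itv /= /phi => /andP[h1 h2]; apply/andP; split.
      + by rewrite ler_ndivrMr// mulrC; lra.
      + by rewrite ltr_ndivlMr// mulrC; lra.
      + by move: h2; rewrite ltr_ndivlMr// mulrC; lra.
      + by move: h1; rewrite ler_ndivrMr// mulrC; lra.
    rewrite lebesgue_measure_itv/= lte_fin ltr_ndivlMr// mulfVK// ltrD2r xy.
    rewrite -!EFinB -EFinM ltr0_norm//; congr EFin; field; exact: a0.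
  - have -> : phi @^-1` `]x, y]%classic = `]((x - b) / a)%R, ((y - b) / a)%R]%classic.
      apply/seteqP; split => t /=; rewrite !in_itv /= /phi => /andP[h1 h2]; apply/andP; split.
      + by rewrite ltr_pdivrMr// mulrC; lra.
      + by rewrite ler_pdivlMr// mulrC; lra.
      + by move: h1; rewrite ltr_pdivrMr// mulrC; lra.
      + by move: h2; rewrite ler_pdivlMr// mulrC; lra.
    rewrite lebesgue_measure_itv/= lte_fin ltr_pdivrMr// mulfVK// ltrD2r xy.
    rewrite -!EFinB -EFinM gtr0_norm//; congr EFin; field; exact: a0.
have -> : \int[mu]_t f t = \int[nu]_t f t.
  by apply: eq_measure_integral => A mA _; first [exact: E | exact: (esym (E A mA))].
rewrite /nu /nu0 ge0_integral_mscale//= ge0_integral_pushforward//=.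
rewrite preimage_setT muleA -EFinM mulVf ?mul1e// gt_eqF//.
Qed.

End affine_1d.

Section coordinate_integrals.
Variable R : realType.
Notation mu := (@lebesgue_measure R).
Local Notation RB := (measurableTypeR R).
Local Open Scope ereal_scope.

Definition upd m n (X : 'M[R]_(m, n)) (i : 'I_m) (j : 'I_n) (t : R) : 'M[R]_(m, n) :=
  \matrix_(k, l) if (k == i) && (l == j) then t else X k l.

Lemma measurable_upd m n d (Z : measurableType d) (f : Z -> 'M[R]_(m, n)) (g : Z -> RB) i j :
  measurable_fun setT f -> measurable_fun setT g ->
  measurable_fun setT (fun z => upd (f z) i j (g z)).
Proof.
move=> mf mg; apply: measurable_mxP => k l.
under eq_fun do rewrite mxE.
case: ((k == i) && (l == j)) => //.
by apply: (@measurableT_comp _ _ _ _ _ _ (fun X : 'M[R]_(m, n) => X k l : RB)) => //;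
  exact: measurable_coord.
Qed.

Lemma updC m n (X : 'M[R]_(m, n)) i j i' j' s t : (i, j) != (i', j') ->
  upd (upd X i j s) i' j' t = upd (upd X i' j' t) i j s.
Proof.
move=> h; apply/matrixP => k l; rewrite !mxE.
case: ifP => // /andP[/eqP-> /eqP->]; case: ifP => // /andP[/eqP e1 /eqP e2].
by rewrite e1 e2 eqxx in h.
Qed.

(** Integrates the coordinates listed in [s] in place, the head of [s] outermost, and reads the
    others from the base point. In contrast to [iint], which changes dimension at each step, the
    order of integration becomes a list that Tonelli permutes. *)
Definition fint n (s : seq 'I_n) (f : 'cV[R]_n -> \bar R) : 'cV[R]_n -> \bar R :=
  foldr (fun j g x => \int[mu]_t g (upd x j ord0 t)) f s.

Lemma fint_ge0 n (s : seq 'I_n) (f : 'cV[R]_n -> \bar R) x :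
  (forall y, 0 <= f y) -> 0 <= fint s f x.
Proof.
move=> f0; elim: s x => [|j s IH] x //=.
by apply: integral_ge0 => t _; exact: IH.
Qed.

Lemma measurable_fint n d (Z : measurableType d) (s : seq 'I_n)
    (f : Z * 'cV[R]_n -> \bar R) :
  measurable_fun setT f -> (forall z, 0 <= f z) ->
  measurable_fun setT (fun z : Z * 'cV[R]_n => fint s (fun y => f (z.1, y)) z.2).
Proof.
move=> mf f0; elim: s => [|j s IH] /=.
  by apply: eq_measurable_fun mf => -[].
apply: (@measurable_fun_fubini_tonelli_F _ _ _ _ _ mu
  (fun p : (Z * 'cV[R]_n) * RB => fint s (fun y => f (p.1.1, y)) (upd p.1.2 j ord0 p.2))).
  apply: (@measurableT_comp _ _ _ _ _ _ _ _ (fun p : (Z * 'cV[R]_n) * RB =>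
     (p.1.1, upd p.1.2 j ord0 p.2)) IH).
  apply: measurable_fun_pair.
    by apply: measurableT_comp.
  by apply: measurable_upd => //; apply: measurableT_comp.
by move=> p; apply: fint_ge0.
Qed.

Lemma measurable_fint1 n (s : seq 'I_n) (f : 'cV[R]_n -> \bar R) :
  measurable_fun setT f -> (forall z, 0 <= f z) -> measurable_fun setT (fint s f).
Proof.
move=> mf f0.
have := @measurable_fint n _ RB s (fun p => f p.2).
move=> /(_ (measurableT_comp mf measurable_snd) (fun=> f0 _)) h.
apply: (@measurableT_comp _ _ _ _ _ _ _ _ (fun x : 'cV[R]_n => (0%R : RB, x)) h).
exact: measurable_pair1.
Qed.

Lemma fint_cat n (s1 s2 : seq 'I_n) f : fint (s1 ++ s2) f = fint s1 (fint s2 f).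
Proof. by rewrite /fint foldr_cat. Qed.

Lemma fint_swap n (i j : 'I_n) f x : measurable_fun setT f -> (forall z, 0 <= f z) ->
  fint [:: i; j] f x = fint [:: j; i] f x.
Proof.
move=> mf f0 /=; have [->//|ij] := eqVneq i j.
rewrite (@fubini_tonelli _ _ _ _ _ mu mu
  (fun p : RB * RB => f (upd (upd x i ord0 p.1) j ord0 p.2))) /=; last 2 first.
- apply: measurableT_comp => //; apply: measurable_upd => //.
  exact: measurable_upd.
- by move=> p.
apply: eq_integral => t _; apply: eq_integral => u _.
by rewrite updC// xpair_eqE (negPf ij).
Qed.

Lemma fint_cons_cat n (i : 'I_n) s1 s2 f : measurable_fun setT f -> (forall z, 0 <= f z) ->
  fint (s1 ++ i :: s2) f = fint (i :: s1 ++ s2) f.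
Proof.
move=> mf f0; elim: s1 => //= j s1 IH.
apply/funext => x; rewrite IH /=.
exact: (@fint_swap _ j i (fint (s1 ++ s2) f) x (measurable_fint1 _ mf f0)
  (fun z => fint_ge0 _ _ f0)).
Qed.

Lemma fint_perm n (s1 s2 : seq 'I_n) f : measurable_fun setT f -> (forall z, 0 <= f z) ->
  perm_eq s1 s2 -> fint s1 f = fint s2 f.
Proof.
move=> mf f0; elim: s1 s2 => [|i s1 IH] s2 h.
  by rewrite perm_sym in h; rewrite (perm_nilP h).
have /splitPr e : i \in s2 by rewrite -(perm_mem h) mem_head.
case: e h => t1 t2 h; rewrite fint_cons_cat//=.
rewrite (IH (t1 ++ t2))//.
by move: h; rewrite perm_sym -[i :: t2]cat1s (perm_catCA t1 [:: i]) /= perm_cons perm_sym.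
Qed.

Lemma fint_lift n (s : seq 'I_n) (f : 'cV[R]_(n.+1) -> \bar R) t (v : 'cV[R]_n) :
  fint (map (lift ord0) s) f (col_mx (const_mx t : 'cV[R]_1) v) =
  fint s (fun v => f (col_mx (const_mx t : 'cV[R]_1) v)) v.
Proof.
elim: s v => //= j s IH v; apply: eq_integral => u _.
rewrite -IH; congr (fint _ _ _).
apply/matrixP => k l; rewrite !mxE.
case: splitP => k' /= ek; rewrite !mxE.
  by case: ifP => // /andP[/eqP e _]; move: ek; rewrite e ord1.
congr (if _ && _ then _ else _).
apply/eqP/eqP => [e|e].
  by apply/val_inj; move: ek; rewrite e /= /bump /= !add1n => -[].
by apply/val_inj; rewrite /= ek e.
Qed.

(** Any base point [x] will do, since all its coordinates get overwritten. *)
Lemma iint_fint n (f : 'cV[R]_n -> \bar R) x : iint f = fint (enum 'I_n) f x.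
Proof.
elim: n f x => [|n IH] f x /=.
  by rewrite (size0nil (size_enum_ord 0)) /=; congr f; apply/matrixP => -[].
rewrite enum_ordSl /=; apply: eq_integral => t _.
rewrite (IH _ (dsubmx (x : 'cV[R]_(1 + n)))) -fint_lift.
congr (fint _ _ _).
apply/matrixP => k l; rewrite !mxE.
case: splitP => k' /= ek; rewrite !mxE.
  rewrite [l]ord1 eqxx andbT; case: eqP => // ne; exfalso; apply: ne; apply/val_inj.
  by rewrite /= ek ord1.
rewrite ifF; first by congr (x _ _); apply/val_inj.
by apply/negbTE; rewrite negb_and -val_eqE /= ek.
Qed.

End coordinate_integrals.

Section iint_theory.
Variable R : realType.
Notation mu := (@lebesgue_measure R).
Local Notation RB := (measurableTypeR R).
Local Open Scope ereal_scope.

Lemma iint_ge0 n (f : 'cV[R]_n -> \bar R) : (forall x, 0 <= f x) -> 0 <= iint f.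
Proof. by move=> f0; rewrite (iint_fint f 0); exact: fint_ge0. Qed.

Lemma eq_iint n (f g : 'cV[R]_n -> \bar R) : f =1 g -> iint f = iint g.
Proof. by move=> /funext ->. Qed.

Lemma measurable_iint n d (Z : measurableType d) (f : Z * 'cV[R]_n -> \bar R) :
  measurable_fun setT f -> (forall z, 0 <= f z) ->
  measurable_fun setT (fun z => iint (fun y => f (z, y))).
Proof.
move=> mf f0; under eq_fun do rewrite (iint_fint _ 0).
have := @measurable_fint R n _ Z (enum 'I_n) f mf f0.
move=> h; apply: (@measurableT_comp _ _ _ _ _ _ _ _ (fun z : Z => (z, 0%R : 'cV[R]_n)) h).
exact: measurable_pair2.
Qed.

Lemma measurable_col_mx n d (Z : measurableType d) (g : Z -> RB) (f : Z -> 'cV[R]_n) :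
  measurable_fun setT g -> measurable_fun setT f ->
  measurable_fun setT (fun z => col_mx (const_mx (g z) : 'cV[R]_1) (f z) : 'cV[R]_n.+1).
Proof.
move=> mg mf; apply: measurable_mxP => i j.
under eq_fun do rewrite mxE.
case: (fintype.split (i : 'I_(1 + n))) => k; under eq_fun do rewrite ?mxE.
  by [].
apply: (@measurableT_comp _ _ _ _ _ _ (fun X : 'cV[R]_n => X k j : RB)) => //.
exact: measurable_coord.
Qed.

Lemma measurable_comp_col_mx n (f : 'cV[R]_n.+1 -> \bar R) :
  measurable_fun setT f ->
  measurable_fun setT (fun p : RB * 'cV[R]_n =>
    f (col_mx (const_mx p.1 : 'cV[R]_1) p.2)).
Proof. by move=> mf; apply: measurableT_comp => //; exact: measurable_col_mx. Qed.

Lemma measurable_slice n (f : 'cV[R]_n.+1 -> \bar R) t :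
  measurable_fun setT f ->
  measurable_fun setT (fun v : 'cV[R]_n => f (col_mx (const_mx t : 'cV[R]_1) v)).
Proof. by move=> mf; apply: measurableT_comp => //; exact: measurable_col_mx. Qed.

Lemma measurable_iint_slice n (f : 'cV[R]_n.+1 -> \bar R) :
  measurable_fun setT f -> (forall x, 0 <= f x) ->
  measurable_fun setT (fun t : RB => iint (fun v : 'cV[R]_n => f (col_mx (const_mx t : 'cV[R]_1) v))).
Proof.
move=> mf f0.
exact: (@measurable_iint n _ RB _ (measurable_comp_col_mx mf)).
Qed.

Lemma le_iint n (f g : 'cV[R]_n -> \bar R) :
  measurable_fun setT f -> measurable_fun setT g -> (forall x, 0 <= f x) ->
  (forall x, f x <= g x) -> iint f <= iint g.
Proof.
elim: n f g => [|n IH] f g mf mg f0 fg //=.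
have g0 x : 0 <= g x by exact: le_trans (fg x).
apply: ge0_le_integral => //.
- by move=> t _; exact: iint_ge0.
- exact: measurable_iint_slice.
- exact: measurable_iint_slice.
- by move=> t _; apply: IH => //; exact: measurable_slice.
Qed.

Lemma iintD n (f g : 'cV[R]_n -> \bar R) :
  measurable_fun setT f -> measurable_fun setT g -> (forall x, 0 <= f x) ->
  (forall x, 0 <= g x) -> iint (fun x => f x + g x) = iint f + iint g.
Proof.
elim: n f g => [|n IH] f g mf mg f0 g0 //=.
rewrite -ge0_integralD//; try (by move=> t _; exact: iint_ge0);
  try exact: measurable_iint_slice.
by apply: eq_integral => t _; rewrite IH//; exact: measurable_slice.
Qed.

Lemma iintZl n (f : 'cV[R]_n -> \bar R) (k : \bar R) :
  measurable_fun setT f -> (forall x, 0 <= f x) -> 0 <= k ->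
  iint (fun x => k * f x) = k * iint f.
Proof.
elim: n f => [|n IH] f mf f0 k0 //=.
rewrite -ge0_integralZl//; try (by move=> t _; exact: iint_ge0);
  try exact: measurable_iint_slice.
by apply: eq_integral => t _; rewrite IH//; exact: measurable_slice.
Qed.

Lemma iint0 n : iint (fun _ : 'cV[R]_n => 0) = 0.
Proof. by elim: n => //= n IH; rewrite IH integral0. Qed.

Lemma iint_sum n (I : Type) (s : seq I) (f : I -> 'cV[R]_n -> \bar R) :
  (forall i, measurable_fun setT (f i)) -> (forall i x, 0 <= f i x) ->
  iint (fun x => \sum_(i <- s) f i x) = \sum_(i <- s) iint (f i).
Proof.
move=> mf f0; elim: s => [|i s IH].
  by rewrite big_nil -[RHS](iint0 n); apply: eq_iint => x; rewrite big_nil.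
rewrite big_cons -IH -iintD//.
- by apply: eq_iint => x; rewrite big_cons.
- by apply: emeasurable_sum => j.
- by move=> x; rewrite sume_ge0.
Qed.

Lemma iint_tonelli n d (Z : measurableType d) (nu : {sigma_finite_measure set Z -> \bar R})
    (f : Z * 'cV[R]_n -> \bar R) :
  measurable_fun setT f -> (forall z, 0 <= f z) ->
  \int[nu]_z iint (fun y => f (z, y)) = iint (fun y => \int[nu]_z f (z, y)).
Proof.
elim: n f => [|n IH] f mf f0 //=.
rewrite (@fubini_tonelli _ _ _ _ _ nu mu (fun p : Z * RB =>
  iint (fun v : 'cV[R]_n => f (p.1, col_mx (const_mx p.2 : 'cV[R]_1) v)))) /=.
- apply: eq_integral => t _.
  apply: (IH (fun q => f (q.1, col_mx (const_mx t : 'cV[R]_1) q.2))) => //.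
  apply: measurableT_comp => //; apply: measurable_fun_pair => //.
  exact: measurable_col_mx.
- apply: (@measurable_iint n _ (Z * RB)%type
    (fun q => f (q.1.1, col_mx (const_mx q.1.2 : 'cV[R]_1) q.2))) => //.
  apply: measurableT_comp => //; apply: measurable_fun_pair.
    exact: measurableT_comp.
  by apply: measurable_col_mx => //; exact: measurableT_comp.
- by move=> p; exact: iint_ge0.
Qed.

Lemma measurable_mulmx_add m n d (Z : measurableType d) (A : 'M[R]_(m, n)) (b : 'cV[R]_m)
    (f : Z -> 'cV[R]_n) : measurable_fun setT f ->
  measurable_fun setT (fun z => (A *m f z + b)%R).
Proof.
move=> mf; apply: measurable_mxP => i j.
under eq_fun do rewrite !mxE.
apply: measurable_funD => //; apply: measurable_sum => k.
apply: measurable_funM => //.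
apply: (@measurableT_comp _ _ _ _ _ _ (fun X : 'cV[R]_n => X k j : RB)) => //.
exact: measurable_coord.
Qed.

(** Change of variables for the linear part [A]. Quantifying over [f] and [b] makes the property
    stable under products, so it needs proof only for permutation and triangular factors. *)
Let cov n (A : 'M[R]_n) := forall (f : 'cV[R]_n -> \bar R) (b : 'cV[R]_n),
  measurable_fun setT f -> (forall x, 0 <= f x) ->
  iint (fun x => f (A *m x + b)%R) = (`|\det A|^-1)%:E * iint f.

Let covM n (A B : 'M[R]_n) : cov A -> cov B -> cov (A *m B).
Proof.
move=> cA cB f b mf f0.
transitivity (iint (fun x => (fun y => f (A *m y + b)%R) (B *m x + 0)%R)).
  by apply: eq_iint => x; rewrite addr0 mulmxA.
rewrite (cB (fun y => f (A *m y + b)%R) 0%R)//; last first.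
  by apply: measurableT_comp => //; exact: measurable_mulmx_add.
by rewrite cA// muleA -EFinM det_mulmx normrM invfM mulrC.
Qed.

(** The first coordinate of [A *m x + b] depends on the first coordinate t alone. For fixed t the
    rest is a lower triangular map of one dimension less, with a translation depending on t;
    integrating t is then the one-dimensional affine case. *)
Let cov_lower n (A : 'M[R]_n) :
  (forall i j : 'I_n, (i < j)%N -> A i j = 0%R) -> (forall i, A i i != 0%R) -> cov A.
Proof.
elim: n A => [|n IH] A low diag f b mf f0.
  by rewrite /= det_mx00 normr1 invr1 mul1e; congr f; apply/matrixP => -[].
set A1 : 'M[R]_(1 + n) := A; set b1 : 'cV[R]_(1 + n) := b.
pose l := A ord0 ord0.
have ul : ulsubmx A1 = l%:M.
  apply/matrixP => i j; rewrite !mxE !ord1 eqxx mulr1n /l.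
  by congr (A _ _); apply/val_inj.
have ur : ursubmx A1 = 0%R.
  by apply/matrixP => i j; rewrite !mxE; apply: low => /=; rewrite ord1.
have AE : A1 = block_mx l%:M 0 (dlsubmx A1) (drsubmx A1).
  by rewrite -[LHS]submxK ul ur.
have bE : b1 = col_mx (const_mx (b ord0 ord0)) (dsubmx b1).
  rewrite -[LHS]vsubmxK; congr col_mx; apply/matrixP => i j; rewrite !mxE !ord1.
  by congr (b _ _); apply/val_inj.
have detE : (\det A = l * \det (drsubmx A1))%R.
  by rewrite -[\det A]/(\det A1) AE det_lblock det_scalar expr1 block_mxKdr.
have E t v : (A *m col_mx (const_mx t : 'cV[R]_1) v + b)%R =
    col_mx (const_mx (l * t + b ord0 ord0)%R : 'cV[R]_1)
      (drsubmx A1 *m v + (dlsubmx A1 *m (const_mx t : 'cV[R]_1) + dsubmx b1))%R.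
  rewrite -[(A *m _ + b)%R]/(A1 *m col_mx (const_mx t : 'cV[R]_1) v + b1)%R.
  rewrite {1}AE {1}bE mul_block_col add_col_mx mul0mx addr0 mul_scalar_mx.
  rewrite [X in col_mx _ (X + _)]addrC -addrA.
  have -> // : (l *: const_mx t + const_mx (b ord0 ord0))%R =
    const_mx (l * t + b ord0 ord0)%R :> 'cV[R]_1.
  by apply/matrixP => i j; rewrite !mxE.
have low' (i j : 'I_n) : (i < j)%N -> drsubmx A1 i j = 0%R.
  by move=> ij; rewrite !mxE; apply: low.
have diag' i : drsubmx A1 i i != 0%R by rewrite !mxE; exact: diag.
rewrite /=; under eq_integral => t _.
  rewrite (eq_iint (g := fun v => f (col_mx (const_mx (l * t + b ord0 ord0)%R : 'cV[R]_1)
      (drsubmx A1 *m v + (dlsubmx A1 *m (const_mx t : 'cV[R]_1) + dsubmx b1))%R))); last first.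
    by move=> v; rewrite E.
  rewrite (IH _ low' diag' (fun v => f (col_mx (const_mx (l * t + b ord0 ord0)%R : 'cV[R]_1) v))) //; last exact: measurable_slice.
  over.
rewrite ge0_integralZl//; last 2 first.
- apply: (@measurableT_comp _ _ _ _ _ _ _ _ (fun t : RB => (l * t + b ord0 ord0)%R : RB) (measurable_iint_slice mf f0)).
  exact: measurable_affine.
- by move=> t _; exact: iint_ge0.
rewrite (@lebesgue_affine R l (b ord0 ord0) (fun t => iint (fun v : 'cV[R]_n => f (col_mx (const_mx t : 'cV[R]_1) v))))//.
- by rewrite muleA -EFinM detE normrM invfM mulrC.
- exact: diag.
- exact: measurable_iint_slice.
- by move=> t; exact: iint_ge0.
Qed.

(** Permuting coordinates only reorders the integrations, which [fint_perm] allows. *)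
Lemma iint_row_perm n (s : 'S_n) (f : 'cV[R]_n -> \bar R) :
  measurable_fun setT f -> (forall x, 0 <= f x) ->
  iint (fun x => f (row_perm s x)) = iint f.
Proof.
move=> mf f0; rewrite (iint_fint _ 0) (iint_fint f 0).
have E r x : fint r (fun x => f (row_perm s x)) x = fint (map (s^-1)%g r) f (row_perm s x).
  elim: r x => //= j r IH x; apply: eq_integral => t _; rewrite IH; congr (fint _ _ _).
  apply/matrixP => k l; rewrite !mxE; congr (if _ && _ then _ else _).
  by apply/eqP/eqP => [<-|->]; rewrite ?permK ?permKV.
rewrite E (_ : row_perm s 0 = 0%R); last by apply/matrixP => i j; rewrite !mxE.
rewrite (fint_perm mf f0 (s2 := enum 'I_n))//.
apply: uniq_perm => [||i]; first by rewrite map_inj_uniq ?enum_uniq//; exact: perm_inj.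
  exact: enum_uniq.
rewrite mem_enum inE; apply/mapP; exists (s i); first by rewrite mem_enum.
by rewrite permK.
Qed.

Lemma iint_shift n (f : 'cV[R]_n -> \bar R) b :
  measurable_fun setT f -> (forall x, 0 <= f x) ->
  iint (fun x => f (x + b)%R) = iint f.
Proof.
move=> mf f0; have := @cov_lower n 1%:M _ _ f b mf f0.
rewrite det1 normr1 invr1 mul1e => <-.
- by apply: eq_iint => x; rewrite mul1mx.
- by move=> i j ij; rewrite mxE lt_eqF.
- by move=> i; rewrite mxE eqxx oner_neq0.
Qed.

Let cov_perm n (s : 'S_n) : cov (perm_mx s).
Proof.
move=> f b mf f0; rewrite det_perm normrX normrN normr1 expr1n invr1 mul1e.
rewrite -(iint_shift b mf f0) -(@iint_row_perm n s (fun x => f (x + b)%R))//.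
  by apply: eq_iint => x; rewrite row_permE.
apply: measurableT_comp => //.
have := @measurable_mulmx_add n n _ _ 1%:M b id (@measurable_id _ _ setT).
by apply: eq_measurable_fun => x _; rewrite mul1mx.
Qed.

Lemma iint_linear n (A : 'M[R]_n) (f : 'cV[R]_n -> \bar R) (b : 'cV[R]_n) :
  \det A != 0%R -> measurable_fun setT f -> (forall x, 0 <= f x) ->
  iint (fun x => f (A *m x + b)%R) = (`|\det A|^-1)%:E * iint f.
Proof.
case: n A f b => [|n] A f b detA mf f0.
  by rewrite /= det_mx00 normr1 invr1 mul1e; congr f; apply/matrixP => -[].
move: f b mf f0; rewrite -/(cov A).
case E : (cormen_lup A) => [[P L] U].
have PA : P *m A = L *m U by have := cormen_lup_correct A; rewrite E.
have /is_perm_mxP[s Ps] : is_perm_mx P by have := cormen_lup_perm A; rewrite E.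
have lowL (i j : 'I_n.+1) : (i <= j)%N -> L i j = (i == j)%:R.
  by have := @cormen_lup_lower _ _ A i j; rewrite E.
have upU (i j : 'I_n.+1) : (j < i)%N -> U i j = 0%R.
  by have := @cormen_lup_upper _ _ A i j; rewrite E.
have detL : \det L = 1%R by have := cormen_lup_detL A; rewrite E.
have AE : A = perm_mx (s^-1)%g *m (L *m U).
  by rewrite -PA Ps mulmxA -perm_mxM mulVg perm_mx1 mul1mx.
have detU : \det U != 0%R.
  by move: detA; rewrite AE !det_mulmx detL mul1r mulf_eq0 negb_or => /andP[].
(* [w] reverses the coordinates: conjugation by it turns the upper triangular factor into a lower
   triangular one, so [cov_lower] serves for both. *)
pose w : 'S_n.+1 := perm (@rev_ord_inj n.+1).
have ww : (perm_mx w *m perm_mx w = 1%:M :> 'M[R]_n.+1)%R.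
  rewrite -perm_mxM (_ : (w * w)%g = 1%g) ?perm_mx1//.
  by apply/permP => i; rewrite permM !permE rev_ordK.
have UE : U = perm_mx w *m (perm_mx w *m U *m perm_mx w) *m perm_mx w.
  by rewrite !mulmxA ww mul1mx -mulmxA ww mulmx1.
have U'E i j : (perm_mx w *m U *m perm_mx w) i j = U (rev_ord i) (rev_ord j).
  have -> : perm_mx w *m U *m perm_mx w = col_perm (w^-1)%g (row_perm w U).
    by rewrite col_permE row_permE invgK.
  rewrite !mxE permE; congr (U _ _).
  have -> : (w^-1 = w)%g.
    by apply/permP => k; apply: (@perm_inj _ w); rewrite permKV !permE rev_ordK.
  by rewrite permE.
have diagU i : U i i != 0%R.
  have : \det U^T != 0%R by rewrite det_tr.
  rewrite det_trig; last by apply/is_trig_mxP => a b ab; rewrite mxE; exact: upU.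
  move=> /prodf_neq0 /(_ i isT); by rewrite mxE.
rewrite AE UE; apply: covM; first exact: cov_perm.
apply: covM.
  apply: cov_lower => [i j ij|i].
    by rewrite lowL ?(ltnW ij)// lt_eqF.
  by rewrite lowL// eqxx oner_neq0.
apply: covM; last exact: cov_perm.
apply: covM; first exact: cov_perm.
apply: cov_lower => [i j ij|i]; rewrite U'E.
  apply: upU => /=; rewrite !subSS ltn_sub2l//.
  by rewrite (leq_trans ij)// -ltnS.
exact: diagU.
Qed.

End iint_theory.

Section iint_sets.
Variable R : realType.
Notation mu := (@lebesgue_measure R).
Local Notation RB := (measurableTypeR R).
Local Open Scope ereal_scope.

Definition dot n (u v : 'cV[R]_n) : R := (\sum_j u j ord0 * v j ord0)%R.

Lemma iint_prod n (f : 'I_n -> R -> R) :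
  (forall i, measurable_fun setT (f i : RB -> RB)) -> (forall i t, 0 <= f i t)%R ->
  iint (fun x : 'cV[R]_n => (\prod_i f i (x i ord0))%:E) = \prod_i \int[mu]_t (f i t)%:E.
Proof.
elim: n f => [|n IH] f mf f0 /=; first by rewrite !big_ord0.
rewrite big_ord_recl -IH//=.
rewrite -ge0_integralZr//; try (by move=> t _; rewrite lee_fin);
  try exact/measurable_EFinP;
  try by apply: iint_ge0 => x; rewrite lee_fin prodr_ge0.
apply: eq_integral => t _; rewrite -iintZl//.
- apply: eq_iint => x; rewrite -EFinM big_ord_recl; congr (EFin (_ * _)%R).
    by congr (f _ _); rewrite mxE; case: splitP => // k _; rewrite mxE.
  apply: eq_bigr => i _; congr (f _ _); rewrite mxE; case: splitP => k /=.
    by rewrite ord1 /bump leq0n.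
  by rewrite /bump leq0n !add1n => -[] /ord_inj ->.
- apply/measurable_EFinP; apply: measurable_prod => i _.
  apply: (@measurableT_comp _ _ _ _ _ _ (f (lift ord0 i) : RB -> RB)) => //.
  exact: measurable_coord.
- by move=> x; rewrite lee_fin prodr_ge0.
- by rewrite lee_fin.
- by apply/measurable_EFinP; exact: mf.
Qed.

Lemma fint_cst0 n (s : seq 'I_n) : fint s (fun=> 0 : \bar R) = fun=> 0.
Proof. by elim: s => //= j s ->; apply/funext => x; rewrite integral0. Qed.

Lemma measurable_dot n d (Z : measurableType d) (u v : Z -> 'cV[R]_n) :
  measurable_fun setT u -> measurable_fun setT v ->
  measurable_fun setT (fun z => dot (u z) (v z) : RB).
Proof.
move=> mu' mv; apply: measurable_sum => j; apply: measurable_funM.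
  by apply: (@measurableT_comp _ _ _ _ _ _ (fun X : 'cV[R]_n => X j ord0 : RB)) => //; exact: measurable_coord.
by apply: (@measurableT_comp _ _ _ _ _ _ (fun X : 'cV[R]_n => X j ord0 : RB)) => //; exact: measurable_coord.
Qed.

Lemma measurable_hyperplane n (a : 'cV[R]_n) (b : R) :
  measurable [set x : 'cV[R]_n | dot a x = b].
Proof.
have m := measurable_dot (measurable_cst a) (@measurable_id _ 'cV[R]_n setT).
have := m measurableT _ (measurable_set1 b).
by rewrite setTI.
Qed.

Lemma iint_hyperplane n (a : 'cV[R]_n) (b : R) : a != 0%R ->
  iint (fun x => (\1_[set x : 'cV[R]_n | dot a x = b] x)%:E) = 0.
Proof.
move=> /eqP a0; have [j aj] : exists j, a j ord0 != 0%R.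
  apply: contrapT => /forallNP h; apply: a0; apply/matrixP => i k.
  by rewrite ord1 mxE; apply/eqP/negP => /negP; exact: h.
set f := fun x => _.
have mf : measurable_fun setT f.
  by apply/measurable_EFinP; apply: measurable_indic; exact: measurable_hyperplane.
have f0 x : 0 <= f x by rewrite lee_fin.
(* A coordinate j with [a j ord0] nonzero is moved innermost; on each line in that direction the
   hyperplane is a single point. *)
rewrite (iint_fint f 0) (fint_perm mf f0 (s2 := rem j (enum 'I_n) ++ [:: j])); last first.
  by rewrite perm_sym cats1 perm_rcons perm_sym perm_to_rem// mem_enum.
rewrite fint_cat (_ : fint [:: j] f = fun=> 0) ?fint_cst0//.
apply/funext => x /=.
pose c := (\sum_(i | i != j) a i ord0 * x i ord0)%R.
have E t : f (upd x j ord0 t) = (\1_[set ((b - c) / a j ord0)%R] t)%:E.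
  rewrite /f !indicE.
  suff -> : (upd x j ord0 t \in [set x : 'cV[R]_n | dot a x = b]) =
            (t \in [set ((b - c) / a j ord0)%R]) by [].
  apply/idP/idP; rewrite !inE /=.
    rewrite /dot (bigD1 j)//= mxE !eqxx /= => h; rewrite -h.
    rewrite (_ : \sum_(i < n | i != j) _ = c)%R; first by field.
    by apply: eq_bigr => i /negPf ij; rewrite mxE ij.
  move=> ->; rewrite /dot (bigD1 j)//= mxE !eqxx /=.
  rewrite (_ : \sum_(i < n | i != j) _ = c)%R; first by field.
  by apply: eq_bigr => i /negPf ij; rewrite mxE ij.
under eq_integral do rewrite E.
by rewrite integral_indic//= setIT lebesgue_measure_set1.
Qed.

Lemma ae_eq_iint n (f g : 'cV[R]_n -> \bar R) (N : set 'cV[R]_n) :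
  measurable_fun setT f -> measurable_fun setT g -> (forall x, 0 <= f x) ->
  (forall x, 0 <= g x) -> measurable N -> iint (fun x => (\1_N x)%:E) = 0 ->
  (forall x, ~ N x -> f x = g x) -> iint f = iint g.
Proof.
move=> mf mg f0 g0 mN N0 fg.
have mI : measurable_fun setT (fun x : 'cV[R]_n => (\1_N x)%:E : \bar R).
  by apply/measurable_EFinP; exact: measurable_indic.
have I0 x : 0 <= (\1_N x)%:E :> \bar R by rewrite lee_fin.
have H (u v : 'cV[R]_n -> \bar R) : measurable_fun setT u -> measurable_fun setT v ->
    (forall x, 0 <= u x) -> (forall x, 0 <= v x) ->
    (forall x, ~ N x -> u x = v x) -> iint u <= iint v.
  move=> mu' mv u0 v0 uv.
  (* Adding +oo times the indicator of the null set dominates [u] everywhere and costs nothing,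
     since +oo * 0 = 0. *)
  apply: (@le_trans _ _ (iint (fun x => v x + +oo * (\1_N x)%:E))).
    apply: le_iint => //.
      apply: emeasurable_funD => //; apply: emeasurable_funM => //.
    move=> x; rewrite indicE; have [/set_mem Nx|/negP Nx] := boolP (x \in N).
      by rewrite mule1 addey ?leey// gt_eqF// (lt_le_trans _ (v0 x)).
    by rewrite mule0 adde0 uv// => Nx'; apply: Nx; exact: mem_set.
  rewrite iintD//; try (by apply: emeasurable_funM => //); try by move=> x; rewrite mule_ge0.
  by rewrite iintZl// N0 mule0 adde0.
apply/eqP; rewrite eq_le !H// => x Nx; exact/esym/fg.
Qed.

End iint_sets.

(** * Convex hulls and separation *)

Section dot_product.
Variables (R : realType) (n : nat).
Implicit Types u v w : 'cV[R]_n.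

Lemma dotC u v : dot u v = dot v u.
Proof. by apply: eq_bigr => i _; rewrite mulrC. Qed.

Lemma dotDr u v w : dot u (v + w) = dot u v + dot u w.
Proof. by rewrite /dot -big_split /=; apply: eq_bigr => i _; rewrite mxE mulrDr. Qed.

Lemma dotZr a u v : dot u (a *: v) = a * dot u v.
Proof. by rewrite /dot mulr_sumr; apply: eq_bigr => i _; rewrite mxE mulrCA. Qed.

Lemma dotNr u v : dot u (- v) = - dot u v.
Proof. by rewrite -scaleN1r dotZr mulN1r. Qed.

Lemma dotBr u v w : dot u (v - w) = dot u v - dot u w.
Proof. by rewrite dotDr dotNr. Qed.

Lemma dotDl u v w : dot (v + w) u = dot v u + dot w u.
Proof. by rewrite dotC dotDr !(dotC u). Qed.

Lemma dotZl a u v : dot (a *: u) v = a * dot u v.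
Proof. by rewrite dotC dotZr dotC. Qed.

Lemma dot0r u : dot u 0 = 0.
Proof. by rewrite /dot big1// => i _; rewrite mxE mulr0. Qed.

Lemma dot_sumr (I : Type) (s : seq I) (P : pred I) (F : I -> 'cV[R]_n) u :
  dot u (\sum_(i <- s | P i) F i) = \sum_(i <- s | P i) dot u (F i).
Proof. by apply: (big_morph _ (dotDr u) (dot0r u)). Qed.

Lemma sqnorm_dot u : sqnorm u = dot u u.
Proof. by apply: eq_bigr => i _; rewrite expr2. Qed.

Lemma sqnorm_ge0 u : 0 <= sqnorm u.
Proof. by apply: sumr_ge0 => i _; rewrite sqr_ge0. Qed.

Lemma sqnorm_eq0 u : sqnorm u = 0 -> u = 0.
Proof.
move=> /eqP; rewrite psumr_eq0; last by move=> i _; rewrite sqr_ge0.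
move=> /allP h; apply/matrixP => i j; rewrite ord1 mxE.
by have := h i (mem_index_enum _); rewrite /= sqrf_eq0 => /eqP.
Qed.

Lemma sqnormD u v : sqnorm (u + v) = sqnorm u + 2 * dot u v + sqnorm v.
Proof. by rewrite !sqnorm_dot dotDr !dotDl (dotC v u); ring. Qed.

Lemma sqnormZ a u : sqnorm (a *: u) = a ^+ 2 * sqnorm u.
Proof. by rewrite !sqnorm_dot dotZr dotZl mulrA expr2. Qed.

Lemma measurable_sqnorm d (Z : measurableType d) (f : Z -> 'cV[R]_n) :
  measurable_fun setT f -> measurable_fun setT (fun z => sqnorm (f z) : measurableTypeR R).
Proof. by move=> mf; under eq_fun do rewrite sqnorm_dot; exact: measurable_dot. Qed.

End dot_product.

Section hull.
Variables (R : realType) (n : nat) (I : finType).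
Implicit Type p : I -> 'cV[R]_n.
Local Notation RB := (measurableTypeR R).

Lemma hull_convex p x y (t : R) : convex_hull p x -> convex_hull p y -> 0 <= t <= 1 ->
  convex_hull p (t *: x + (1 - t) *: y).
Proof.
move=> [l [l0 [l1 ->]]] [k [k0 [k1 ->]]] /andP[t0 t1].
exists (fun i => t * l i + (1 - t) * k i); split; last split.
- by move=> i; rewrite addr_ge0// mulr_ge0// subr_ge0.
- by rewrite big_split /= -!mulr_sumr l1 k1 !mulr1 subrKC.
- rewrite !scaler_sumr -big_split /=; apply: eq_bigr => i _.
  by rewrite !scalerA -scalerDl.
Qed.

Lemma hull_vertex p i : convex_hull p (p i).
Proof.
exists (fun j => (j == i)%:R); split; last split.
- by move=> j; rewrite ler0n.
- by rewrite (bigD1 i)//= eqxx big1 ?addr0// => j /negPf ->.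
- by rewrite (bigD1 i)//= eqxx scale1r big1 ?addr0// => j /negPf ->; rewrite scale0r.
Qed.

(** The hull is the continuous image of the standard simplex, a closed subset of a cube of row
    vectors. *)
Lemma hull_compact p : compact (convex_hull p).
Proof.
pose k := #|I|.
pose D := [set l : 'rV[R]_k | forall i, `[0, 1]%classic (l ord0 i)].
pose S := [set l : 'rV[R]_k | \sum_i l ord0 i = 1].
pose phi := fun l : 'rV[R]_k => \sum_(i : I) l ord0 (enum_rank i) *: p i.
have -> : convex_hull p = phi @` (D `&` S).
  apply/seteqP; split => x.
    move=> [l [l0 [l1 ->]]]; exists (\row_i l (enum_val i)).
      split => [i|] /=.
        rewrite mxE in_itv /= l0 /=.
        by rewrite -l1 (bigD1 (enum_val i))//= lerDl sumr_ge0.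
      rewrite /S /= -[RHS]l1 [RHS](reindex (@enum_val I I)) /=; last first.
        by exists enum_rank => i _; rewrite ?enum_valK ?enum_rankK.
      by apply: eq_bigr => i _; rewrite mxE.
    by apply: eq_bigr => i _; rewrite mxE enum_rankK.
  move=> [l [Dl Sl] <-]; exists (fun i => l ord0 (enum_rank i)); split; last split => //.
    by move=> i; have := Dl (enum_rank i); rewrite /= in_itv /= => /andP[].
  rewrite -[RHS]Sl [RHS](reindex (@enum_rank I)) //=.
  by exists enum_val => i _; rewrite ?enum_valK ?enum_rankK.
apply: continuous_compact.
  apply: continuous_subspaceT => l.
  apply: (@continuous_big _ _ _ _ _ _ _ _ (fun i (l : 'rV[R]_k) => l ord0 (enum_rank i) *: p i)).
    exact: add_continuous.
  move=> i _ l'.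
  apply: (@continuous_comp _ _ _ (fun l : 'rV[R]_k => l ord0 (enum_rank i)) (fun t => t *: p i)).
    exact: coord_continuous.
  exact: scalel_continuous.
apply: compact_closedI.
  by apply: (@rV_compact R k (fun=> [set` `[0 : R, 1]])) => i; exact: segment_compact.
apply: (@closed_comp _ _ (fun l : 'rV[R]_k => \sum_i l ord0 i) [set x | x = 1]); last exact: closed_eq.
move=> l _; apply: (@continuous_big _ _ _ _ _ _ _ _ (fun i (l : 'rV[R]_k) => l ord0 i)).
  exact: add_continuous.
by move=> i _; exact: coord_continuous.
Qed.

(** Strictness at every vertex makes the condition open in [th], so rational functionals suffice and
    measurability follows. With finitely many vertices it is still the exact complement of the
    hull. *)
Definition strictly_separated p (x : 'cV[R]_n) := exists th, forall i, 0 < dot th (p i - x).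

Lemma separated_notin p x : strictly_separated p x -> ~ convex_hull p x.
Proof.
move=> [th h] [l [l0 [l1 xE]]].
have : 0 < \sum_i l i * dot th (p i - x).
  have [i li] : exists i, l i != 0.
    apply: contrapT => /forallNP h'.
    have : \sum_i l i = 0 by apply: big1 => i _; apply/eqP/negP => /negP; exact: h'.
    by move/eqP; rewrite l1 oner_eq0.
  have li0 : 0 < l i by rewrite lt0r li l0.
  rewrite (bigD1 i)//= ltr_wpDr ?mulr_gt0//.
  by apply: sumr_ge0 => j _; rewrite mulr_ge0// ltW.
have -> : \sum_i l i * dot th (p i - x) = dot th (\sum_i l i *: p i - (\sum_i l i) *: x).
  rewrite scaler_suml -sumrB dot_sumr; apply: eq_bigr => i _.
  by rewrite -scalerBr dotZr.
by rewrite l1 scale1r -xE subrr dot0r ltxx.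
Qed.

(** The functional is [y0 - x] for the point [y0] of the hull closest to [x]: were some vertex on
    the wrong side of [y0], a small move towards it would come closer. *)
Lemma notin_separated p x : ~ convex_hull p x -> strictly_separated p x.
Proof.
move=> nx; have [i0|noI] := pselect (exists i : I, True); last first.
  by exists 0 => i; exfalso; apply: noI; exists i.
case: i0 => i0 _.
have [] := @compact_EVT_min 'cV[R]_n R (fun y : 'cV[R]_n => sqnorm (y - x)) (convex_hull p).
- by exists (p i0); exact: hull_vertex.
- exact: hull_compact.
- apply: continuous_subspaceT => y.
  apply: (@continuous_big _ _ _ _ _ _ _ _ (fun i (y : 'cV[R]_n) => (y - x) i ord0 ^+ 2)).
    exact: add_continuous.
  move=> i _ z.
  apply: (@continuous_comp _ _ _ (fun y : 'cV[R]_n => (y - x) i ord0) (fun t => t ^+ 2)); last exact: exprn_continuous.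
  have -> : (fun y : 'cV[R]_n => (y - x) i ord0) = fun y => y i ord0 - x i ord0.
    by apply/funext => y'; rewrite !mxE.
  by apply: continuousB; [exact: coord_continuous|exact: cst_continuous].
move=> y0 /set_mem Ky0 ymin; set th := y0 - x.
have th0 : 0 < sqnorm th.
  rewrite lt0r sqnorm_ge0 andbT; apply/eqP => /sqnorm_eq0 /eqP.
  by rewrite subr_eq0 => /eqP e; apply: nx; rewrite -e.
exists th => i.
have -> : p i - x = (p i - y0) + th by rewrite /th addrA subrK.
rewrite dotDr -sqnorm_dot ltr_wpDl//.
rewrite leNgt; apply/negP; set a := dot _ _ => a0.
pose b := sqnorm (p i - y0); have b0 : 0 <= b by exact: sqnorm_ge0.
(* This step lies in (0, 1] and satisfies t b <= - a, so the change 2 t a + t^2 b of the squared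
   distance is at most t a < 0. *)
pose t := (- a) / (b - a).
have ba0 : 0 < b - a by lra.
have t0 : 0 < t by rewrite divr_gt0//; lra.
have t1 : t <= 1 by rewrite ler_pdivrMr// mul1r; lra.
have := ymin (t *: p i + (1 - t) *: y0).
rewrite mem_set; last by apply: hull_convex => //; [exact: hull_vertex|rewrite ltW].
move=> /(_ isT).
have -> : t *: p i + (1 - t) *: y0 - x = th + t *: (p i - y0).
  by rewrite /th scalerBl scalerBr scale1r !addrA; apply/matrixP => k l; rewrite !mxE; ring.
rewrite (sqnormD th) dotZr sqnormZ -/a -/b leNgt => /negP; apply.
have tb : t * (b - a) = - a by rewrite divfK// gt_eqF.
have ta : t * a <= 0 by rewrite mulr_ge0_le0// ltW.
have h : t * b <= - a by rewrite mulrBr in tb; lra.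
 rewrite -addrA gtrDl expr2.
have -> : 2 * (t * a) + t * t * b = t * (2 * a + t * b) by ring.
by rewrite pmulr_rlt0//; lra.
Qed.

Lemma separated_rat p x : strictly_separated p x ->
  exists q : 'cV[rat]_n, forall i, 0 < dot (map_mx ratr q) (p i - x).
Proof.
move=> [th h].
pose M i := \sum_j `|(p i - x) j ord0|.
(* [del] is below every ratio of the margin [dot th (p i - x)] to [M i + 1], so a perturbation of
   [th] by less than [del] per coordinate keeps all margins positive. The final + 1 keeps the sum
   positive when [I] is empty. *)
pose del := (\sum_i (M i + 1) / dot th (p i - x) + 1)^-1.
have M0 i : 0 <= M i by apply: sumr_ge0.
have S0 : 0 <= \sum_i (M i + 1) / dot th (p i - x).
  by apply: sumr_ge0 => i _; rewrite divr_ge0// ?addr_ge0// ltW.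
have del0 : 0 < del by rewrite invr_gt0 ltr_wpDl.
have delM i : del * M i < dot th (p i - x).
  rewrite mulrC -ltr_pdivlMr// invrK mulrDr mulr1.
  rewrite (bigD1 i)//= mulrDr [_ * (_ / _)]mulrC divfK ?gt_eqF//.
  have a0 := h i; have : 0 <= dot th (p i - x) * \sum_(i0 | i0 != i) (M i0 + 1) / dot th (p i0 - x).
    apply: mulr_ge0; first exact: ltW.
    by apply: sumr_ge0 => k _; apply: divr_ge0; [rewrite addr_ge0|exact: ltW].
  by lra.
have /choice[q hq] : forall j, exists q : rat, th j ord0 < ratr q < th j ord0 + del.
  move=> j.
  have : th j ord0 < th j ord0 + del by rewrite ltrDl.
  by move=> /rat_in_itvoo[r]; rewrite in_itv /=; exists r.
exists (\col_j q j) => i.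
have : `|dot (map_mx ratr (\col_j q j)) (p i - x) - dot th (p i - x)| <= del * M i.
  rewrite /dot -sumrB mulr_sumr; apply: le_trans (ler_norm_sum _ _ _) _.
  apply: ler_sum => j _; rewrite !mxE -mulrBl normrM ler_wpM2r//.
  by have /andP[h1 h2] := hq j; rewrite ger0_norm; lra.
by rewrite ler_norml => /andP[h1 _]; have := delM i; lra.
Qed.

(** Countable union over rational functionals of finite intersections of half-space conditions. *)
Lemma measurable_separated d (Z : measurableType d) (p : Z -> I -> 'cV[R]_n) (x : Z -> 'cV[R]_n) :
  (forall i, measurable_fun setT (fun z => p z i)) -> measurable_fun setT x ->
  measurable [set z | strictly_separated (p z) (x z)].
Proof.
move=> mp mx.
have -> : [set z | strictly_separated (p z) (x z)] =
  \bigcup_(q : 'cV[rat]_n) \bigcap_(i : I) [set z | 0 < dot (map_mx ratr q) (p z i - x z)].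
  apply/seteqP; split => z.
    by move=> /separated_rat[q hq]; exists q => // i _; exact: hq.
  by move=> [q _ hq]; exists (map_mx ratr q) => i; exact: hq.
apply: countable_bigcupT_measurable => // q.
apply: fin_bigcap_measurable => // i _.
have m : measurable_fun setT (fun z => dot (map_mx ratr q) (p z i - x z) : RB).
  apply: measurable_dot => //; apply: measurable_mxP => k l.
  under eq_fun do rewrite !mxE.
  apply: measurable_funB.
    by apply: (@measurableT_comp _ _ _ _ _ _ (fun X : 'cV[R]_n => X k l : RB)) => //; exact: measurable_coord.
  by apply: (@measurableT_comp _ _ _ _ _ _ (fun X : 'cV[R]_n => X k l : RB)) => //; exact: measurable_coord.
have := m measurableT `]0, +oo[%classic (measurable_itv _).
by rewrite setTI; congr measurable; apply/seteqP; split => z /=; rewrite in_itv /= andbT.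
Qed.

Lemma hullE p : convex_hull p = ~` [set x | strictly_separated p x].
Proof.
apply/seteqP; split => x.
  by move=> Kx /= /separated_notin.
by move=> /= ns; apply: contrapT => /notin_separated.
Qed.

Lemma measurable_hull p : measurable (convex_hull p).
Proof.
by rewrite hullE; apply: measurableC; apply: measurable_separated.
Qed.

End hull.

(** * Second moments of a simplex *)

Section barycentric.
Variables (R : realType) (n : nat).
Local Notation RB := (measurableTypeR R).
Local Open Scope ereal_scope.

(** Homogeneous coordinates: affine maps of R^n become matrices of size n + 1, and barycentric
    coordinates become linear. *)
Definition homog (y : 'cV[R]_n) : 'cV[R]_(1 + n) := col_mx (const_mx 1%R) y.

Lemma measurable_homog d (Z : measurableType d) (f : Z -> 'cV[R]_n) :
  measurable_fun setT f -> measurable_fun setT (fun z => homog (f z)).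
Proof. by move=> mf; exact: (@measurable_col_mx R n _ Z (cst 1%R) f). Qed.

Lemma measurable_mulmx m k d (Z : measurableType d) (A : 'M[R]_(m, k))
    (f : Z -> 'cV[R]_k) : measurable_fun setT f ->
  measurable_fun setT (fun z => (A *m f z)%R).
Proof.
move=> mf; have := @measurable_mulmx_add R m k _ Z A 0%R f mf.
by apply: eq_measurable_fun => z _; rewrite addr0.
Qed.

(** The top row of [C] is that of the identity, so [C] acts on homogeneous vectors as an affine map
    whose linear part, the lower right block, has the same determinant. *)
Lemma iint_homog (C : 'M[R]_(1 + n)) (g : 'cV[R]_(1 + n) -> \bar R) :
  (forall k, C ord0 k = (k == ord0)%:R) -> \det C != 0%R ->
  measurable_fun setT g -> (forall x, 0 <= g x) ->
  iint (fun y => g (C *m homog y)) = (`|\det C|^-1)%:E * iint (fun y => g (homog y)).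
Proof.
move=> C0 detC mg g0.
have ul : ulsubmx C = 1%:M.
  apply/matrixP => i j; rewrite !mxE !ord1.
  rewrite (_ : lshift n (0 : 'I_1)%R = ord0); last exact/val_inj.
  by rewrite C0 eqxx.
have ur : ursubmx C = 0%R.
  apply/matrixP => i j; rewrite !mxE ord1.
  rewrite (_ : lshift n (0 : 'I_1)%R = ord0); last exact/val_inj.
  by rewrite C0.
have CE : C = block_mx 1%:M 0 (dlsubmx C) (drsubmx C) by rewrite -ul -ur submxK.
have detE : \det C = \det (drsubmx C).
  by rewrite CE det_lblock det1 mul1r block_mxKdr.
rewrite detE -(@iint_linear R n _ (fun y => g (homog y)) (dlsubmx C *m const_mx 1%R))//.
- apply: eq_iint => y; congr g; rewrite {1}CE /homog mul_block_col mul1mx mul0mx addr0.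
  by rewrite [X in col_mx _ X]addrC.
- by rewrite -detE.
- by apply: measurableT_comp => //; exact: measurable_homog.
Qed.

(* [sum_mx] maps barycentric coordinates l on the standard simplex to (\sum l, l_1, ..., l_n). *)
Definition sum_mx : 'M[R]_(1 + n) := block_mx 1%:M (const_mx 1%R) 0 1%:M.

Lemma det_sum_mx : \det sum_mx = 1%R.
Proof. by rewrite /sum_mx det_ublock !det1 mulr1. Qed.

Lemma sum_mx_unit : sum_mx \in unitmx.
Proof. by rewrite unitmxE det_sum_mx unitr1. Qed.

Lemma sum_mx0 k : sum_mx ord0 k = 1%R.
Proof.
rewrite (_ : ord0 = lshift n (ord0 : 'I_1)); last exact/val_inj.
rewrite -[k]splitK; case: (fintype.split k) => j /=.
  by rewrite block_mxEul mxE !ord1 eqxx.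
by rewrite block_mxEur mxE.
Qed.

Definition lam (y : 'cV[R]_n) : 'cV[R]_(1 + n) := invmx sum_mx *m homog y.

Lemma measurable_lam d (Z : measurableType d) (f : Z -> 'cV[R]_n) :
  measurable_fun setT f -> measurable_fun setT (fun z => lam (f z)).
Proof. by move=> mf; apply: measurable_mulmx; exact: measurable_homog. Qed.

Lemma sum_lam y : (\sum_i lam y i ord0 = 1)%R.
Proof.
have : (sum_mx *m lam y) ord0 ord0 = 1%R.
  rewrite /lam mulKVmx ?sum_mx_unit// /homog.
  rewrite (_ : ord0 = lshift n (ord0 : 'I_1)); last exact/val_inj.
  by rewrite col_mxEu mxE.
by rewrite mxE; under eq_bigr do rewrite sum_mx0 mul1r.
Qed.

Lemma lamE y : lam y = col_mx (const_mx (1 - \sum_i y i ord0)%R) y.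
Proof.
apply: (@row_full_inj R _ _ _ sum_mx); first by rewrite row_full_unit sum_mx_unit.
rewrite /lam mulKVmx ?sum_mx_unit// /homog /sum_mx mul_block_col !mul1mx mul0mx add0r.
congr col_mx; apply/matrixP => i j; rewrite !mxE.
rewrite [X in (_ + X)%R](eq_bigr (fun k => y k ord0)) ?subrK// => k _.
by rewrite mxE mul1r [j]ord1.
Qed.

(** Columns of sum one mean that [T] preserves the hyperplane of barycentric vectors; conjugation by
    [sum_mx] reduces to [iint_homog]. *)
Lemma iint_lam (T : 'M[R]_(1 + n)) (g : 'cV[R]_(1 + n) -> \bar R) :
  (forall k, \sum_i T i k = 1)%R -> \det T != 0%R ->
  measurable_fun setT g -> (forall x, 0 <= g x) ->
  iint (fun y => g (T *m lam y)) = (`|\det T|^-1)%:E * iint (fun y => g (lam y)).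
Proof.
move=> T1 detT mg g0.
pose C := sum_mx *m T *m invmx sum_mx.
have detC : \det C = \det T.
  by rewrite !det_mulmx det_inv det_sum_mx invr1 mulr1 mul1r.
have sT k : (sum_mx *m T) ord0 k = sum_mx ord0 k.
  by rewrite mxE sum_mx0 -[RHS](T1 k); apply: eq_bigr => i _; rewrite sum_mx0 mul1r.
rewrite -detC -(@iint_homog C (fun l => g (invmx sum_mx *m l)))//.
- apply: eq_iint => y; congr g; rewrite /C /lam !mulmxA mulVmx ?sum_mx_unit// mul1mx//.
- move=> k; rewrite /C mxE; under eq_bigr do rewrite sT.
  have := congr1 (fun M : 'M[R]_(1 + n) => M ord0 k) (mulmxV sum_mx_unit).
  by rewrite mxE => ->; rewrite mxE eq_sym.
- by rewrite detC.
- by apply: measurableT_comp => //; exact: measurable_mulmx.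
Qed.

Definition lift_mx (P : 'I_(1 + n) -> 'cV[R]_n) : 'M[R]_(1 + n) :=
  \matrix_(i, k) homog (P k) i ord0.

Lemma lift_mx0 P k : lift_mx P ord0 k = 1%R.
Proof.
rewrite mxE /homog (_ : ord0 = lshift n (ord0 : 'I_1)); last exact/val_inj.
by rewrite col_mxEu mxE.
Qed.

Definition bary P x : 'cV[R]_(1 + n) := invmx (lift_mx P) *m homog x.

Lemma measurable_bary P d (Z : measurableType d) (f : Z -> 'cV[R]_n) :
  measurable_fun setT f -> measurable_fun setT (fun z => bary P (f z)).
Proof. by move=> mf; apply: measurable_mulmx; exact: measurable_homog. Qed.

Lemma lift_mxM P (l : 'cV[R]_(1 + n)) :
  lift_mx P *m l = col_mx (const_mx (\sum_i l i ord0)%R) (\sum_i l i ord0 *: P i)%R.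
Proof.
apply/matrixP => i j; rewrite [j]ord1 mxE -[i]splitK.
case: (fintype.split i) => k /=.
  rewrite col_mxEu !mxE; apply: eq_bigr => a _; rewrite mxE /homog col_mxEu mxE mul1r //.
rewrite col_mxEd summxE; apply: eq_bigr => a _; rewrite mxE [in RHS]mxE /homog col_mxEd mulrC //.
Qed.

Lemma lift_mx_bary P x : \det (lift_mx P) != 0%R ->
  (\sum_i bary P x i ord0 = 1)%R /\ x = (\sum_i bary P x i ord0 *: P i)%R.
Proof.
move=> dP; have uP : lift_mx P \in unitmx by rewrite unitmxE unitfE.
have := lift_mxM P (bary P x); rewrite /bary mulKVmx// => /eq_col_mx[e1 e2].
split; last by rewrite {1}e2.
by move/(congr1 (fun M : 'cV[R]_1 => M ord0 ord0)): e1; rewrite !mxE.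
Qed.

Lemma bary_unique P (l : 'cV[R]_(1 + n)) : \det (lift_mx P) != 0%R ->
  (\sum_i l i ord0 = 1)%R -> bary P (\sum_i l i ord0 *: P i)%R = l.
Proof.
move=> dP l1; have uP : lift_mx P \in unitmx by rewrite unitmxE unitfE.
have := lift_mxM P l; rewrite l1 -/(homog _) /bary => <-.
by rewrite mulKmx.
Qed.

Lemma iint_bary P (g : 'cV[R]_(1 + n) -> \bar R) : \det (lift_mx P) != 0%R ->
  measurable_fun setT g -> (forall x, 0 <= g x) ->
  iint (fun x => g (bary P x)) = (`|\det (lift_mx P)|)%:E * iint (fun y => g (lam y)).
Proof.
move=> dP mg g0; have uP : lift_mx P \in unitmx by rewrite unitmxE unitfE.
pose C := sum_mx *m invmx (lift_mx P).
have detC : \det C = ((\det (lift_mx P))^-1)%R.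
  by rewrite det_mulmx det_inv det_sum_mx mul1r.
have -> : (`|\det (lift_mx P)|)%R = (`|\det C|^-1)%R.
  by rewrite detC normfV invrK.
rewrite -(@iint_homog C (fun l => g (invmx sum_mx *m l)))//.
- apply: eq_iint => x; congr g; rewrite /C /bary !mulmxA mulVmx ?sum_mx_unit// mul1mx//.
- move=> k; rewrite /C mxE.
  have := congr1 (fun M : 'M[R]_(1 + n) => M ord0 k) (mulmxV uP).
  rewrite mxE => h; rewrite [RHS](_ : _ = (1%:M : 'M[R]_(1 + n)) ord0 k); last by rewrite mxE eq_sym.
  by rewrite -h; apply: eq_bigr => i _; rewrite sum_mx0 lift_mx0.
- by rewrite detC invr_neq0.
- by apply: measurableT_comp => //; exact: measurable_mulmx.
Qed.

End barycentric.

Lemma indic_in {T : Type} {R : realType} (A : set T) x : A x -> \1_A x = 1 :> R.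
Proof. by move=> Ax; rewrite indicE mem_set. Qed.

Lemma indic_notin {T : Type} {R : realType} (A : set T) x : ~ A x -> \1_A x = 0 :> R.
Proof. by move=> Ax; rewrite indicE memNset. Qed.

Lemma sum_delta {R : realType} {I : finType} (k : I) (F : I -> R) :
  \sum_m (m == k)%:R * F m = F k.
Proof. by rewrite (bigD1 k)//= eqxx mul1r big1 ?addr0// => m /negPf ->; rewrite mul0r. Qed.

Section moments.
Variables (R : realType) (n : nat).
Local Notation RB := (measurableTypeR R).
Local Notation vec := 'cV[R]_(1 + n).
Local Open Scope ereal_scope.

Definition orthant : set vec := [set l | forall k, (0 <= l k ord0)%R].

Lemma measurable_le_fun d (Z : measurableType d) (f g : Z -> RB) :
  measurable_fun setT f -> measurable_fun setT g -> measurable [set z | (f z <= g z)%R].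
Proof.
move=> mf mg; have := measurable_fun_ler mf mg.
move=> /(_ measurableT [set true] I); rewrite setTI.
by congr measurable; apply/seteqP; split.
Qed.

Lemma measurable_lt_fun d (Z : measurableType d) (f g : Z -> RB) :
  measurable_fun setT f -> measurable_fun setT g -> measurable [set z | (f z < g z)%R].
Proof.
move=> mf mg; have := measurable_fun_ltr mf mg.
move=> /(_ measurableT [set true] I); rewrite setTI.
by congr measurable; apply/seteqP; split.
Qed.

Lemma measurable_orthant : measurable orthant.
Proof.
have -> : orthant = \bigcap_(k : 'I_(1 + n)) [set l : vec | (0 <= l k ord0)%R].
  by apply/seteqP; split => l h k; [move=> _; exact: h|exact: h].
apply: fin_bigcap_measurable => // k _.
by apply: measurable_le_fun => //; exact: measurable_coord.
Qed.

Let mI (A : set vec) : measurable A -> measurable_fun setT (fun l : vec => \1_A l : RB).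
Proof. by move=> mA; exact: measurable_indic. Qed.

(** On barycentric vectors a linear form with coefficients not all equal is a nonconstant affine
    function of [y], so its zeros form a hyperplane. *)
Lemma lam_null (c : 'I_(1 + n) -> R) : (exists i j, c i <> c j) ->
  measurable [set y : 'cV[R]_n | (\sum_i c i * lam y i ord0 = 0)%R] /\
  iint (fun y : 'cV[R]_n => (\1_[set y | (\sum_i c i * lam y i ord0 = 0)%R] y)%:E) = 0.
Proof.
move=> [i [j cij]].
pose a : 'cV[R]_n := (\col_k (c (rshift 1 k) - c ord0))%R.
have E y : (\sum_i c i * lam y i ord0 = c ord0 + dot a y)%R.
  rewrite lamE big_split_ord /= big_ord1 col_mxEu mxE.
  rewrite (_ : lshift n ord0 = ord0); last exact/val_inj.
  rewrite [X in (_ + X)%R](eq_bigr (fun k => c (rshift 1 k) * y k ord0)%R); last first.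
    by move=> k _; rewrite col_mxEd.
  rewrite mulrBr mulr1 -addrA; congr (_ + _)%R.
  rewrite addrC mulr_sumr -sumrB; apply: eq_bigr => k _.
  by rewrite mxE mulrBl.
have -> : [set y | (\sum_i c i * lam y i ord0 = 0)%R] = [set y | dot a y = (- c ord0)%R].
  by apply/seteqP; split => y /=; rewrite E; lra.
split; first exact: measurable_hyperplane.
apply: iint_hyperplane; apply/eqP => a0; apply: cij.
have H k : c k = c ord0.
  rewrite -[k]splitK; case: (fintype.split k) => k' /=.
    by congr c; apply/val_inj; rewrite /= ord1.
  have := congr1 (fun M : 'cV[R]_n => M k' ord0) a0.
  by rewrite !mxE => /eqP; rewrite subr_eq0 => /eqP.
by rewrite H (H j).
Qed.

Definition Mom (i j : 'I_(1 + n)) : \bar R :=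
  iint (fun y : 'cV[R]_n => (\1_orthant (lam y) * (lam y i ord0 * lam y j ord0))%:E).

(** The volume 1/n! of the standard simplex; it enters only through the bounds n^(-n) and 1. *)
Definition Wsimp : \bar R := iint (fun y : 'cV[R]_n => (\1_orthant (lam y))%:E).

Let mc i : measurable_fun setT (fun l : vec => l i ord0 : RB).
Proof. exact: measurable_coord. Qed.

Let mg (A : set vec) i j : measurable A ->
  measurable_fun setT (fun l : vec => (\1_A l * (l i ord0 * l j ord0))%:E : \bar R).
Proof.
move=> mA; apply/measurable_EFinP; apply: measurable_funM; first exact: mI.
by apply: measurable_funM; exact: mc.
Qed.

Let mlam (g : vec -> \bar R) : measurable_fun setT g ->
  measurable_fun setT (fun y : 'cV[R]_n => g (lam y)).
Proof. by move=> m; apply: measurableT_comp => //; exact: measurable_lam. Qed.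

Let pos_ge0 (A : set vec) i j l : A `<=` orthant -> 0 <= (\1_A l * (l i ord0 * l j ord0))%:E.
Proof.
move=> AO; rewrite lee_fin; have [Al|Al] := pselect (A l).
  by rewrite indic_in// mul1r mulr_ge0//; exact: AO.
by rewrite indic_notin// mul0r.
Qed.

Lemma MomC i j : Mom i j = Mom j i.
Proof. by apply: eq_iint => y; rewrite [(lam y i _ * _)%R]mulrC. Qed.

(* Cut the simplex in two through the midpoint of the edge joining the
   vertices i and j; each half is an affine image of the whole. *)
Lemma Mom_split i j : i != j ->
  Mom i j = (1 / 2)%:E * Mom i j + (1 / 4)%:E * Mom j j.
Proof.
move=> ij.
have mO := measurable_orthant.
pose A1 : set vec := orthant `&` [set l | (l j ord0 <= l i ord0)%R].
pose A2 : set vec := orthant `&` [set l | (l i ord0 < l j ord0)%R].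
pose A3 : set vec := orthant `&` [set l | (l j ord0 < l i ord0)%R].
have mA1 : measurable A1 by apply: measurableI => //; exact: measurable_le_fun.
have mA2 : measurable A2 by apply: measurableI => //; exact: measurable_lt_fun.
have mA3 : measurable A3 by apply: measurableI => //; exact: measurable_lt_fun.
have A1O : A1 `<=` orthant by move=> ? [].
have A2O : A2 `<=` orthant by move=> ? [].
have A3O : A3 `<=` orthant by move=> ? [].
pose g A (l : vec) : \bar R := (\1_A l * (l i ord0 * l j ord0))%:E.
have E1 : Mom i j = iint (fun y => g A1 (lam y)) + iint (fun y => g A2 (lam y)).
  rewrite -iintD; first last.
  - by move=> y; exact: pos_ge0.
  - by move=> y; exact: pos_ge0.
  - by apply: mlam; exact: mg.
  - by apply: mlam; exact: mg.
  apply: eq_iint => y; rewrite /g -EFinD -mulrDl; congr (EFin (_ * _)%R).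
  have [oy|noy] := pselect (orthant (lam y)); last first.
    by rewrite !indic_notin ?addr0// => -[].
  have [h|h] := leP (lam y j ord0) (lam y i ord0).
    rewrite indic_in// (@indic_in _ _ A1)// indic_notin ?addr0// => -[_ /=].
    by rewrite ltNge h.
  rewrite indic_in// (@indic_notin _ _ A1) ?indic_in ?add0r// => -[_ /=].
  by rewrite leNgt h.
have rp (l : vec) k : row_perm (tperm i j) l k ord0 = l (tperm i j k) ord0 by rewrite mxE.
have E2 : iint (fun y => g A2 (lam y)) = iint (fun y => g A3 (lam y)).
  have := @iint_lam R n (perm_mx (tperm i j)) (g A3) _ _ (mg _ _ mA3) (fun l => pos_ge0 _ _ _ A3O).
  rewrite det_perm normrX normrN normr1 expr1n invr1 mul1e => <-.
  - apply: eq_iint => y; rewrite -row_permE /g !rp tpermL tpermR.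
    rewrite (mulrC (lam y j ord0)); congr (EFin (_ * _)%R).
    suff e : A3 (row_perm (tperm i j) (lam y)) <-> A2 (lam y).
      have [h|h] := pselect (A2 (lam y)); first by rewrite !indic_in//; exact/e.
      by rewrite !indic_notin// => /e.
    rewrite /A2 /A3 /= !rp tpermL tpermR; split => -[oy h]; split => // k.
      by have := oy (tperm i j k); rewrite rp tpermK.
    by rewrite rp.
  - move=> k; rewrite (bigD1 (tperm i j k))//= !mxE tpermK eqxx big1 ?addr0// => l lk.
    rewrite !mxE; case: eqP => // e; move: lk; rewrite -e tpermK eqxx //.
  - by rewrite expf_neq0// oppr_eq0 oner_eq0.
(* [A1] and [A3] differ only on the hyperplane where the coordinates i and j agree. *)
have E3 : iint (fun y => g A3 (lam y)) = iint (fun y => g A1 (lam y)).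
  pose c k : R := ((k == i)%:R - (k == j)%:R)%R.
  have [|mN N0] := @lam_null c.
    by exists i, j; rewrite /c !eqxx (negPf ij) eq_sym (negPf ij) /= subr0 sub0r => /eqP; rewrite -subr_eq0 opprK -natrD pnatr_eq0.
  apply: (ae_eq_iint _ _ _ _ mN N0).
  - by apply: mlam; exact: mg.
  - by apply: mlam; exact: mg.
  - by move=> y; exact: pos_ge0.
  - by move=> y; exact: pos_ge0.
  move=> y /= ny; rewrite /g; congr (EFin (_ * _)%R).
  have ne : lam y i ord0 != lam y j ord0.
    apply/eqP => e; apply: ny; rewrite /c; under eq_bigr do rewrite mulrBl.
    by rewrite sumrB !sum_delta e subrr.
  suff e : A3 (lam y) <-> A1 (lam y).
    have [h|h] := pselect (A1 (lam y)); first by rewrite !indic_in//; exact/e.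
    by rewrite !indic_notin// => /e.
  split => -[oy h]; split => //=; first exact: ltW.
  by rewrite lt_neqAle eq_sym ne.
(* [T] replaces the vertex j by the midpoint of the edge from i to j: (l_i, l_j) becomes (l_i +
   l_j/2, l_j/2), which maps the simplex onto the half where l_j <= l_i. *)
pose T : 'M[R]_(1 + n) := (1%:M + (1/2) *: delta_mx i j - (1/2) *: delta_mx j j)%R.
have TE (l : vec) k : (T *m l) k ord0 =
    (l k ord0 + (1/2) * (k == i)%:R * l j ord0 - (1/2) * (k == j)%:R * l j ord0)%R.
  rewrite /T mulmxBl mulmxDl mul1mx -!scalemxAl !mxE.
  rewrite (bigD1 j)//= mxE eqxx andbT big1 ?addr0; last first.
    by move=> m /negPf mj; rewrite mxE mj andbF mul0r.
  rewrite (bigD1 j)//= mxE eqxx andbT big1 ?addr0; last first.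
    by move=> m /negPf mj; rewrite mxE mj andbF mul0r.
  by rewrite !mulrA.
have Ti (l : vec) : (T *m l) i ord0 = (l i ord0 + 1/2 * l j ord0)%R.
  by rewrite TE eqxx (negPf ij) mulr1 mulr0 mul0r subr0.
have Tj (l : vec) : (T *m l) j ord0 = (1/2 * l j ord0)%R.
  by rewrite TE eqxx eq_sym (negPf ij) mulr1 mulr0 mul0r addr0; lra.
have Tk (l : vec) k : k != i -> k != j -> (T *m l) k ord0 = l k ord0.
  by move=> /negPf ki /negPf kj; rewrite TE ki kj !mulr0 !mul0r subr0 addr0.
have detT : \det T = (1 / 2)%R.
  rewrite (expand_det_row _ j) (bigD1 j)//= big1 ?addr0.
    rewrite /cofactor -signr_odd addnn odd_double expr0 mul1r.
    rewrite (_ : row' j (col' j T) = 1%:M).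
      by rewrite det1 mulr1 !mxE !eqxx /= eq_sym (negPf ij) /=; lra.
    apply/matrixP => a b; rewrite !mxE (inj_eq (@lift_inj _ j)).
    rewrite ![_ == j]eq_sym !(negPf (neq_lift _ _)) !andbF !mulr0; lra.
  move=> k /negPf kj; rewrite !mxE kj !andbF eq_sym kj /=; lra.
(* Pulled back by [T], the product l_i l_j becomes l_i l_j / 2 + l_j^2 / 4; the factor 2 is the
   inverse determinant. *)
have E4 : (1/4)%:E * Mom j j + (1/2)%:E * Mom i j = 2%:E * iint (fun y => g A1 (lam y)).
  have := @iint_lam R n T (g A1) _ _ (mg _ _ mA1) (fun l => pos_ge0 _ _ _ A1O).
  rewrite detT (_ : `|1 / 2|^-1 = 2 :> R)%R; last by rewrite ger0_norm; lra.
  move=> <-; first last.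
  - by rewrite div1r invr_neq0.
  - move=> k; rewrite /T; under eq_bigr do rewrite !mxE.
    rewrite sumrB big_split /= -!mulr_sumr.
    have D (a : 'I_(1 + n)) (b : bool) : (\sum_m ((m == a) && b)%:R = b%:R :> R)%R.
      by rewrite (bigD1 a)//= eqxx big1 ?addr0// => m /negPf ->.
    rewrite !D (_ : (\sum_m (m == k)%:R = 1)%R) ?addrK//.
    by have := D k true; under eq_bigr do rewrite andbT.
  rewrite -iintZl; first last.
  - by rewrite lee_fin; lra.
  - by move=> y; exact: pos_ge0.
  - by first [exact: (mlam (mg j j mO)) | exact: (mlam (mg i j mO))].
  rewrite -iintZl; first last.
  - by rewrite lee_fin; lra.
  - by move=> y; exact: pos_ge0.
  - by first [exact: (mlam (mg j j mO)) | exact: (mlam (mg i j mO))].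
  rewrite -iintD; first last.
  - by move=> y; apply: mule_ge0; [rewrite lee_fin; lra|exact: pos_ge0].
  - by move=> y; apply: mule_ge0; [rewrite lee_fin; lra|exact: pos_ge0].
  - by apply: measurable_funeM; first [exact: (mlam (mg j j mO)) | exact: (mlam (mg i j mO))].
  - by apply: measurable_funeM; first [exact: (mlam (mg j j mO)) | exact: (mlam (mg i j mO))].
  apply: eq_iint => y; rewrite /g -!EFinM -EFinD; congr EFin.
  rewrite Ti Tj.
  have -> : \1_A1 (T *m lam y) = \1_orthant (lam y) :> R.
    suff e : A1 (T *m lam y) <-> orthant (lam y).
      have [h|h] := pselect (orthant (lam y)); first by rewrite !indic_in//; exact/e.
      by rewrite !indic_notin// => /e.
    rewrite /A1 /= Ti Tj; split => [[oy h] k|oy].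
      have [->|ki] := eqVneq k i; first by lra.
      have [->|kj] := eqVneq k j; first by have := oy j; rewrite Tj; lra.
      by have := oy k; rewrite Tk.
    split; last by have := oy i; lra.
    move=> k; have [->|ki] := eqVneq k i; first by rewrite Ti; have := oy i; have := oy j; lra.
    have [->|kj] := eqVneq k j; first by rewrite Tj; have := oy j; lra.
    by rewrite Tk.
  by field.
rewrite [RHS]addeC E4 E1 E2 E3.
by rewrite -mule2n mule_natl.
Qed.

End moments.

Section simplex_moments.
Variables (R : realType) (n : nat).
Local Notation RB := (measurableTypeR R).
Local Notation mu := (@lebesgue_measure R).
Local Notation vec := 'cV[R]_(1 + n).
Local Notation Mom := (@Mom R n).
Local Notation Wsimp := (@Wsimp R n).
Local Notation orthant := (@orthant R n).

Lemma iint_cube (a b : R) m : a <= b ->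
  iint (fun x : 'cV[R]_m => (\prod_i \1_(`[a, b]%classic) (x i ord0))%:E) = ((b - a) ^+ m)%:E.
Proof.
move=> ab; rewrite (@iint_prod R m (fun _ t => \1_(`[a, b]%classic) t))//; last first.
  by move=> i; apply: measurable_indic; exact: measurable_itv.
rewrite big_const /= (eq_iter (f' := fun y => ((b - a)%:E * y)%E)); last first.
  move=> y; rewrite integral_indic//= setIT lebesgue_measure_itv /= lte_fin.
  by case: ltP ab => // ba ab'; rewrite (_ : b - a = 0) ?mul0e//; lra.
by rewrite card_ord; elim: m => //= m ->; rewrite -EFinM exprS.
Qed.

Let m1 : measurable_fun setT (fun y : 'cV[R]_n => (\1_orthant (lam y))%:E : \bar R).
Proof.
apply/measurable_EFinP; apply: (measurableT_comp (f := fun l : vec => \1_orthant l : RB)).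
  by apply: measurable_indic; exact: measurable_orthant.
exact: measurable_lam.
Qed.

Lemma lam_le1 (y : 'cV[R]_n) i : orthant (lam y) -> lam y i ord0 <= 1.
Proof. by move=> oy; rewrite -(sum_lam y) (bigD1 i)//= lerDl sumr_ge0. Qed.

Let mprod (a b : R) : measurable_fun setT
  (fun x : 'cV[R]_n => (\prod_i \1_(`[a, b]%classic) (x i ord0))%:E : \bar R).
Proof.
apply/measurable_EFinP; apply: measurable_prod => i _.
apply: (measurableT_comp (f := fun t : RB => \1_(`[a, b]%classic) t : RB)).
  by apply: measurable_indic; exact: measurable_itv.
exact: measurable_coord.
Qed.

Lemma Wsimp_le1 : (Wsimp <= 1)%E.
Proof.
have <- : iint (fun x : 'cV[R]_n => (\prod_i \1_(`[0, 1]%classic) (x i ord0))%:E) = 1%E :> \bar R.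
  by rewrite iint_cube// subr0 expr1n.
apply: le_iint => // y.
rewrite lee_fin; have [h|h] := pselect (orthant (lam y)); last first.
  by rewrite indic_notin// prodr_ge0.
rewrite indic_in// big1// => i _; rewrite indic_in//= in_itv /=.
have e : y i ord0 = lam y (rshift 1 i) ord0 by rewrite lamE col_mxEd.
by rewrite e h lam_le1.
Qed.

(** The cube [0, 1/n]^n lies in the simplex. *)
Lemma Wsimp_ge : (0 < n)%N -> ((n%:R^-1 ^+ n)%:E <= Wsimp)%E.
Proof.
move=> n0; have n1 : 0 <= n%:R^-1 :> R by rewrite invr_ge0.
rewrite -[X in X ^+ _]subr0 -iint_cube//.
apply: le_iint => // [y|y]; first by rewrite lee_fin prodr_ge0.
rewrite lee_fin; have [h|h] := pselect (forall i, 0 <= y i ord0 <= n%:R^-1); last first.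
  have [i hi] : exists i, ~ (0 <= y i ord0 <= n%:R^-1).
    by apply: contrapT => /forallNP h'; apply: h => i; exact: contrapT.
  by rewrite (bigD1 i)//= indic_notin ?mul0r//= in_itv.
rewrite big1 => [|i _]; last by rewrite indic_in//= in_itv /= h.
rewrite indic_in// => k; rewrite lamE -[k]splitK; case: (fintype.split k) => j /=.
  rewrite col_mxEu mxE subr_ge0.
  apply: (@le_trans _ _ (\sum_(i < n) n%:R^-1)).
    by apply: ler_sum => i _; case/andP: (h i).
  by rewrite sumr_const card_ord -(mulr_natr n%:R^-1) mulVf// pnatr_eq0 -lt0n.
by rewrite col_mxEd; case/andP: (h j).
Qed.

Let mM i j : measurable_fun setT (fun y : 'cV[R]_n =>
  (\1_orthant (lam y) * (lam y i ord0 * lam y j ord0))%:E : \bar R).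
Proof.
apply/measurable_EFinP; apply: measurable_funM; first exact/measurable_EFinP.
apply: measurable_funM.
  apply: (measurableT_comp (f := fun l : vec => l i ord0 : RB)); first exact: measurable_coord.
  exact: measurable_lam.
apply: (measurableT_comp (f := fun l : vec => l j ord0 : RB)); first exact: measurable_coord.
exact: measurable_lam.
Qed.

Let M0 i j (y : 'cV[R]_n) : (0 <= (\1_orthant (lam y) * (lam y i ord0 * lam y j ord0))%:E :> \bar R)%E.
Proof.
rewrite lee_fin; have [h|h] := pselect (orthant (lam y)); last by rewrite indic_notin// mul0r.
by rewrite mulr_ge0// mulr_ge0.
Qed.

Lemma Wsimp_fin : Wsimp \is a fin_num.
Proof.
rewrite ge0_fin_numE; first by apply: (le_lt_trans Wsimp_le1); rewrite ltry.
by apply: iint_ge0 => y; rewrite lee_fin.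
Qed.

Lemma Mom_fin i j : Mom i j \is a fin_num.
Proof.
rewrite ge0_fin_numE; last exact: iint_ge0.
apply: (@le_lt_trans _ _ Wsimp); last by rewrite ltey_eq Wsimp_fin.
apply: le_iint => // y; rewrite lee_fin.
have [h|h] := pselect (orthant (lam y)); last by rewrite indic_notin// mul0r.
by rewrite indic_in// mul1r mulr_ile1// lam_le1.
Qed.

Definition wsimp := fine Wsimp.

Lemma sum_Mom : (\sum_i \sum_j Mom i j = Wsimp)%E.
Proof.
under eq_bigr => i _.
  rewrite -(@iint_sum R n _ (index_enum _) (fun j y => (\1_orthant (lam y) * (lam y i ord0 * lam y j ord0))%:E))//.
  over.
rewrite -iint_sum; first last.
- by move=> i x; rewrite sume_ge0.
- by move=> i; apply: emeasurable_sum => j.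
apply: eq_iint => y.
under eq_bigr do rewrite sumEFin -!mulr_sumr.
by rewrite sumEFin -mulr_sumr -mulr_suml sum_lam !mulr1.
Qed.

(** [Mom_split] says that a diagonal moment is twice any off-diagonal one in its column. With
    symmetry all moments are multiples of one number, which the total [sum_Mom] determines. *)
Lemma momE i j : Mom i j = ((1 + (i == j)%:R) * (wsimp / ((n.+1)%:R * (n.+2)%:R)))%:E.
Proof.
pose m i j := fine (Mom i j).
have mE a b : Mom a b = (m a b)%:E by rewrite fineK// Mom_fin.
have half a b : a != b -> m b b = 2 * m a b.
  move=> ab; have := @Mom_split R n a b ab; rewrite !mE -!EFinM -EFinD => -[] h; lra.
have mC a b : m a b = m b a by rewrite /m MomC.
have diag b : m b b = m ord0 ord0.
  have [->//|b0] := eqVneq b ord0.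
  by rewrite (half ord0 b) 1?eq_sym// (half b ord0)// mC.
pose b0 := m ord0 ord0 / 2.
have mb a b : m a b = (1 + (a == b)%:R) * b0.
  have [->|ab] := eqVneq a b; first by rewrite diag /b0 /= mulr1n; lra.
  by have := half _ _ ab; rewrite diag /b0 /= mulr0n; lra.
have W : wsimp = b0 * ((n.+1)%:R * (n.+2)%:R).
  apply: EFin_inj; rewrite /wsimp fineK ?Wsimp_fin// -sum_Mom.
  under eq_bigr => a _.
    rewrite (eq_bigr (fun b => (m a b)%:E)) => [|b _]; last exact: mE.
    rewrite sumEFin (eq_bigr (fun b => b0 + (b == a)%:R * b0)) => [|b _]; last first.
      by rewrite mb mulrDl mul1r eq_sym.
    rewrite big_split /= sum_delta sumr_const card_ord; over.
  rewrite sumEFin sumr_const card_ord; congr EFin.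
  by rewrite -mulr_natr -[b0 *+ _]mulr_natr -[n.+2]addn1 -[(1 + n)%N]/(n.+1) natrD; ring.
rewrite mE mb W; congr (EFin (_ * _)).
by rewrite mulfK// mulf_neq0// pnatr_eq0.
Qed.

Lemma iint_quad (M : 'I_(1 + n) -> 'I_(1 + n) -> R) :
  (forall l, orthant l -> 0 <= \sum_i \sum_j M i j * (l i ord0 * l j ord0)) ->
  iint (fun y : 'cV[R]_n => (\1_orthant (lam y) *
     \sum_i \sum_j M i j * (lam y i ord0 * lam y j ord0))%:E) =
  ((\sum_i \sum_j M i j * (1 + (i == j)%:R)) * (wsimp / ((n.+1)%:R * (n.+2)%:R)))%:E.
Proof.
move=> q0.
pose k := wsimp / ((n.+1)%:R * (n.+2)%:R).
pose q (y : 'cV[R]_n) := \1_orthant (lam y) *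
     \sum_i \sum_j M i j * (lam y i ord0 * lam y j ord0).
(* [iint] is additive on nonnegative functions only, while Gram coefficients may be negative, so the
   form is split into its positive and negative parts. *)
pose Mp i j := Num.max (M i j) 0; pose Mn i j := Num.max (- M i j) 0.
have MpE i j : M i j + Mn i j = Mp i j.
  rewrite /Mp /Mn; case: (leP (M i j) 0) => h; first by rewrite max_l; lra.
  by rewrite max_r; lra.
have H (N : 'I_(1 + n) -> 'I_(1 + n) -> R) : (forall i j, 0 <= N i j) ->
    iint (fun y : 'cV[R]_n => (\1_orthant (lam y) *
     \sum_i \sum_j N i j * (lam y i ord0 * lam y j ord0))%:E) =
     ((\sum_i \sum_j N i j * (1 + (i == j)%:R)) * k)%:E.
  move=> N0.
  transitivity (iint (fun y : 'cV[R]_n => \sum_i \sum_j ((N i j)%:E *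
      (\1_orthant (lam y) * (lam y i ord0 * lam y j ord0))%:E))%E).
    apply: eq_iint => y.
    rewrite mulr_sumr -sumEFin; apply: eq_bigr => i _.
    rewrite mulr_sumr -sumEFin; apply: eq_bigr => j _.
    by rewrite -EFinM mulrCA.
  have p0 i j y : (0 <= (N i j)%:E * (\1_orthant (lam y) * (lam y i ord0 * lam y j ord0))%:E)%E.
    by rewrite mule_ge0// ?lee_fin// M0.
  have mm i j : measurable_fun setT (fun y : 'cV[R]_n =>
      (N i j)%:E * (\1_orthant (lam y) * (lam y i ord0 * lam y j ord0))%:E)%E.
    by apply: measurable_funeM.
  rewrite iint_sum; first last.
  - by move=> i y; rewrite sume_ge0.
  - by move=> i; apply: emeasurable_sum => j.
  rewrite mulr_suml -sumEFin; apply: eq_bigr => i _.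
  rewrite iint_sum//.
  rewrite mulr_suml -sumEFin; apply: eq_bigr => j _.
  rewrite iintZl ?lee_fin//; transitivity ((N i j)%:E * Mom i j)%E => //.
  by rewrite momE -EFinM -/k mulrA.
have Mn0 i j : 0 <= Mn i j by rewrite le_max lexx orbT.
have Mp0 i j : 0 <= Mp i j by rewrite le_max lexx orbT.
have mq (N : 'I_(1 + n) -> 'I_(1 + n) -> R) : measurable_fun setT (fun y : 'cV[R]_n => (\1_orthant (lam y) *
     \sum_i \sum_j N i j * (lam y i ord0 * lam y j ord0))%:E).
  apply/measurable_EFinP; apply: measurable_funM; first exact/measurable_EFinP.
  apply: measurable_sum => i; apply: measurable_sum => j; apply: measurable_funM => //.
  apply: measurable_funM.
    apply: (measurableT_comp (f := fun l : vec => l i ord0 : RB)); first exact: measurable_coord.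
    exact: measurable_lam.
  apply: (measurableT_comp (f := fun l : vec => l j ord0 : RB)); first exact: measurable_coord.
  exact: measurable_lam.
have pos (N : 'I_(1 + n) -> 'I_(1 + n) -> R) y : (orthant (lam y) -> 0 <= \sum_i \sum_j N i j * (lam y i ord0 * lam y j ord0)) ->
    (0 <= (\1_orthant (lam y) * \sum_i \sum_j N i j * (lam y i ord0 * lam y j ord0))%:E)%E.
  move=> h; rewrite lee_fin; have [oy|oy] := pselect (orthant (lam y)).
    by rewrite mulr_ge0// h.
  by rewrite indic_notin// mul0r.
have : (iint (fun y => (q y)%:E) + iint (fun y : 'cV[R]_n => (\1_orthant (lam y) *
     \sum_i \sum_j Mn i j * (lam y i ord0 * lam y j ord0))%:E) =
     iint (fun y : 'cV[R]_n => (\1_orthant (lam y) *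
     \sum_i \sum_j Mp i j * (lam y i ord0 * lam y j ord0))%:E))%E.
  rewrite -iintD.
  - apply: eq_iint => y; rewrite -EFinD /q -mulrDr; congr (EFin (_ * _)).
    rewrite -big_split /=; apply: eq_bigr => i _.
    rewrite -big_split /=; apply: eq_bigr => j _.
    by rewrite -mulrDl MpE.
  - exact: mq.
  - exact: mq.
  - by move=> y; apply: pos => oy; exact: q0.
  - move=> y; apply: pos => oy; apply: sumr_ge0 => i _; apply: sumr_ge0 => j _.
    by rewrite mulr_ge0// mulr_ge0.
rewrite (H Mn)// (H Mp)// => h; rewrite -/k.
suff -> : (\sum_i \sum_j M i j * (1 + (i == j)%:R)) * k =
  (\sum_i \sum_j Mp i j * (1 + (i == j)%:R)) * k - (\sum_i \sum_j Mn i j * (1 + (i == j)%:R)) * k.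
  rewrite EFinB -h addeK//.
rewrite -mulrBl; congr (_ * _); rewrite -sumrB; apply: eq_bigr => i _.
by rewrite -sumrB; apply: eq_bigr => j _; rewrite -mulrBl -MpE addrK.
Qed.

Definition simplex (P : 'I_(1 + n) -> 'cV[R]_n) : set 'cV[R]_n :=
  [set x | orthant (bary P x)].

Lemma measurable_simplex P : measurable (simplex P).
Proof.
have := @measurable_bary R n P _ _ id (@measurable_id _ _ setT).
by move=> /(_ measurableT _ (@measurable_orthant R n)); rewrite setTI.
Qed.

Lemma vol_simplex P : \det (lift_mx P) != 0 ->
  vol (simplex P) = (`|\det (lift_mx P)| * wsimp)%:E.
Proof.
move=> dP; rewrite EFinM /wsimp fineK ?Wsimp_fin//.
rewrite -(@iint_bary R n P (fun l => (\1_orthant l)%:E))//.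
by apply/measurable_EFinP; apply: measurable_indic; exact: measurable_orthant.
Qed.

(** In barycentric coordinates |x|^2 is the quadratic form of the Gram matrix of the vertices; the
    identity part of [1 + (i == j)] yields the sum of the |P i|^2, the constant part the square of
    the sum. *)
Lemma simplex_second_moment P : \det (lift_mx P) != 0 ->
  iint (fun x => (\1_(simplex P) x * sqnorm x)%:E) =
  (((\sum_i sqnorm (P i) + sqnorm (\sum_i P i)) / ((n.+1)%:R * (n.+2)%:R))%:E * vol (simplex P))%E.
Proof.
move=> dP; rewrite vol_simplex//.
have sqE (l : vec) : sqnorm (\sum_i l i ord0 *: P i) =
   \sum_i \sum_j dot (P i) (P j) * (l i ord0 * l j ord0).
  rewrite sqnorm_dot dot_sumr [RHS]exchange_big /=; apply: eq_bigr => i _.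
  rewrite dotC dot_sumr; apply: eq_bigr => j _.
  by rewrite dotZl dotZr (dotC (P j)); ring.
have := @iint_bary R n P (fun l => (\1_orthant l * \sum_i \sum_j dot (P i) (P j) * (l i ord0 * l j ord0))%:E) dP.
rewrite iint_quad; last by move=> l _; rewrite -sqE sqnorm_ge0.
move=> h; transitivity (iint (fun x => (\1_orthant (bary P x) *
   \sum_i \sum_j dot (P i) (P j) * (bary P x i ord0 * bary P x j ord0))%:E)).
  by apply: eq_iint => x; rewrite -sqE -(lift_mx_bary x dP).2.
rewrite h.
- rewrite -!EFinM; congr EFin.
  have -> : \sum_i \sum_j dot (P i) (P j) * (1 + (i == j)%:R) = \sum_i sqnorm (P i) + sqnorm (\sum_i P i).
    rewrite sqnorm_dot dot_sumr addrC -big_split /=; apply: eq_bigr => i _.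
    rewrite (dotC (\sum_i0 P i0)) dot_sumr sqnorm_dot.
    rewrite -(sum_delta i (fun j => dot (P i) (P j))) -big_split /=.
    by apply: eq_bigr => j _; rewrite mulrDr mulr1 eq_sym mulrC; congr (_ + _); rewrite mulrC.
  by ring.
- apply/measurable_EFinP; apply: measurable_funM; first by apply: measurable_indic; exact: measurable_orthant.
  apply: measurable_sum => i; apply: measurable_sum => j; apply: measurable_funM => //.
  by apply: measurable_funM; exact: measurable_coord.
- by move=> l; rewrite -sqE lee_fin mulr_ge0// sqnorm_ge0.
Qed.

End simplex_moments.

(** * Triangulation of a polytope by generic heights *)

Lemma homogL (R : realType) n (y : 'cV[R]_n) : homog y (lshift n ord0) ord0 = 1.
Proof. by rewrite /homog col_mxEu mxE. Qed.

Lemma homogR (R : realType) n (y : 'cV[R]_n) j : homog y (rshift 1 j) ord0 = y j ord0.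
Proof. by rewrite /homog col_mxEd. Qed.

Section affine_representations.
Variables (R : realType) (n : nat) (I : finType) (p : I -> 'cV[R]_n).

Definition rep x (l : I -> R) :=
  [/\ forall i, 0 <= l i, \sum_i l i = 1 & \sum_i l i *: p i = x].

Definition supp (l : I -> R) : {set I} := [set i | l i != 0]%SET.

Definition affine_indep (A : {set I}) := forall mu : I -> R,
  (forall i, i \notin A -> mu i = 0) -> \sum_i mu i = 0 ->
  \sum_i mu i *: p i = 0 -> forall i, mu i = 0.

Lemma hullP x : convex_hull p x <-> exists l, rep x l.
Proof.
by split=> [[l [l0 [l1 ->]]]|[l [l0 l1 <-]]]; exists l.
Qed.

(** A pivot of the simplex method: follow an affine dependency among the support, in the direction
    that does not raise the cost, until a coefficient vanishes. *)
Lemma rep_reduce (h : I -> R) x l : rep x l -> ~ affine_indep (supp l) ->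
  exists l', [/\ rep x l', \sum_i h i * l' i <= \sum_i h i * l i & (#|supp l'| < #|supp l|)%N].
Proof.
move=> [l0 l1 lx] nai.
have [mu [mus mu1 mux cmu [i mui]]] : exists mu : I -> R,
    [/\ forall i, i \notin supp l -> mu i = 0, \sum_i mu i = 0, \sum_i mu i *: p i = 0,
        \sum_i h i * mu i <= 0 & exists i, mu i < 0].
  have [mu H] : exists mu : I -> R,
    [/\ forall i, i \notin supp l -> mu i = 0, \sum_i mu i = 0, \sum_i mu i *: p i = 0
      & exists i, mu i != 0].
    apply: contrapT => /forallNP H; apply: nai => mu m1 m2 m3 i.
    apply: contrapT => mi; apply: (H mu); split => //; exists i; exact/eqP.
  case: H => m1 m2 m3 m4.
  (* A nonzero function of sum zero takes a negative value, so whichever of [mu] and its opposite is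
     chosen for its cost, some coefficient decreases. *)
  have neg (nu : I -> R) : \sum_i nu i = 0 -> (exists i, nu i != 0) -> exists i, nu i < 0.
    move=> s0 [i ni]; apply: contrapT => /forallNP H.
    have H0 j : true -> 0 <= nu j by move=> _; rewrite leNgt; apply/negP; exact: H.
    by move: s0 => /eqP; rewrite psumr_eq0// => /allP /(_ i (mem_index_enum _)) /=; rewrite (negPf ni).
  have [c|c] := leP (\sum_i h i * mu i) 0.
    by exists mu; split => //; exact: neg.
  exists (fun i => - mu i); split.
  - by move=> i /m1 ->; rewrite oppr0.
  - by rewrite sumrN m2 oppr0.
  - under eq_bigr do rewrite scaleNr.
    by rewrite sumrN m3 oppr0.
  - under eq_bigr do rewrite mulrN.
    by rewrite sumrN oppr_le0 ltW.
  - apply: neg; first by rewrite sumrN m2 oppr0.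
    by have [i mi] := m4; exists i; rewrite oppr_eq0.
pose F j := l j / (- mu j).
have [j muj jmin] := @arg_minP _ _ _ i (fun j => mu j < 0) F mui.
(* The smallest ratio is the largest step that keeps all coefficients nonnegative, and it
   annihilates the coefficient of [j]. *)
pose t := F j.
have t0 : 0 <= t by rewrite divr_ge0// oppr_ge0 ltW.
pose l' i := l i + t * mu i.
have l'j : l' j = 0.
  by rewrite /l' /t /F invrN mulrN mulNr divfK ?lt_eqF// subrr.
exists l'; split.
- split.
  + move=> k; rewrite /l'; have [mk|mk] := leP 0 (mu k); first by rewrite addr_ge0// mulr_ge0.
    have := jmin k mk; rewrite -/t /F ler_pdivlMr ?oppr_gt0// mulrN.
    by rewrite -subr_ge0 opprK.
  + by rewrite /l' big_split /= -mulr_sumr mu1 mulr0 addr0.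
  + rewrite /l'; under eq_bigr do rewrite scalerDl -scalerA.
    by rewrite big_split /= -scaler_sumr mux scaler0 addr0.
- rewrite /l'; under eq_bigr do rewrite mulrDr mulrCA.
  by rewrite big_split /= -mulr_sumr gerDl mulr_ge0_le0.
- apply: proper_card; apply/properP; split.
    apply/fintype.subsetP => k; rewrite !inE; apply: contraNN => /eqP lk.
    by rewrite /l' lk mus ?inE ?lk ?eqxx// mulr0 addr0.
  exists j; last by rewrite !inE l'j eqxx.
  rewrite inE; apply/negP => /eqP lj.
  by move: muj; rewrite mus ?ltxx// inE lj eqxx.
Qed.

Lemma caratheodory (h : I -> R) x l : rep x l ->
  exists l', [/\ rep x l', \sum_i h i * l' i <= \sum_i h i * l i & affine_indep (supp l')].
Proof.
have [m] := ubnP #|supp l|; elim: m l => // m IH l lm rl.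
have [ai|nai] := pselect (affine_indep (supp l)); first by exists l.
have [l1 [r1 c1 s1]] := rep_reduce h rl nai.
have [|l2 [r2 c2 a2]] := IH l1 _ r1; first exact: leq_trans s1 _.
by exists l2; split => //; exact: le_trans c2 c1.
Qed.

Lemma affine_indep_unique A x l l' : affine_indep A -> rep x l -> rep x l' ->
  supp l \subset A -> supp l' \subset A -> l =1 l'.
Proof.
move=> ai [_ l1 lx] [_ l1' lx'] /fintype.subsetP s /fintype.subsetP s' i.
apply/eqP; rewrite -subr_eq0; apply/eqP.
have z (k : I -> R) : {subset supp k <= A} -> forall i, i \notin A -> k i = 0.
  by move=> sk j jA; apply/eqP; apply: contraNT jA => kj; apply: sk; rewrite inE.
apply: (ai (fun i => l i - l' i)).
- by move=> j jA; rewrite !z ?subrr.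
- by rewrite sumrB l1 l1' subrr.
- by under eq_bigr do rewrite scalerBl; rewrite sumrB lx lx' subrr.
Qed.

(** A representation with affinely independent support is determined by that support. By
    Carathéodory the minimum of the cost is therefore one over finitely many sets, and no
    compactness is involved. *)
Lemma min_rep (h : I -> R) x : convex_hull p x ->
  exists l, [/\ rep x l, affine_indep (supp l) &
    forall l', rep x l' -> \sum_i h i * l i <= \sum_i h i * l' i].
Proof.
move=> /hullP[l0 r0].
pose Q (A : {set I}) (l : I -> R) := [/\ rep x l, affine_indep A & supp l = A].
(* [L] selects the representation carried by each support, with the zero function as a placeholder
   for supports that carry none. *)
have /choice[L HL] : forall A, exists l, (exists l', Q A l') -> Q A l.
  by move=> A; have [[l q]|nq] := pselect (exists l', Q A l'); [exists l|exists (fun=> 0)].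
have [l1 [r1 _ a1]] := caratheodory h r0.
have P1 : `[< exists l', Q (supp l1) l' >] by apply/asboolP; exists l1.
pose cost A := \sum_i h i * L A i.
have [A /asboolP PA Amin] := @arg_minP _ _ _ (supp l1) (fun A => `[< exists l', Q A l' >]) cost P1.
have [rA aA sA] := HL _ PA.
exists (L A); split => //; first by rewrite sA.
move=> l' r'; have [l2 [r2 c2 a2]] := caratheodory h r'.
apply: le_trans c2.
have P2 : exists l', Q (supp l2) l' by exists l2.
have [rB aB sB] := HL _ P2.
have e := affine_indep_unique a2 r2 rB (subxx _).
have := Amin (supp l2); rewrite /cost => /(_ (asboolT P2)) hh.
rewrite (le_trans hh)//; rewrite le_eqVlt; apply/orP; left; apply/eqP.
by apply: eq_bigr => i _; rewrite e// sB.
Qed.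

(** The homogeneous vectors of at most n points do not span dimension n + 1. A vector annihilating
    them consists of the constant term [b0] and the normal [a], and [a] is nonzero because [b0]
    alone cannot annihilate a homogeneous vector. *)
Lemma small_hyperplane (A : {set I}) : (0 < n)%N -> (#|A| <= n)%N ->
  exists (a : 'cV[R]_n) (b : R), a != 0 /\
    forall l : I -> R, (forall i, i \notin A -> l i = 0) -> \sum_i l i = 1 ->
      dot a (\sum_i l i *: p i) = b.
Proof.
move=> n0 An.
have [A0|[i1 Ai1]] := set_0Vmem A.
  exists (const_mx 1), 0; split.
    apply/eqP => /(congr1 (fun M : 'cV[R]_n => M (Ordinal n0) ord0)) /eqP.
    by rewrite !mxE oner_eq0.
  move=> l lA /eqP; rewrite big1 => [|i _]; last by rewrite lA// A0 inE.
  by rewrite eq_sym oner_eq0.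
pose W : 'M[R]_(1 + n, #|A|) := \matrix_(i, k) homog (p (enum_val k)) i ord0.
have rk : kermx W != 0.
  rewrite -mxrank_eq0 mxrank_ker -lt0n subn_gt0.
  by apply: (leq_ltn_trans (rank_leq_col W)); rewrite add1n ltnS.
have [v vW v0] := rowV0Pn rk.
have vW0 : v *m W = 0 by apply/sub_kermxP.
pose b0 := v ord0 (lshift n ord0); pose a : 'cV[R]_n := \col_j v ord0 (rshift 1 j).
have H i : i \in A -> b0 + dot a (p i) = 0.
  move=> iA; have := congr1 (fun M : 'rV[R]_#|A| => M ord0 (enum_rank_in iA i)) vW0.
  rewrite mxE [RHS]mxE big_split_ord /= big_ord1 => <-.
  rewrite [W _ _]mxE homogL mulr1; congr (_ + _).
  by apply: eq_bigr => j _; rewrite [a _ _]mxE [W _ _]mxE homogR enum_rankK_in.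
exists a, (- b0); split.
  apply/eqP => a0; move/negP: v0; apply; apply/eqP/matrixP => i k; rewrite ord1 mxE.
  have b00 : b0 = 0.
    have := H _ Ai1; rewrite a0 /dot big1 ?addr0// => j _.
    by rewrite mxE mul0r.
  rewrite -[k]splitK; case: (fintype.split k) => j /=; first by rewrite ord1.
  by have := congr1 (fun M : 'cV[R]_n => M j ord0) a0; rewrite !mxE.
move=> l lA l1; rewrite dot_sumr.
transitivity (\sum_i l i * (- b0)); last by rewrite -mulr_suml l1 mul1r.
apply: eq_bigr => i _; rewrite dotZr.
have [iA|/lA ->] := boolP (i \in A); last by rewrite !mul0r.
by congr (_ * _); have := H _ iA; lra.
Qed.

Lemma affine_indep_card A : affine_indep A -> (#|A| <= n.+1)%N.
Proof.
move=> ai; rewrite leqNgt; apply/negP => An.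
pose W : 'M[R]_(#|A|, 1 + n) := \matrix_(k, i) homog (p (enum_val k)) i ord0.
have rk : kermx W != 0.
  rewrite -mxrank_eq0 mxrank_ker -lt0n subn_gt0.
  by apply: (leq_ltn_trans (rank_leq_col W)).
have [v vW v0] := rowV0Pn rk.
have vW0 : v *m W = 0 by apply/sub_kermxP.
pose mu i := \sum_(k < #|A|) (enum_val k == i)%:R * v ord0 k.
have E (V : lmodType R) (F : I -> V) : \sum_i mu i *: F i = \sum_k v ord0 k *: F (enum_val k).
  under eq_bigr do rewrite scaler_suml.
  rewrite exchange_big /=; apply: eq_bigr => k _.
  rewrite (bigD1 (enum_val k))//= eqxx mul1r big1 ?addr0// => i /negPf.
  by rewrite eq_sym => ->; rewrite mul0r scale0r.
have mu0 i : mu i = 0.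
  apply: ai.
  - move=> {}i iA; rewrite /mu big1// => k _; case: eqP => [e|]; rewrite ?mul0r//.
    by move: iA; rewrite -e enum_valP.
  - have := E R^o (fun=> 1); rewrite /GRing.scale /=; under eq_bigr do rewrite mulr1.
    move=> ->; under eq_bigr do rewrite mulr1.
    have := congr1 (fun M : 'rV[R]_(1 + n) => M ord0 (lshift n ord0)) vW0.
    rewrite mxE [RHS]mxE => h; rewrite -[RHS]h; apply: eq_bigr => k _.
    by rewrite [W _ _]mxE homogL mulr1.
  - rewrite E; apply/matrixP => r c; rewrite [c]ord1 summxE [RHS]mxE.
    have := congr1 (fun M : 'rV[R]_(1 + n) => M ord0 (rshift 1 r)) vW0.
    rewrite mxE [RHS]mxE => h; rewrite -[RHS]h; apply: eq_bigr => k _.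
    by rewrite mxE [W _ _]mxE homogR.
move/negP: v0; apply; apply/eqP/matrixP => r k; rewrite [r]ord1 [RHS]mxE.
rewrite -[RHS](mu0 (enum_val k)) /mu (bigD1 k)//= eqxx mul1r big1 ?addr0// => k' kk.
by rewrite (inj_eq enum_val_inj) (negPf kk) mul0r.
Qed.

End affine_representations.

Section triangulation.
Variables (R : realType) (n : nat) (I : finType) (p : I -> 'cV[R]_n) (i0 : I).
Implicit Types (J : {set I}) (x : 'cV[R]_n).

(** Numbers the elements of [J]; the default [i0] is reached only when [J] has fewer than n + 1
    elements. *)
Definition qn J (k : 'I_(1 + n)) : I := nth i0 (enum J) k.
Definition verts J (k : 'I_(1 + n)) := p (qn J k).
Definition affine_basis J := (#|J| == n.+1) && (\det (lift_mx (verts J)) != 0).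

Lemma qn_in J k : #|J| = n.+1 -> qn J k \in J.
Proof. by move=> HJ; rewrite -mem_enum mem_nth// -cardE HJ. Qed.

Lemma qn_inj J : #|J| = n.+1 -> injective (qn J).
Proof.
move=> HJ k l /eqP; rewrite nth_uniq ?enum_uniq -?cardE ?HJ// => /eqP.
exact: val_inj.
Qed.

Lemma qn_surj J i : #|J| = n.+1 -> i \in J -> exists k, qn J k = i.
Proof.
move=> HJ iJ; have h : (index i (enum J) < 1 + n)%N.
  by rewrite add1n -HJ cardE index_mem mem_enum.
by exists (Ordinal h); rewrite /qn /= nth_index// mem_enum.
Qed.

Lemma sum_qn (V : nmodType) J (F : I -> V) : #|J| = n.+1 ->
  (forall i, i \notin J -> F i = 0) -> \sum_i F i = \sum_k F (qn J k).
Proof.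
move=> HJ F0; rewrite (bigID (mem J))/= [X in _ + X]big1 ?addr0; last first.
  by move=> i /F0.
rewrite -big_enum (big_nth i0) big_mkord -cardE HJ; exact: eq_bigr.
Qed.

(** Extends coefficients on the numbered vertices of [J] by zero to all of [I], to pass from
    barycentric coordinates to representations. *)
Definition spread J (v : 'I_(1 + n) -> R) (i : I) := \sum_k (qn J k == i)%:R * v k.

Lemma spread_qn J v k : #|J| = n.+1 -> spread J v (qn J k) = v k.
Proof.
move=> HJ; rewrite /spread (bigD1 k)//= eqxx mul1r big1 ?addr0// => l lk.
by rewrite (inj_eq (qn_inj HJ)) (negPf lk) mul0r.
Qed.

Lemma spread_notin J v i : #|J| = n.+1 -> i \notin J -> spread J v i = 0.
Proof.
move=> HJ iJ; rewrite /spread big1// => k _; case: eqP => [e|]; last by rewrite mul0r.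
by move: iJ; rewrite -e qn_in.
Qed.

Lemma sum_spread J v : #|J| = n.+1 -> \sum_i spread J v i = \sum_k v k.
Proof.
move=> HJ; rewrite (@sum_qn _ J)//; last by move=> i; exact: spread_notin.
by apply: eq_bigr => k _; rewrite spread_qn.
Qed.

Lemma sum_spread_scale J v : #|J| = n.+1 ->
  \sum_i spread J v i *: p i = \sum_k v k *: verts J k.
Proof.
move=> HJ; rewrite (@sum_qn _ J)//; last by move=> i /spread_notin ->; rewrite ?scale0r.
by apply: eq_bigr => k _; rewrite spread_qn.
Qed.

Lemma sum_spread_cost (h : I -> R) J v : #|J| = n.+1 ->
  \sum_i h i * spread J v i = \sum_k h (qn J k) * v k.
Proof.
move=> HJ; rewrite (@sum_qn _ J)//; last by move=> i /spread_notin ->; rewrite ?mulr0.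
by apply: eq_bigr => k _; rewrite spread_qn.
Qed.

Lemma affine_indep_basis J : affine_indep p J -> #|J| = n.+1 -> affine_basis J.
Proof.
move=> ai HJ; rewrite /affine_basis HJ eqxx /=; apply/negP => /eqP d0.
have : \det (lift_mx (verts J))^T == 0 by rewrite det_tr d0.
move=> /det0P[v v0 vL].
have Lv : lift_mx (verts J) *m v^T = 0.
  by apply: trmx_inj; rewrite trmx_mul trmxK vL trmx0.
have := lift_mxM (verts J) v^T; rewrite Lv -[0](@col_mx0 _ 1 n) => /eq_col_mx[e1 e2].
have s1 : \sum_i v^T i ord0 = 0.
  by move/(congr1 (fun M : 'cV[R]_1 => M ord0 ord0)): e1; rewrite [LHS]mxE [RHS]mxE.
have z := ai (spread J (fun k => v^T k ord0)).
move/negP: v0; apply; apply/eqP/matrixP => r k; rewrite [r]ord1 [RHS]mxE.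
rewrite -[RHS](z _ _ _ (qn J k)) ?spread_qn ?mxE//.
- by move=> i; exact: spread_notin.
- by rewrite sum_spread.
- by rewrite sum_spread_scale.
Qed.

Lemma bary_affine (K : finType) P (l : K -> R) (y : K -> 'cV[R]_n) : \sum_i l i = 1 ->
  bary P (\sum_i l i *: y i) = \sum_i l i *: bary P (y i).
Proof.
move=> l1; rewrite /bary.
have -> : homog (\sum_i l i *: y i) = \sum_i l i *: homog (y i).
  apply/matrixP => a b; rewrite [b]ord1 summxE -[a]splitK.
  case: (fintype.split a) => c /=.
    rewrite [c]ord1 homogL -[LHS]l1; apply: eq_bigr => i _.
    by rewrite mxE homogL mulr1.
  rewrite homogR summxE; apply: eq_bigr => i _.
  by rewrite [LHS]mxE [RHS]mxE homogR.
rewrite mulmx_sumr; apply: eq_bigr => i _.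
by rewrite scalemxAr.
Qed.

Lemma bary_vertex (P : 'I_(1 + n) -> 'cV[R]_n) k : \det (lift_mx P) != 0 -> bary P (P k) = delta_mx k ord0.
Proof.
move=> dP; pose l : 'cV[R]_(1 + n) := delta_mx k ord0.
have lE i : l i ord0 = (i == k)%:R by rewrite mxE eqxx andbT.
have s1 : \sum_i l i ord0 = 1.
  by rewrite -[RHS](sum_delta k (fun=> 1)); apply: eq_bigr => i _; rewrite lE mulr1.
rewrite -/l -(bary_unique dP s1); congr bary.
rewrite (bigD1 k)//= lE eqxx scale1r big1 ?addr0// => i /negPf ik.
by rewrite lE ik scale0r.
Qed.

Variable h : I -> R.

(** The affine function that interpolates the heights [h] at the vertices of [J]. *)
Definition ell J x := \sum_k h (qn J k) * bary (verts J) x k ord0.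

Lemma ell_affine (K : finType) J (l : K -> R) (y : K -> 'cV[R]_n) : \sum_i l i = 1 ->
  ell J (\sum_i l i *: y i) = \sum_i l i * ell J (y i).
Proof.
move=> l1; rewrite /ell bary_affine//.
under eq_bigr do rewrite summxE mulr_sumr.
rewrite exchange_big /=; apply: eq_bigr => i _; rewrite mulr_sumr.
by apply: eq_bigr => k _; rewrite mxE mulrCA.
Qed.

Lemma ell_vertex J k : affine_basis J -> ell J (p (qn J k)) = h (qn J k).
Proof.
move=> /andP[_ dJ]; rewrite /ell -[p _]/(verts J k) bary_vertex//.
under eq_bigr do rewrite mxE eqxx andbT mulrC.
by rewrite sum_delta.
Qed.

(* J is a lower face of the hull of the points lifted to the heights h. *)
Definition dual_feasible J := affine_basis J && [forall i, (i \notin J) ==> (ell J (p i) < h i)].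

(** A generic point needs at least n + 1 of the points to be represented, so it has no zero
    barycentric coordinate in a nondegenerate simplex of the family. *)
Definition generic x := forall (A : {set I}) (l : I -> R), (#|A| <= n)%N ->
  (forall i, i \notin A -> l i = 0) -> \sum_i l i = 1 -> \sum_i l i *: p i <> x.

Hypothesis h_generic : forall J i, affine_basis J -> i \notin J -> ell J (p i) != h i.

(** Linear programming duality: the support of a cheapest representation of [x] is a lower face. If
    a lifted point lay below its affine interpolant, shifting a little weight onto that point would
    lower the cost. *)
Lemma dual_feasible_cover x : convex_hull p x -> generic x ->
  exists2 J, dual_feasible J & simplex (verts J) x.
Proof.
move=> Kx gx; have [l [[l0 l1 lx] ai lmin]] := min_rep h Kx.
set J := supp l in ai.
have lJ i : i \notin J -> l i = 0 by rewrite inE negbK => /eqP.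
have HJ : #|J| = n.+1.
  apply/eqP; rewrite eqn_leq (affine_indep_card ai)/= ltnNge; apply/negP => Jn.
  exact: (gx J l).
have bJ := affine_indep_basis ai HJ.
have dJ : \det (lift_mx (verts J)) != 0 by case/andP: bJ.
have bE : bary (verts J) x = \col_k l (qn J k).
  have s1 : \sum_k (\col_k l (qn J k) : 'cV[R]_(1 + n)) k ord0 = 1.
    by rewrite -l1 (sum_qn HJ)//; apply: eq_bigr => k _; rewrite mxE.
  rewrite -(bary_unique dJ s1); congr bary.
  rewrite -lx (sum_qn HJ); last by move=> i /lJ ->; rewrite scale0r.
  by apply: eq_bigr => k _; rewrite mxE.
exists J; last by move=> k; rewrite bE mxE.
rewrite /dual_feasible bJ; apply/forallP => i; apply/implyP => iJ.
rewrite lt_neqAle h_generic//= leNgt; apply/negP => hi.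
pose c := spread J (fun k => bary (verts J) (p i) k ord0).
have [c1 cx] := lift_mx_bary (p i) dJ.
have cost_c : \sum_j h j * c j = ell J (p i) by rewrite sum_spread_cost.
pose S := \sum_(j in J) `|c j| / l j.
have lpos j : j \in J -> 0 < l j by rewrite inE lt0r l0 andbT.
have S0 : 0 <= S by apply: sumr_ge0 => j jJ; rewrite divr_ge0.
(* [S] bounds every ratio of |c j| to l j, so a shift of size [e] keeps the coefficients
   nonnegative. Weight [e] goes to [i] and is taken from [J] in the barycentric proportions of
   [p i], which leaves the barycenter fixed. *)
pose e := (S + 1)^-1.
have e0 : 0 < e by rewrite invr_gt0; lra.
pose l' j := l j + e * ((j == i)%:R - c j).
have r' : rep p x l'.
  split.
  - move=> j; rewrite /l'; have [jJ|jJ] := boolP (j \in J); last first.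
      by rewrite lJ// add0r /c spread_notin// subr0 mulr_ge0// ltW.
    have ji : (j == i) = false by apply/negbTE; apply: contraTneq jJ => ->.
    rewrite ji sub0r mulrN subr_ge0.
    apply: (@le_trans _ _ (e * `|c j|)); first by rewrite ler_pM2l// ler_norm.
    rewrite mulrC -ler_pdivlMr ?invrK// -ler_pdivrMl ?lpos// mulrC.
    apply: (@le_trans _ _ S); last by lra.
    rewrite /S (bigD1 j)//= lerDl; apply: sumr_ge0 => k /andP[kJ _].
    by rewrite divr_ge0.
  - rewrite /l' big_split /= -mulr_sumr sumrB l1 sum_spread// c1.
    have -> : \sum_j (j == i)%:R = 1 :> R.
      by have := sum_delta i (fun=> 1 : R); under eq_bigr do rewrite mulr1.
    by rewrite subrr mulr0 addr0.
  - rewrite /l'; under eq_bigr do rewrite scalerDl -scalerA scalerBl.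
    rewrite big_split /= lx -scaler_sumr sumrB sum_spread_scale// -cx.
    rewrite (bigD1 i)//= eqxx scale1r big1 ?addr0 ?subrr ?scaler0 ?addr0// => j /negPf ->.
    by rewrite scale0r.
have := lmin _ r'; rewrite /l'; under [X in _ <= X]eq_bigr do rewrite mulrDr mulrCA mulrBr.
rewrite big_split /= -mulr_sumr sumrB cost_c.
have -> : \sum_j h j * (j == i)%:R = h i.
  by under eq_bigr do rewrite mulrC; rewrite sum_delta.
rewrite lerDl pmulr_rge0// subr_ge0 leNgt hi //.
Qed.

Lemma simplex_hull J x : affine_basis J -> simplex (verts J) x -> convex_hull p x.
Proof.
move=> /andP[/eqP HJ dJ] Sx; have [b1 bx] := lift_mx_bary x dJ.
exists (spread J (fun k => bary (verts J) x k ord0)); split; last split.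
- move=> i; apply: sumr_ge0 => k _; rewrite mulr_ge0//; exact: Sx.
- by rewrite sum_spread.
- by rewrite sum_spread_scale.
Qed.

(** On its own simplex [ell B x] is a weighted mean of the heights over [B], and feasibility keeps
    [ell A] below these heights, strictly off [A]. So [ell A x <= ell B x], strictly unless [B] is
    inside [A]; exchanging the roles gives a contradiction. *)
Lemma dual_feasible_unique J J' x : generic x -> dual_feasible J -> dual_feasible J' ->
  simplex (verts J) x -> simplex (verts J') x -> J = J'.
Proof.
move=> gx fJ fJ' SJ SJ'; apply: contrapT => /eqP JJ'.
have H A B : dual_feasible A -> dual_feasible B -> simplex (verts B) x ->
    ell A x <= ell B x /\ (~~ (B \subset A) -> ell A x < ell B x).
  move=> /andP[bA /forallP fA] /andP[/andP[/eqP HB dB] _] SB.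
  have [b1 bx] := lift_mx_bary x dB.
  have le k : ell A (verts B k) <= h (qn B k).
    have [kA|kA] := boolP (qn B k \in A); last by apply: ltW; exact: implyP (fA _) kA.
    have /andP[/eqP HA _] := bA.
    by have [m qm] := qn_surj HA kA; rewrite /verts -qm ell_vertex.
  have E : ell A x = \sum_k bary (verts B) x k ord0 * ell A (verts B k).
    by rewrite -ell_affine// -bx.
  have E' : ell B x = \sum_k bary (verts B) x k ord0 * h (qn B k).
    by apply: eq_bigr => k _; rewrite mulrC.
  rewrite E E'; split; first by apply: ler_sum => k _; rewrite ler_wpM2l//; exact: SB.
  move=> /subsetPn[i iB iA]; have [m qm] := qn_surj HB iB.
  have bm : 0 < bary (verts B) x m ord0.
    rewrite lt0r; apply/andP; split; last exact: SB.
    apply/eqP => bm0.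
    (* A zero weight at [i] would represent [x] by the n remaining points, against genericity. *)
    apply: (gx (B :\ i)%SET (spread B (fun k => bary (verts B) x k ord0))).
    + by have := cardsD1 i B; rewrite iB HB add1n => -[] ->.
    + move=> j; rewrite !inE negb_and negbK => /orP[/eqP ->|jB]; last exact: spread_notin.
      by rewrite -qm spread_qn.
    + by rewrite sum_spread.
    + by rewrite sum_spread_scale.
  rewrite (bigD1 m)//= [ltRHS](bigD1 m)//= ltr_leD//.
    by rewrite ltr_pM2l// /verts qm; apply: implyP (fA _) iA.
  by apply: ler_sum => k _; rewrite ler_wpM2l//; exact: SB.
have cE : #|J| = #|J'|.
  by case/andP: fJ => /andP[/eqP -> _] _; case/andP: fJ' => /andP[/eqP -> _] _.
have nsub : ~~ (J' \subset J).
  apply/negP => s; case/negP: JJ'; rewrite eq_sym eqEcard s cE leqnn //.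
have [_ /(_ nsub) lt] := H _ _ fJ fJ' SJ'.
have [le _] := H _ _ fJ' fJ SJ.
by have := lt_le_trans lt le; rewrite ltxx.
Qed.

End triangulation.

Lemma exists_nonroot (R : realType) (q : {poly R}) : q != 0 -> exists t, ~~ root q t.
Proof.
move=> q0; apply: contrapT => /forallNP H.
have : (size [seq k%:R : R | k <- iota 0 (size q)] < size q)%N.
  apply: max_poly_roots => //.
    by apply/allP => x _; have /negP := H x; rewrite negbK.
  rewrite map_inj_uniq ?iota_uniq// => a b /eqP; rewrite eqr_nat => /eqP //.
by rewrite size_map size_iota ltnn.
Qed.

(** * From the triangulation to the isotropic constant *)

Section hull_moment.
Variables (R : realType) (n : nat) (I : finType) (p : I -> 'cV[R]_n) (i0 : I).

(** The heights are powers t^r with distinct exponents. Each forbidden coincidence is a root of a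
    polynomial whose coefficient at [r i] is 1, because [i] is outside [J]; t is chosen off the
    roots of their product. *)
Lemma generic_heights : exists h : I -> R,
  forall J i, affine_basis p i0 J -> i \notin J -> ell p i0 h J (p i) != h i.
Proof.
pose r (i : I) : nat := enum_rank i.
pose pol (J : {set I}) i : {poly R} :=
  'X^(r i) - \sum_k (bary (verts p i0 J) (p i) k ord0) *: 'X^(r (qn i0 J k)).
pose q : {poly R} := \prod_(J : {set I} | #|J| == n.+1) \prod_(i | i \notin J) pol J i.
have q0 : q != 0.
  apply/prodf_neq0 => J /eqP HJ; apply/prodf_neq0 => i iJ.
  apply/eqP => /(congr1 (fun w : {poly R} => w`_(r i))).
  rewrite /pol coefB coefXn eqxx coef_sum big1 => [/eqP|k _].
    by rewrite coef0 subr0 oner_eq0.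
  rewrite coefZ coefXn; case: eqP => [e|]; last by rewrite mulr0.
  move: iJ; rewrite (_ : i = qn i0 J k) ?qn_in//.
  by apply: enum_rank_inj; apply: val_inj.
have [t tq] := exists_nonroot q0.
exists (fun i => t ^+ r i) => J i /andP[HJ _] iJ; apply/eqP => e.
move/negP: tq; apply; rewrite /q /root horner_prod.
rewrite (bigD1 J)//= horner_prod (bigD1 i)//= /pol hornerD hornerN hornerXn horner_sum.
suff -> : \sum_k (bary (verts p i0 J) (p i) k ord0 *: 'X^(r (qn i0 J k))).[t] = t ^+ r i.
  by rewrite subrr !mul0r.
by rewrite -e; apply: eq_bigr => k _; rewrite hornerZ hornerXn mulrC.
Qed.

Lemma generic_ae : (0 < n)%N -> exists N : set 'cV[R]_n,
  [/\ measurable N, iint (fun x => (\1_N x)%:E) = 0%E & forall x, ~ N x -> generic p x].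
Proof.
move=> n0.
have /choice[ab Hab] : forall A : {set I}, exists ab : 'cV[R]_n * R, (#|A| <= n)%N ->
    ab.1 != 0 /\ forall l : I -> R, (forall i, i \notin A -> l i = 0) -> \sum_i l i = 1 ->
      dot ab.1 (\sum_i l i *: p i) = ab.2.
  move=> A; have [An|An] := leqP #|A| n; last by exists (0, 0).
  by have [a [b H]] := small_hyperplane p n0 An; exists (a, b).
pose H (A : {set I}) : set 'cV[R]_n :=
  if (#|A| <= n)%N then [set x | dot (ab A).1 x = (ab A).2] else set0.
have mH A : measurable (H A).
  by rewrite /H; case: ifP => _ //; exact: measurable_hyperplane.
exists (\bigcup_A H A); split.
- by apply: fin_bigcup_measurable.
- apply/eqP; rewrite eq_le iint_ge0 ?andbT; last by move=> x; rewrite lee_fin.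
  apply: (@le_trans _ _ (\sum_A iint (fun x => (\1_(H A) x)%:E))%E).
    rewrite -iint_sum//; last by move=> A; apply/measurable_EFinP; exact: measurable_indic.
    apply: le_iint.
    + apply/measurable_EFinP; apply: measurable_indic; exact: fin_bigcup_measurable.
    + by apply: emeasurable_sum => A; apply/measurable_EFinP; exact: measurable_indic.
    + by move=> x; rewrite lee_fin.
    + move=> x; rewrite sumEFin lee_fin.
      have [[A _ HA]|nH] := pselect ((\bigcup_A H A) x); last first.
        by rewrite indic_notin// sumr_ge0.
      rewrite indic_in; last by exists A.
      by rewrite (bigD1 A)//= indic_in// lerDl sumr_ge0.
  rewrite big1// => A _; rewrite /H; case: ifP => An.
    by apply: iint_hyperplane; case: (Hab A An).
  by under eq_iint do rewrite indic0; exact: iint0.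
- move=> x Nx A l An lA l1 lx; apply: Nx; exists A => //.
  by rewrite /H An /= -lx; apply: (Hab A An).2.
Qed.

(** Up to a null set the hull is a disjoint union of simplices, each with second moment at most B /
    ((n+1)(n+2)) times its volume. Injectivity of [q] records that a simplex uses each index
    once. *)
Lemma hull_second_moment B : (0 < n)%N ->
  (forall q : 'I_(1 + n) -> I, injective q ->
     \sum_k sqnorm (p (q k)) + sqnorm (\sum_k p (q k)) <= B) ->
  (iint (fun x => (\1_(convex_hull p) x * sqnorm x)%:E) <=
   (B / ((n.+1)%:R * (n.+2)%:R))%:E * vol (convex_hull p))%E.
Proof.
move=> n0 HB; have [h hg] := generic_heights.
have [N [mN N0 Ng]] := generic_ae n0.
pose S J := simplex (verts p i0 J).
pose D := [set J | dual_feasible p i0 h J]%SET.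
have fD J : J \in D -> dual_feasible p i0 h J by rewrite inE.
have E (f : 'cV[R]_n -> R) : measurable_fun setT (f : 'cV[R]_n -> measurableTypeR R) ->
    (forall x, 0 <= f x) ->
    iint (fun x => (\1_(convex_hull p) x * f x)%:E) =
    (\sum_(J <- enum D) iint (fun x => (\1_(S J) x * f x)%:E))%E.
  move=> mf f0.
  have mS (A : set 'cV[R]_n) : measurable A -> measurable_fun setT (fun x => (\1_A x * f x)%:E : \bar R).
    by move=> mA; apply/measurable_EFinP; apply: measurable_funM => //; exact: measurable_indic.
  have S0 (A : set 'cV[R]_n) x : (0 <= (\1_A x * f x)%:E)%E by rewrite lee_fin mulr_ge0.
  have mSJ J : measurable_fun setT (fun x => (\1_(S J) x * f x)%:E : \bar R).
    by apply: mS; exact: measurable_simplex.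
  rewrite -iint_sum//.
  apply: (ae_eq_iint _ _ _ _ mN N0) => //.
  - by apply: mS; exact: measurable_hull.
  - exact: emeasurable_sum.
  - by move=> x; rewrite sume_ge0.
  move=> x Nx; have gx := Ng x Nx; rewrite sumEFin -mulr_suml; congr (EFin (_ * _)).
  have [Kx|nKx] := pselect (convex_hull p x); last first.
    rewrite indic_notin// big_seq big1// => J; rewrite mem_enum => /fD /andP[bJ _].
    by apply: indic_notin => SJ; apply: nKx; exact: simplex_hull bJ SJ.
  rewrite indic_in//; have [J fJ SJ] := dual_feasible_cover hg Kx gx.
  rewrite big_enum /= (bigD1 J) ?inE//= indic_in// big1 ?addr0// => J' /andP[/fD fJ' JJ'].
  apply: indic_notin => SJ'; case/negP: JJ'; apply/eqP.
  exact: dual_feasible_unique gx fJ' fJ SJ' SJ.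
rewrite /vol E; first last.
- by move=> x; exact: sqnorm_ge0.
- exact: measurable_sqnorm.
have -> : iint (fun x => (\1_(convex_hull p) x)%:E) = iint (fun x => (\1_(convex_hull p) x * 1)%:E) :> \bar R.
  by apply: eq_iint => x; rewrite mulr1.
rewrite E//.
(* The sign of [B] is known only from an existing simplex; with none, both sums are empty. *)
have Bn : 0 <= B / ((n.+1)%:R * (n.+2)%:R) \/ enum D = [::].
  case eD : (enum D) => [|J s]; [by right|left].
  have /fD /andP[/andP[/eqP HJ _] _] : J \in D by rewrite -mem_enum eD mem_head.
  apply: divr_ge0; last by rewrite mulr_ge0.
  have := HB _ (@qn_inj n I i0 J HJ); apply: le_trans.
  by rewrite addr_ge0 ?sqnorm_ge0//; apply: sumr_ge0 => k _; exact: sqnorm_ge0.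
case: Bn => [Bn|->]; last by rewrite !big_nil mule0.
rewrite ge0_sume_distrr; last first.
  by move=> J _; apply: iint_ge0 => x; rewrite lee_fin mulr1.
rewrite big_seq [leRHS]big_seq; apply: lee_sum => J; rewrite mem_enum => /fD /andP[/andP[/eqP HJ dJ] _].
rewrite simplex_second_moment//.
have -> : iint (fun x => (\1_(S J) x * 1)%:E) = vol (S J).
  by apply: eq_iint => x; rewrite mulr1.
rewrite lee_wpmul2r//.
  by apply: iint_ge0 => x; rewrite lee_fin.
by rewrite lee_fin ler_wpM2r// ?invr_ge0 ?mulr_ge0//; exact: HB (@qn_inj n I i0 J HJ).
Qed.

Lemma vol_ge0 (A : set 'cV[R]_n) : (0 <= vol A)%E.
Proof. by apply: iint_ge0 => x; rewrite lee_fin. Qed.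

Lemma le_vol (A B : set 'cV[R]_n) : measurable A -> measurable B -> A `<=` B -> (vol A <= vol B)%E.
Proof.
move=> mA mB AB; apply: le_iint.
- by apply/measurable_EFinP; exact: measurable_indic.
- by apply/measurable_EFinP; exact: measurable_indic.
- by move=> x; rewrite lee_fin.
- move=> x; rewrite lee_fin; have [Ax|Ax] := pselect (A x); last by rewrite indic_notin.
  by rewrite !indic_in//; exact: AB.
Qed.

Lemma vol_hull_fin : vol (convex_hull p) \is a fin_num.
Proof.
rewrite ge0_fin_numE; last exact: vol_ge0.
pose b := \sum_i \sum_j `|p i j ord0|.
have b0 : 0 <= b by apply: sumr_ge0 => i _; apply: sumr_ge0.
have bb : - b <= b by rewrite -subr_ge0 opprK addr_ge0.
apply: (@le_lt_trans _ _ (iint (fun x : 'cV[R]_n => (\prod_i \1_(`[- b, b]%classic) (x i ord0))%:E))); last first.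
  by rewrite iint_cube// ltry.
apply: le_iint.
- by apply/measurable_EFinP; apply: measurable_indic; exact: measurable_hull.
- apply/measurable_EFinP; apply: measurable_prod => i _.
  apply: (measurableT_comp (f := fun t : measurableTypeR R => \1_(`[- b, b]%classic) t : measurableTypeR R)).
    by apply: measurable_indic; exact: measurable_itv.
  exact: measurable_coord.
- by move=> x; rewrite lee_fin.
- move=> x; rewrite lee_fin; have [Kx|nKx] := pselect (convex_hull p x); last first.
    by rewrite indic_notin// prodr_ge0.
  rewrite indic_in// big1// => j _; rewrite indic_in//= in_itv /= -ler_norml.
  have [l [l0 [l1 ->]]] := Kx; rewrite summxE.
  apply: le_trans (ler_norm_sum _ _ _) _; apply: ler_sum => i _.
  rewrite mxE normrM (@le_trans _ _ (1 * `|p i j ord0|))//.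
    rewrite ler_wpM2r// ger0_norm// -l1 (bigD1 i)//= lerDl; exact: sumr_ge0.
  by rewrite mul1r (bigD1 j)//= lerDl sumr_ge0.
Qed.

Lemma isotropic_constant_le B V : (0 < n)%N ->
  (forall q : 'I_(1 + n) -> I, injective q ->
     \sum_k sqnorm (p (q k)) + sqnorm (\sum_k p (q k)) <= B) ->
  0 <= B -> 0 < V -> (V%:E <= vol (convex_hull p))%E ->
  isotropic_constant (convex_hull p) <=
    Num.sqrt (B / ((n.+1)%:R * (n.+2)%:R) * V `^ (- (2 / n%:R)) / n%:R).
Proof.
move=> n0 HB B0 V0 HV; rewrite /isotropic_constant ler_sqrt; last first.
  by rewrite divr_ge0// mulr_ge0 ?powR_ge0// divr_ge0// mulr_ge0.
rewrite ler_wpM2r ?invr_ge0//.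
set K := convex_hull p; set v := fine (vol K).
have vE : vol K = v%:E by rewrite /v fineK// vol_hull_fin.
have Vv : V <= v by rewrite -lee_fin -vE.
have v0 : 0 < v by exact: lt_le_trans Vv.
pose m := iint (fun x => (\1_K x * sqnorm x)%:E).
have m0 : (0 <= m)%E by apply: iint_ge0 => x; rewrite lee_fin mulr_ge0// sqnorm_ge0.
have mB := hull_second_moment n0 HB; rewrite -/K vE -EFinM -/m in mB.
have mfin : m \is a fin_num by rewrite ge0_fin_numE// (le_lt_trans mB)// ltry.
have mB' : fine m <= B / ((n.+1)%:R * (n.+2)%:R) * v by rewrite -lee_fin fineK.
have isom : iso_values K (fine m / v `^ (1 + 2 / n%:R)).
  exists 1%:M, 0; split; first by rewrite det1 normr1.
  by congr (fine _ / _); apply: eq_iint => x; rewrite mul1mx addr0.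
apply: (@le_trans _ _ (fine m / v `^ (1 + 2 / n%:R))).
  apply: ge_inf => //; exists 0 => _ [A [b [_ ->]]].
  rewrite divr_ge0 ?powR_ge0// fine_ge0//; apply: iint_ge0 => x.
  by rewrite lee_fin mulr_ge0// sqnorm_ge0.
(* The factor v of the moment cancels against v^(1 + 2/n); the remaining v^(-2/n) decreases in v, so
   a lower bound on the volume is what matters. *)
apply: (@le_trans _ _ (B / ((n.+1)%:R * (n.+2)%:R) * v `^ (- (2 / n%:R)))).
  rewrite ler_pdivrMr ?powR_gt0//.
  rewrite -[X in _ <= X]mulrA -powRD; last by rewrite (gt_eqF v0) implybT.
  by rewrite addrCA addNr addr0 powRr1// ltW.
rewrite ler_wpM2l ?divr_ge0// ?mulr_ge0//.
rewrite !powRN lef_pV2 ?posrE ?powR_gt0// ge0_ler_powR// ?nnegrE ?ltW//.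
Qed.

End hull_moment.

(** * Gaussian families *)

Section gaussian_density.
Variable R : realType.
Local Notation RB := (measurableTypeR R).
Local Notation mu := (@lebesgue_measure R).

Definition gpdf : R -> R := normal_pdf 0 1.

Lemma gpdf_ge0 t : 0 <= gpdf t. Proof. exact: normal_pdf_ge0. Qed.

Lemma measurable_gpdf : measurable_fun setT (gpdf : RB -> RB).
Proof. exact: measurable_normal_pdf. Qed.

Lemma gpdfE t : gpdf t = (Num.sqrt (2 * pi))^-1 * expR (- t ^+ 2 / 2).
Proof.
rewrite /gpdf normal_pdfE ?oner_neq0// /normal_peak /normal_fun subr0 expr1n mul1r.
by congr (_^-1 * _); congr Num.sqrt; rewrite mulr_natl.
Qed.

(** The Radon-Nikodym derivative and [gpdf] have the same integral over every measurable set, hence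
    agree almost everywhere. *)
Lemma integral_normal_prob (f : R -> \bar R) :
  measurable_fun setT (f : RB -> \bar R) -> (forall t, 0 <= f t)%E ->
  (\int[normal_prob 0 1]_t f t = \int[mu]_t (f t * (gpdf t)%:E))%E.
Proof.
move=> mf f0.
have dom := @normal_prob_dominates R 0 1.
rewrite -(Radon_Nikodym_SigmaFinite.change_of_variables dom)//.
apply: ae_eq_integral => //.
- apply: emeasurable_funM => //; apply: measurable_int.
  exact: (Radon_Nikodym_SigmaFinite.f_integrable dom).
- by apply: emeasurable_funM => //; apply/measurable_EFinP; exact: measurable_gpdf.
apply: ae_eqe_mul2l => /=.
apply: integral_ae_eq => //=.
- exact: (Radon_Nikodym_SigmaFinite.f_integrable dom).
- by apply/measurable_EFinP; exact: measurable_gpdf.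
- move=> E _ mE; rewrite -(Radon_Nikodym_SigmaFinite.f_integral dom)//.
Qed.

(** Completing the square: the integrand is a constant times the normal density of mean [m] and
    standard deviation [s]. *)
Lemma gauss1d (t u z : R) : 2 * t * z ^+ 2 < 1 ->
  (\int[mu]_g (expR (t * (u + z * g) ^+ 2) * gpdf g)%:E =
   ((Num.sqrt (1 - 2 * t * z ^+ 2))^-1 * expR (t * u ^+ 2 / (1 - 2 * t * z ^+ 2)))%:E)%E.
Proof.
move=> h; set D := 1 - _; have D0 : 0 < D by rewrite /D; lra.
pose s := (Num.sqrt D)^-1; pose m := 2 * t * u * z / D.
have s0 : 0 < s by rewrite invr_gt0 sqrtr_gt0.
have s2 : s ^+ 2 = D^-1 by rewrite exprVn sqr_sqrtr// ltW.
have E g : expR (t * (u + z * g) ^+ 2) * gpdf g =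
    (s * expR (t * u ^+ 2 / D)) * normal_pdf m s g.
  rewrite gpdfE normal_pdfE ?gt_eqF// /normal_peak /normal_fun.
  have -> : Num.sqrt (s ^+ 2 * pi *+ 2) = s * Num.sqrt (2 * pi).
    by rewrite -mulrnAr -[pi *+ 2]mulr_natl sqrtrM ?sqr_ge0// sqrtr_sqr gtr0_norm.
  rewrite mulrCA -expRD.
  have -> : t * (u + z * g) ^+ 2 + - g ^+ 2 / 2 =
      t * u ^+ 2 / D + - (g - m) ^+ 2 / (s ^+ 2 *+ 2).
    have D1 : 1 - 2 * t * z ^+ 2 != 0 by rewrite gt_eqF.
    by rewrite s2 /m /D -mulr_natl; field.
  rewrite expRD; field.
  by rewrite !gt_eqF// sqrtr_gt0 mulr_gt0// pi_gt0.
under eq_integral do rewrite E EFinM.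
rewrite ge0_integralZl//.
- by rewrite integral_normal_pdf mule1.
- by apply/measurable_EFinP; exact: measurable_normal_pdf.
- by move=> g _; rewrite lee_fin normal_pdf_ge0.
- by rewrite lee_fin mulr_ge0// ?expR_ge0// ltW.
Qed.

End gaussian_density.

Section gaussian_vector.
Variables (R : realType) (n : nat).
Local Notation RB := (measurableTypeR R).
Local Notation mu := (@lebesgue_measure R).

Definition gden (y : 'cV[R]_n) : R := \prod_j gpdf (y j ord0).

Lemma gden_ge0 y : 0 <= gden y.
Proof. by apply: prodr_ge0 => j _; exact: gpdf_ge0. Qed.

Lemma measurable_gden d (Z : measurableType d) (f : Z -> 'cV[R]_n) :
  measurable_fun setT f -> measurable_fun setT (fun z => gden (f z) : RB).
Proof.
move=> mf; apply: measurable_prod => j _.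
apply: (measurableT_comp (f := @gpdf R : RB -> RB)); first exact: measurable_gpdf.
apply: (measurableT_comp (f := fun y : 'cV[R]_n => y j ord0 : RB)) => //.
exact: measurable_coord.
Qed.

Lemma iint_gauss (t z : R) (u : 'cV[R]_n) : 2 * t * z ^+ 2 < 1 ->
  iint (fun y => (expR (t * sqnorm (u + z *: y)) * gden y)%:E) =
  (((Num.sqrt (1 - 2 * t * z ^+ 2))^-1) ^+ n *
    expR (t * sqnorm u / (1 - 2 * t * z ^+ 2)))%:E.
Proof.
move=> h; set D := 1 - _.
pose f (j : 'I_n) g := expR (t * (u j ord0 + z * g) ^+ 2) * gpdf g.
transitivity (iint (fun y : 'cV[R]_n => (\prod_j f j (y j ord0))%:E)).
  apply: eq_iint => y; rewrite big_split /=; congr (EFin (_ * _)).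
  rewrite /sqnorm mulr_sumr expR_sum; apply: eq_bigr => j _.
  by rewrite !mxE.
rewrite iint_prod; first last.
- by move=> j g; rewrite mulr_ge0 ?expR_ge0 ?gpdf_ge0.
- move=> j; apply: measurable_funM; last exact: measurable_gpdf.
  apply: measurableT_comp => //; apply: measurable_funM => //.
  by apply: measurable_funX; apply: measurable_funD => //; exact: measurable_funM.
under eq_bigr do rewrite gauss1d//.
rewrite prodEFin; congr EFin; rewrite big_split /= prodr_const card_ord; congr (_ * _).
by rewrite -expR_sum -mulr_suml -mulr_sumr.
Qed.

Lemma iint_gden : iint (fun y => (gden y)%:E) = 1%E.
Proof.
have := @iint_gauss 0 0 0; rewrite !mulr0 !mul0r subr0 sqrtr1 invr1 expr1n => /(_ ltr01).
rewrite expR0 mulr1 => <-; apply: eq_iint => y; by rewrite mul0r expR0 mul1r.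
Qed.

End gaussian_vector.

Lemma pushforward_is_measure (R : realType) d1 d2 (T1 : measurableType d1)
    (T2 : measurableType d2) (nu : {measure set T1 -> \bar R}) (f : T1 -> T2) :
  measurable_fun setT f ->
  exists m : {measure set T2 -> \bar R}, (m : set T2 -> \bar R) = pushforward nu f.
Proof.
by move=> mf; unshelve eexists; [unshelve refine [the {measure set T2 -> \bar R} of pushforward nu f]|].
Qed.

(** * Laws of gaussian matrices and resampling of their entries *)

Section product_measure_matrices.
Variables (R : realType) (m n : nat).
Local Notation RB := (measurableTypeR R).

(** Boxes form a pi-system generating the sigma-algebra, and they are the events on which the
    gaussian hypothesis gives the law. *)
Definition mx_rect (B : 'I_n -> 'I_m -> set RB) : set 'M[R]_(n, m) :=
  [set M | forall j i, B j i (M j i)].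

Definition mx_rects : set (set 'M[R]_(n, m)) :=
  [set A | exists2 B, (forall j i, measurable (B j i)) & A = mx_rect B].

Lemma measurable_rect B : (forall j i, measurable (B j i)) -> measurable (mx_rect B).
Proof.
move=> mB.
have -> : mx_rect B = \bigcap_(j : 'I_n) \bigcap_(i : 'I_m) [set M : 'M[R]_(n, m) | B j i (M j i)].
  by apply/seteqP; split => M /= h j => [_ i _|i]; exact: h.
apply: fin_bigcap_measurable => // j _; apply: fin_bigcap_measurable => // i _.
by have := @measurable_coord R n m j i measurableT _ (mB j i); rewrite setTI.
Qed.

Lemma measurable_rectsE : @measurable _ 'M[R]_(n, m) = <<s mx_rects >>.
Proof.
apply/seteqP; split.
  apply: smallest_sub; first exact: smallest_sigma_algebra.
  move=> _ [j [i [B mB ->]]]; apply: sub_sigma_algebra.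
  exists (fun j' i' => if (j' == j) && (i' == i) then B else setT).
    by move=> j' i'; case: ifP.
  apply/seteqP; split => M /=.
    by move=> h j' i' /=; case: ifP => // /andP[/eqP -> /eqP ->].
  by move=> /(_ j i) /=; rewrite !eqxx.
apply: smallest_sub; first exact: sigma_algebra_measurable.
by move=> _ [B mB ->]; exact: measurable_rect.
Qed.

Lemma mx_measure_unique (m1 m2 : {measure set 'M[R]_(n, m) -> \bar R}) :
  (m1 setT < +oo)%E ->
  (forall B, (forall j i, measurable (B j i)) -> m1 (mx_rect B) = m2 (mx_rect B)) ->
  forall A, measurable A -> m1 A = m2 A.
Proof.
move=> fin E A mA; apply: (@measure_unique _ _ _ mx_rects (fun=> setT)) => //.
- exact: measurable_rectsE.
- move=> _ _ [B mB ->] [C mC ->]; exists (fun j i => B j i `&` C j i).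
    by move=> j i; exact: measurableI.
  apply/seteqP; split => M /=; first by move=> [h1 h2] j i; split; [exact: h1|exact: h2].
  by move=> h; split => j i; case: (h j i).
- move=> _; exists (fun _ _ => setT) => //.
  by apply/seteqP; split.
- by apply/seteqP; split => // M _; exists 0%N.
- by move=> _ [B mB ->]; exact: E.
Qed.

End product_measure_matrices.

Section gaussian_family.
Variables (R : realType) (d : measure_display) (T : measurableType d).
Variables (P : probability T R) (m n : nat) (G : 'I_m -> T -> 'cV[R]_n).
Hypothesis hG : std_gaussian_family P G.
Local Notation RB := (measurableTypeR R).
Local Notation mu := (@lebesgue_measure R).

Definition gmx w : 'M[R]_(n, m) := \matrix_(j, i) G i w j ord0.

Lemma measurable_gmx : measurable_fun setT gmx.
Proof.
by apply: measurable_mxP => j i; under eq_fun do rewrite mxE; case: hG => h _; exact: h.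
Qed.

Lemma prob_rect B : (forall j i, measurable (B j i)) ->
  P (gmx @^-1` mx_rect B) = (\prod_(i < m) \prod_(j < n) normal_prob 0 1 (B j i))%E.
Proof.
move=> mB; case: hG => _ [h1 h2].
have := h2 (fun i j => B j i) (fun i j => mB j i).
move=> e; transitivity (P [set w | forall i j, B j i (G i w j ord0)]); last first.
  by rewrite e; apply: eq_bigr => i _; apply: eq_bigr => j _; apply: h1; exact: mB.
congr (P _); apply/seteqP; split => w /= h.
  by move=> i j; have := h j i; rewrite mxE.
by move=> j i; rewrite mxE; exact: h.
Qed.

Local Open Scope ereal_scope.

(** Overwriting one entry with an independent normal variable leaves the probability of every box
    unchanged, hence the law of the matrix; Tonelli and the density give the inner integral. *)
Lemma replace_entry (j : 'I_n) (i : 'I_m) (F : 'M[R]_(n, m) -> \bar R) :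
  measurable_fun setT F -> (forall M, 0 <= F M) ->
  \int[P]_w F (gmx w) = \int[P]_w \int[mu]_t (F (upd (gmx w) j i t) * (gpdf t)%:E).
Proof.
move=> mF F0.
pose N : probability RB R := normal_prob 0 1.
pose Psi (p : T * RB) := upd (gmx p.1) j i p.2.
have mPsi : measurable_fun setT Psi.
  by apply: measurable_upd => //; apply: measurableT_comp => //; exact: measurable_gmx.
have [m1 m1E] := pushforward_is_measure P measurable_gmx.
have [m2 m2E] := pushforward_is_measure (P \x N) mPsi.
have E A : measurable A -> m1 A = m2 A.
  apply: mx_measure_unique.
    rewrite m1E /pushforward; apply: (@le_lt_trans _ _ 1); last exact: ltry.
    by apply: probability_le1; rewrite preimage_setT.
  move=> B mB; rewrite m1E m2E /pushforward.
  (* The side of the box at the overwritten entry is relaxed to the whole line, since its constraint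
     now bears on the fresh variable. *)
  pose B' j' i' := if (j' == j) && (i' == i) then setT else B j' i'.
  have mB' j' i' : measurable (B' j' i') by rewrite /B'; case: ifP.
  have -> : Psi @^-1` mx_rect B = (gmx @^-1` mx_rect B') `*` B j i.
    apply/seteqP; split => -[w t] /=.
      move=> h; split; last by have := h j i; rewrite mxE !eqxx.
      move=> j' i'; rewrite /B'; case: ifP => // ne.
      by have := h j' i'; rewrite [upd _ _ _ _ _ _]mxE ne.
    move=> [h1 h2] j' i'; rewrite [upd _ _ _ _ _ _]mxE; case: ifP => [/andP[/eqP -> /eqP ->]//|ne].
    by have := h1 j' i'; rewrite /B' ne.
  have mA' : measurable (gmx @^-1` mx_rect B').
    by have := measurable_gmx measurableT (measurable_rect mB'); rewrite setTI.
  transitivity (P (gmx @^-1` mx_rect B') * N (B j i)); last first.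
    by apply/esym; exact: (product_measure1E P N mA' (mB j i)).
  etransitivity; first exact: (prob_rect mB).
  rewrite (prob_rect mB').
  rewrite [LHS](bigD1 i)//= [X in X * _ = _](bigD1 j)//=.
  rewrite [X in _ = X * _](bigD1 i)//= [X in _ = X * _ * _](bigD1 j)//=.
  rewrite /B' !eqxx /= -[normal_prob 0 1 setT]/(N setT) probability_setT mul1e.
  rewrite -muleA muleC; congr (_ * _ * _).
    by apply: eq_bigr => j' /negPf ->.
  apply: eq_bigr => i' /negPf ne; apply: eq_bigr => j' _; by rewrite ne andbF.
transitivity (\int[m1]_M F M).
  by rewrite m1E ge0_integral_pushforward//= ?preimage_setT//; exact: measurable_gmx.
transitivity (\int[m2]_M F M).
  by apply: eq_measure_integral => A mA _; first [exact: E | exact/esym/E].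
rewrite m2E ge0_integral_pushforward//= preimage_setT.
rewrite fubini_tonelli1//=; last exact: (measurableT_comp mF mPsi).
apply: eq_integral => w _; rewrite /fubini_F /= integral_normal_prob//.
have mu1 : measurable_fun setT (fun t : RB => upd (gmx w) j i t).
  by apply: measurable_upd => //; exact: measurable_cst.
exact: (measurableT_comp mF mu1).
Qed.

Definition setcol (M : 'M[R]_(n, m)) (i : 'I_m) (y : 'cV[R]_n) : 'M[R]_(n, m) :=
  \matrix_(k, l) if l == i then y k ord0 else M k l.

Lemma measurable_setcol d' (Z : measurableType d') (f : Z -> 'M[R]_(n, m)) (g : Z -> 'cV[R]_n) i :
  measurable_fun setT f -> measurable_fun setT g ->
  measurable_fun setT (fun z => setcol (f z) i (g z)).
Proof.
move=> mf mg; apply: measurable_mxP => k l; under eq_fun do rewrite mxE.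
case: (l == i).
  by apply: (measurableT_comp (f := fun y : 'cV[R]_n => y k ord0 : RB)) => //; exact: measurable_coord.
by apply: (measurableT_comp (f := fun y : 'M[R]_(n, m) => y k l : RB)) => //; exact: measurable_coord.
Qed.

Lemma measurable_col d' (Z : measurableType d') (f : Z -> 'M[R]_(n, m)) i :
  measurable_fun setT f -> measurable_fun setT (fun z => col i (f z)).
Proof.
move=> mf; apply: measurable_mxP => k l; under eq_fun do rewrite mxE.
by apply: (measurableT_comp (f := fun y : 'M[R]_(n, m) => y k i : RB)) => //; exact: measurable_coord.
Qed.

Lemma fintZ (s : seq 'I_n) (j : 'I_n) (H : 'cV[R]_n -> \bar R) (c : R -> R) x :
  measurable_fun setT H -> (forall y, 0 <= H y) -> (forall t, 0 <= c t)%R -> j \notin s ->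
  fint s (fun y => (c (y j ord0))%:E * H y) x = (c (x j ord0))%:E * fint s H x.
Proof.
move=> mH H0 c0; elim: s x => //= k s IH x; rewrite inE negb_or => /andP[jk js].
under eq_integral do rewrite IH// mxE (negPf jk) /=.
have mu1 : measurable_fun setT (fun t : RB => upd x k ord0 t).
  by apply: measurable_upd => //; exact: measurable_cst.
rewrite ge0_integralZl//.
- exact: (measurableT_comp (measurable_fint1 s mH H0) mu1).
- by move=> t _; exact: fint_ge0.
- by rewrite lee_fin.
Qed.

Lemma replace_col (i : 'I_m) (F : 'M[R]_(n, m) -> \bar R) :
  measurable_fun setT F -> (forall M, 0 <= F M) ->
  \int[P]_w F (gmx w) =
  \int[P]_w iint (fun y : 'cV[R]_n => (gden y)%:E * F (setcol (gmx w) i y)).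
Proof.
move=> mF F0.
pose wt (s : seq 'I_n) (y : 'cV[R]_n) := (\prod_(j <- s) gpdf (y j ord0))%R.
have wt0 s y : (0 <= wt s y)%R by apply: prodr_ge0 => j _; exact: gpdf_ge0.
have mwt s : measurable_fun setT (wt s : 'cV[R]_n -> RB).
  apply: measurable_prod => j _.
  apply: (measurableT_comp (f := @gpdf R : RB -> RB)); first exact: measurable_gpdf.
  exact: measurable_coord.
(* Intermediate stage: the coordinates of column [i] listed in [s] are resampled, the others are
   still read from [M]. The induction adds one coordinate at a time. *)
pose Kf s (M : 'M[R]_(n, m)) := fint s (fun y => (wt s y)%:E * F (setcol M i y)) (col i M).
have mH s : measurable_fun setT (fun p : 'M[R]_(n, m) * 'cV[R]_n => (wt s p.2)%:E * F (setcol p.1 i p.2)).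
  apply: emeasurable_funM; first by apply/measurable_EFinP; exact: (measurableT_comp (mwt s) measurable_snd).
  by apply: measurableT_comp => //; exact: measurable_setcol.
have mK s : measurable_fun setT (Kf s).
  have H0 (p : 'M[R]_(n, m) * 'cV[R]_n) : 0 <= (wt s p.2)%:E * F (setcol p.1 i p.2).
    by apply: mule_ge0 => //; rewrite lee_fin.
  have h := @measurable_fint R n _ _ s _ (mH s) H0.
  apply: (@measurableT_comp _ _ _ _ _ _ _ _ (fun M : 'M[R]_(n, m) => (M, col i M)) h).
  by apply: measurable_fun_pair => //; exact: measurable_col.
have K0 s M : 0 <= Kf s M.
  by apply: fint_ge0 => y; apply: mule_ge0 => //; rewrite lee_fin.
suff H s : uniq s -> \int[P]_w F (gmx w) = \int[P]_w Kf s (gmx w).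
  rewrite (H (enum 'I_n) (enum_uniq _)); apply: eq_integral => w _.
  rewrite (iint_fint _ (col i (gmx w))); congr (fint _ _ _); apply/funext => y.
  by congr (_%:E * _); rewrite /wt /gden big_enum.
elim: s => [|j s IH] /= => [_|/andP[js us]].
  apply: eq_integral => w _; rewrite /Kf /= /wt big_nil mul1e; congr F.
  by apply/matrixP => k l; rewrite !mxE; case: eqP => // ->.
rewrite IH// (replace_entry j i (mK s))//; apply: eq_integral => w _.
rewrite /Kf /=; apply: eq_integral => t _.
have cE : col i (upd (gmx w) j i t) = upd (col i (gmx w)) j ord0 t.
  by apply/matrixP => k l; rewrite !mxE [l]ord1 eqxx andbT.
have sE y : setcol (upd (gmx w) j i t) i y = setcol (gmx w) i y.
  apply/matrixP => k l; rewrite [LHS]mxE [RHS]mxE; case: eqP => // ne.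
  by rewrite mxE; case: ifP => // /andP[_ /eqP].
transitivity (fint s (fun y => (gpdf (y j ord0))%:E * ((wt s y)%:E * F (setcol (gmx w) i y)))
     (upd (col i (gmx w)) j ord0 t)); last first.
  by congr (fint _ _ _); apply/funext => y; rewrite /wt big_cons EFinM muleA.
rewrite fintZ//.
- rewrite mxE !eqxx /= muleC cE; congr (_ * fint _ _ _).
  by apply/funext => y; rewrite sE.
- have := mH s => h; apply: (@measurableT_comp _ _ _ _ _ _ _ _ (fun y : 'cV[R]_n => (gmx w, y)) h).
  exact: measurable_pair1.
- by move=> y; apply: mule_ge0 => //; rewrite lee_fin.
- exact: gpdf_ge0.
Qed.

End gaussian_family.

(** Each sign is chosen to make the new cross term nonnegative. A bound on all signed sums thus also
    bounds the sum of the squared norms. *)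
Lemma greedy_signs (R : realType) n (I : eqType) (s : seq I) (g : I -> 'cV[R]_n) :
  exists e : I -> bool,
    \sum_(i <- s) sqnorm (g i) <= sqnorm (\sum_(i <- s) (-1) ^+ e i *: g i) \/ ~~ uniq s.
Proof.
elim: s => [|i s [e he]].
  by exists (fun=> false); left; rewrite !big_nil sqnorm_ge0.
have [us|us] := boolP (uniq (i :: s)); last by exists e; right.
case: he => [he|]; last by move: us => /= /andP[_ ->].
pose v := \sum_(i <- s) (-1) ^+ e i *: g i.
pose b := dot (g i) v < 0.
exists (fun k => if k == i then b else e k); left; rewrite !big_cons eqxx.
have -> : \sum_(j <- s) (-1) ^+ (if j == i then b else e j) *: g j = v.
  apply: eq_big_seq => j js; case: eqP => // ji.
  by move: us => /= /andP[]; rewrite -ji js.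
rewrite sqnormD sqnormZ sqrr_sign mul1r dotZl.
have h : 0 <= (-1) ^+ b * dot (g i) v.
  rewrite /b; case: ltP => h; first by rewrite expr1 mulN1r oppr_ge0 ltW.
  by rewrite expr0 mul1r.
by rewrite -addrA lerD2l; apply: le_trans he _; rewrite lerDr mulr_ge0.
Qed.

Section markov.
Context (R : realType) d (T : measurableType d) (P : probability T R).
Local Open Scope ereal_scope.

Lemma markov_ge0 (f : T -> \bar R) (c : R) : measurable_fun setT f -> (forall w, 0 <= f w) ->
  (0 < c)%R -> measurable [set w | c%:E <= f w] ->
  P [set w | c%:E <= f w] <= (c^-1)%:E * \int[P]_w f w.
Proof.
move=> mf f0 c0 mA.
set A := [set w | _] in mA *.
have -> : P A = (c^-1)%:E * (c%:E * P A).
  by rewrite muleA -EFinM mulVf ?gt_eqF// mul1e.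
apply: lee_wpmul2l; first by rewrite lee_fin invr_ge0 ltW.
have -> : c%:E * P A = \int[P]_w (c * \1_A w)%:E.
  under eq_integral do rewrite EFinM.
  rewrite ge0_integralZl//.
  - by rewrite integral_indic//= setIT.
  - by apply/measurable_EFinP; exact: measurable_indic.
  - by rewrite lee_fin ltW.
apply: ge0_le_integral => //.
- by move=> w _; rewrite lee_fin mulr_ge0// ltW.
- by apply/measurable_EFinP; apply: measurable_funM => //; exact: measurable_indic.
- move=> w _; rewrite indicE; have [h|h] := boolP (w \in A).
    by rewrite mulr1; exact: set_mem h.
  by rewrite mulr0.
Qed.

Lemma prob_union_bound (I : finType) (S : {set I}) (Q : I -> set T) (A : set T) (b : R) :
  measurable A -> (forall i, measurable (Q i)) ->
  (forall w, A w -> exists2 i, i \in S & Q i w) ->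
  (forall i, i \in S -> P (Q i) <= b%:E) -> P A <= (#|S|%:R * b)%:E.
Proof.
move=> mA mQ AQ Pb.
have PE B : measurable B -> P B = \int[P]_w (\1_B w)%:E.
  by move=> mB; rewrite integral_indic//= setIT.
rewrite PE//.
apply: (@le_trans _ _ (\int[P]_w \sum_(i <- enum S) (\1_(Q i) w)%:E)).
  apply: ge0_le_integral => //.
  - by apply/measurable_EFinP; exact: measurable_indic.
  - by apply: emeasurable_sum => i; apply/measurable_EFinP; exact: measurable_indic.
  - move=> w _; rewrite sumEFin lee_fin; have [Aw|Aw] := boolP (w \in A); last first.
      by rewrite indicE (negPf Aw); apply: sumr_ge0.
    have [i iS Qi] := AQ w (set_mem Aw); rewrite big_enum /= (bigD1 i)//= !indicE Aw mem_set//.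
    by rewrite lerDl; apply: sumr_ge0.
rewrite ge0_integral_sum//; last first.
  by move=> i; apply/measurable_EFinP; exact: measurable_indic.
rewrite big_enum /=.
apply: (@le_trans _ _ (\sum_(i in S) b%:E)).
  by apply: lee_sum => i iS; rewrite -PE// Pb.
by rewrite sumEFin lee_fin sumr_const mulr_natl.
Qed.

End markov.

(** * Signed sums of few gaussian vectors *)

Section quadratic_event.
Variables (R : realType) (d : measure_display) (T : measurableType d).
Variables (P : probability T R) (m n : nat) (G : 'I_m -> T -> 'cV[R]_n).
Hypothesis hG : std_gaussian_family P G.
Local Notation RB := (measurableTypeR R).

Definition lin_comb (s : seq 'I_m) (e : 'I_m -> R) (M : 'M[R]_(n, m)) : 'cV[R]_n :=
  \sum_(i <- s) e i *: col i M.

Lemma measurable_lin_comb s e d' (Z : measurableType d') (f : Z -> 'M[R]_(n, m)) (u : 'cV[R]_n) :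
  measurable_fun setT f -> measurable_fun setT (fun z => u + lin_comb s e (f z)).
Proof.
move=> mf; apply: measurable_mxP => k l; under eq_fun do rewrite mxE summxE.
apply: measurable_funD => //; apply: measurable_sum => i.
under eq_fun do rewrite !mxE.
apply: measurable_funM => //.
by apply: (measurableT_comp (f := fun y : 'M[R]_(n, m) => y k i : RB)) => //; exact: measurable_coord.
Qed.

Lemma measurable_exp_quad s e t d' (Z : measurableType d') (f : Z -> 'M[R]_(n, m)) (u : 'cV[R]_n) :
  measurable_fun setT f ->
  measurable_fun setT (fun z => (expR (t * sqnorm (u + lin_comb s e (f z))))%:E : \bar R).
Proof.
move=> mf; apply/measurable_EFinP; apply: measurableT_comp => //; apply: measurable_funM => //.
by apply: measurable_sqnorm; exact: measurable_lin_comb.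
Qed.

(** The vector is gaussian with mean [u] and coordinates of variance the sum of the e_i^2, so this
    is a noncentral chi-square transform. Columns are integrated out one by one; [u] is arbitrary
    because the columns still present act as part of the mean. *)
Lemma exp_moment (s : seq 'I_m) (e : 'I_m -> R) (t : R) (u : 'cV[R]_n) :
  uniq s -> 2 * t * \sum_(i <- s) e i ^+ 2 < 1 ->
  (\int[P]_w (expR (t * sqnorm (u + lin_comb s e (gmx G w))))%:E =
  (((Num.sqrt (1 - 2 * t * \sum_(i <- s) e i ^+ 2))^-1) ^+ n *
    expR (t * sqnorm u / (1 - 2 * t * \sum_(i <- s) e i ^+ 2)))%:E)%E.
Proof.
elim: s t u => [|i s IH] t u.
  move=> _ _; rewrite big_nil mulr0 subr0 sqrtr1 invr1 expr1n mul1r mulr1.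
  under eq_integral do rewrite /lin_comb big_nil addr0.
  by rewrite integral_cst//= probability_setT mule1.
rewrite /= => /andP[is_ us]; rewrite big_cons; set a := e i ^+ 2; set b := \sum_(j <- s) _.
have a0 : 0 <= a by exact: sqr_ge0.
have b0 : 0 <= b by apply: sumr_ge0 => j _; exact: sqr_ge0.
move=> hab.
have ha : 2 * t * a < 1.
  have [t0|t0] := leP 0 t; first by rewrite (le_lt_trans _ hab)// ler_wpM2l ?lerDl// mulr_ge0.
  by rewrite (le_lt_trans _ ltr01)// mulr_le0_ge0// mulr_ge0_le0// ltW.
have D0 : 0 < 1 - 2 * t * a by lra.
rewrite (replace_col hG i (F := fun M => (expR (t * sqnorm (u + lin_comb (i :: s) e M)))%:E)); last 2 first.
- exact: (@measurable_exp_quad (i :: s) e t _ _ id u (@measurable_id _ _ setT)).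
- by move=> M; rewrite lee_fin expR_ge0.
(* Integrating out column [i] changes t into t / (1 - 2 t e_i^2); the factors 1 - 2 t (partial sum)
   telescope. *)
pose t' := t / (1 - 2 * t * a).
pose k := ((Num.sqrt (1 - 2 * t * a))^-1) ^+ n.
have E w : iint (fun y : 'cV[R]_n => (gden y)%:E *
     (expR (t * sqnorm (u + lin_comb (i :: s) e (setcol (gmx G w) i y))))%:E)%E =
     (k * expR (t' * sqnorm (u + lin_comb s e (gmx G w))))%:E.
  have := @iint_gauss R n t (e i) (u + lin_comb s e (gmx G w)) ha.
  rewrite -/a (_ : t * _ / _ = t' * sqnorm (u + lin_comb s e (gmx G w))); last by rewrite /t' mulrAC.
  rewrite -/k => <-; apply: eq_iint => y; rewrite -EFinM mulrC; congr (EFin (expR (t * sqnorm _) * _)).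
  rewrite -addrA (addrC _ (e i *: y)); congr (_ + _).
  rewrite /lin_comb big_cons; congr (_ + _).
    by congr (_ *: _); apply/matrixP => x z; rewrite !mxE eqxx [z]ord1.
  apply: eq_big_seq => j js; congr (_ *: _); apply/matrixP => x z; rewrite !mxE.
  by case: eqP => // ji; move: is_; rewrite -ji js.
under eq_integral do rewrite E EFinM.
have k0 : 0 <= k by rewrite exprn_ge0// invr_ge0.
rewrite ge0_integralZl//; try (by move=> w _; rewrite lee_fin expR_ge0);
  try (by apply: measurable_exp_quad; exact: (measurable_gmx hG)); try by rewrite lee_fin.
have D' : 1 - 2 * t' * b = (1 - 2 * t * (a + b)) / (1 - 2 * t * a).
  rewrite /t'; field; lra.
have hb : 2 * t' * b < 1.
  by rewrite -subr_gt0 D' divr_gt0//; lra.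
rewrite IH// -/b -EFinM; congr EFin; rewrite mulrA; congr (_ * expR _).
  rewrite /k -exprMn; congr (_ ^+ n); rewrite -invfM; congr (_^-1).
  rewrite -sqrtrM; last exact: ltW.
  by rewrite D' mulrC divfK// gt_eqF.
have D1 : 1 - 2 * t * a != 0 by rewrite gt_eqF.
have D2 : 1 - 2 * t * (a + b) != 0 by rewrite gt_eqF//; lra.
rewrite D' /t'; field.
by rewrite D1 D2.
Qed.

(** Codes 0, 1, 2 stand for the coefficients 0, 1, -1, so that sign patterns with their supports
    form a finite type. *)
Definition sgn3 (k : 'I_3) : R := (k == 1 :> nat)%:R - (k == 2 :> nat)%:R.
Definition supp3 (e : {ffun 'I_m -> 'I_3}) : {set 'I_m} := [set i | e i != ord0]%SET.

(** Weigh each pattern by t to the size of its support: patterns with support at most k weigh at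
    least t^k, and all weights sum to (1 + 2t)^m. *)
Lemma card_supp3_le k (t : R) : 0 < t <= 1 ->
  #|[set e | (#|supp3 e| <= k)%N]%SET|%:R <= t ^- k * (1 + 2 * t) ^+ m.
Proof.
move=> /andP[t0 t1]; rewrite ler_pdivlMl ?exprn_gt0//.
rewrite mulrC -sum1_card natr_sum mulr_suml.
have -> : (1 + 2 * t) ^+ m = \sum_(e : {ffun 'I_m -> 'I_3}) \prod_i (if e i == ord0 then 1 else t).
  rewrite -(bigA_distr_bigA (fun _ k => if k == ord0 then 1 else t)) /=.
  by under eq_bigr do rewrite !big_ord_recl big_ord0 /=; rewrite prodr_const card_ord; congr (_ ^+ m); ring.
rewrite [leRHS](bigID (mem [set e | (#|supp3 e| <= k)%N]%SET)) /= ler_wpDr//.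
  by apply: sumr_ge0 => e _; apply: prodr_ge0 => i _; case: ifP => _; rewrite ?ltW.
apply: ler_sum => e; rewrite inE => ek; rewrite mul1r.
have -> : \prod_i (if e i == ord0 then 1 else t) = t ^+ #|supp3 e|.
  rewrite (bigID (mem (supp3 e))) /= [X in _ * X]big1 ?mulr1; last first.
    by move=> i; rewrite inE negbK => ->.
  rewrite -prodr_const; apply: eq_bigr => i; rewrite inE => /negPf -> //.
by rewrite ler_wiXn2l// ltW.
Qed.

Definition quad_good (k : nat) (B0 : R) : set T :=
  [set w | forall e : {ffun 'I_m -> 'I_3}, (#|supp3 e| <= k)%N ->
     sqnorm (\sum_i sgn3 (e i) *: G i w) <= B0].

Lemma lin_combE e w : lin_comb (index_enum _) e (gmx G w) = \sum_i e i *: G i w.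
Proof.
by apply: eq_bigr => i _; congr (_ *: _); apply/matrixP => a b; rewrite !mxE [b]ord1.
Qed.

Lemma sgn3_sqr k : sgn3 k ^+ 2 = (k != ord0)%:R.
Proof.
rewrite /sgn3; case: k => -[|[|[|//]]] h /=; rewrite ?mulr0n ?mulr1n.
- by rewrite subrr expr0n.
- by rewrite subr0 expr1n.
- by rewrite sub0r sqrrN expr1n.
Qed.

Lemma quad_good_prob (k : nat) (B0 tau : R) : (0 < k)%N -> 0 < tau <= 1 ->
  measurable (quad_good k B0) /\
  (P (~` quad_good k B0) <=
    (tau ^- k * (1 + 2 * tau) ^+ m * (2 ^+ n * expR (- B0 / (4 * k%:R))))%:E)%E.
Proof.
move=> k0 ht.
have k0' : 0 < k%:R :> R by rewrite ltr0n.
pose Q (e : {ffun 'I_m -> 'I_3}) : set T := [set w | B0 < sqnorm (\sum_i sgn3 (e i) *: G i w)].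
have mq (e : {ffun 'I_m -> 'I_3}) : measurable_fun setT (fun w => sqnorm (\sum_i sgn3 (e i) *: G i w) : RB).
  under eq_fun do rewrite -(lin_combE (fun i => sgn3 (e i))) -[lin_comb _ _ _]add0r.
  by apply: measurable_sqnorm; apply: measurable_lin_comb; exact: (measurable_gmx hG).
have mQ e : measurable (Q e).
  have := mq e measurableT `]B0, +oo[%classic (measurable_itv _).
  by rewrite setTI; congr measurable; apply/seteqP; split => z /=; rewrite in_itv /= andbT.
have E : ~` quad_good k B0 = \bigcup_(e in [set e | (#|supp3 e| <= k)%N]) Q e.
  apply/seteqP; split => w.
    move=> h; apply: contrapT => h'; apply: h => e ek; rewrite leNgt; apply/negP => he.
    by apply: h'; exists e.
  by move=> [e /= ek] /= he h; have := h e ek; rewrite leNgt he.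
have mB : measurable (~` quad_good k B0) by rewrite E; apply: fin_bigcup_measurable.
split; first by rewrite -[quad_good _ _]setCK; exact: measurableC.
have PQ e : (#|supp3 e| <= k)%N -> (P (Q e) <= (2 ^+ n * expR (- B0 / (4 * k%:R)))%:E)%E.
  (* With variance at most k, this t gives 2 t sg <= 1/2, so the prefactor of the exponential moment
     is at most 2^n. *)
  move=> ek; pose t : R := (4 * k%:R)^-1.
  have t0 : 0 < t by rewrite invr_gt0 mulr_gt0.
  pose sg := \sum_(i <- index_enum 'I_m) sgn3 (e i) ^+ 2.
  have sgk : sg <= k%:R.
    rewrite /sg; under eq_bigr do rewrite sgn3_sqr.
    rewrite -natr_sum ler_nat (leq_trans _ ek)// -sum1_card [X in (_ <= X)%N]big_mkcond /=.
    by apply: leq_sum => i _; rewrite inE; case: (e i != ord0).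
  have sg0 : 0 <= sg by apply: sumr_ge0 => i _; exact: sqr_ge0.
  have tk : t * k%:R = 4^-1 by rewrite /t invfM -mulrA mulVf ?mulr1// gt_eqF.
  have h1 : 2 * t * sg <= 2^-1.
    have : t * sg <= t * k%:R by rewrite ler_wpM2l// ltW.
    by rewrite tk; lra.
  have h2 : 2 * t * sg < 1 by lra.
  have mm := @exp_moment (index_enum _) (fun i => sgn3 (e i)) t 0 (index_enum_uniq _) h2.
  rewrite -/sg (_ : sqnorm 0 = 0) in mm; last by rewrite sqnorm_dot dot0r.
  rewrite mulr0 mul0r expR0 mulr1 in mm.
  pose f w := (expR (t * sqnorm (\sum_i sgn3 (e i) *: G i w)))%:E : \bar R.
  have fE w : f w = (expR (t * sqnorm (0 + lin_comb (index_enum _) (fun i => sgn3 (e i)) (gmx G w))))%:E.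
    by rewrite add0r lin_combE.
  have mf : measurable_fun setT f.
    rewrite (funext fE); apply: measurable_exp_quad; exact: (measurable_gmx hG).
  have f0 w : (0 <= f w)%E by rewrite lee_fin expR_ge0.
  have mA : measurable [set w | (expR (t * B0))%:E <= f w]%E.
    have := @emeasurable_fun_c_infty _ _ _ setT f measurableT mf (expR (t * B0))%:E.
    by rewrite setTI.
  have := markov_ge0 P mf f0 (expR_gt0 (t * B0)) mA => hM.
  apply: le_trans (le_trans hM _).
    apply: le_measure; rewrite ?inE//.
    by move=> w /= qw; rewrite lee_fin ler_expR ler_wpM2l ?ltW.
  under eq_integral do rewrite fE.
  rewrite mm -EFinM lee_fin mulrC ler_pM ?invr_ge0 ?expR_ge0 ?exprn_ge0 ?invr_ge0//.
    rewrite lerXn2r ?nnegrE ?invr_ge0//.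
    have D4 : (2^-1) ^+ 2 <= 1 - 2 * t * sg.
      have -> : (2^-1 : R) ^+ 2 = 4^-1 by rewrite expr2 -invfM -natrM.
      by lra.
    rewrite -[leRHS]invrK lef_pV2 ?posrE ?invr_gt0// ?sqrtr_gt0; last by lra.
    by rewrite -(@ger0_norm _ (2^-1 : R)) ?invr_ge0// -sqrtr_sqr ler_wsqrtr.
  by rewrite -expRN ler_expR /t mulNr mulrC.
have := @prob_union_bound _ _ _ P _ [set e | (#|supp3 e| <= k)%N]%SET Q (~` quad_good k B0)
  (2 ^+ n * expR (- B0 / (4 * k%:R))) mB mQ.
move=> /(_ _ _)/le_trans; apply.
- by move=> w; rewrite E => -[e /= ek he]; exists e => //; rewrite inE.
- by move=> e; rewrite inE => /PQ.
rewrite lee_fin ler_wpM2r ?mulr_ge0 ?exprn_ge0 ?expR_ge0//.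
exact: card_supp3_le.
Qed.

End quadratic_event.

(** * Determinants of gaussian matrices *)

Lemma measurable_inv (R : realType) :
  measurable_fun setT (fun x : measurableTypeR R => x^-1 : measurableTypeR R).
Proof.
have -> : [set: measurableTypeR R] = [set 0] `|` [set x | x != 0].
  by apply/seteqP; split => // x _; have [->|x0] := eqVneq x 0; [left|right].
have op : open [set x : R | x != 0] by exact: open_neq.
apply/measurable_funU => //.
  exact: open_measurable.
split; first exact: measurable_fun_set1.
apply: open_continuous_measurable_fun => // x; rewrite inE /= => x0.
exact: inv_continuous.
Qed.

Section cauchy_integrals.
Variable R : realType.
Local Notation RB := (measurableTypeR R).
Local Notation mu := (@lebesgue_measure R).

Lemma integralT_oneDsqr : (\int[mu]_x ((1 + x ^+ 2)^-1)%:E = pi%:E)%E.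
Proof.
rewrite (@ge0_symfun_integralT R (fun x => (1 + x ^+ 2)^-1)).
- have := @integral0y_oneDsqr R; rewrite /oneDsqr.
  rewrite -set_itvcy => ->; rewrite -EFinM; congr EFin; lra.
- by move=> x; rewrite invr_ge0 addr_ge0// sqr_ge0.
- exact: (@continuous_oneDsqrV R).
- by move=> x; rewrite /= sqrrN.
Qed.

Lemma integralT_scaled_oneDsqr (b : R) : 0 < b ->
  (\int[mu]_x ((1 + b ^+ 2 * x ^+ 2)^-1)%:E = (pi / b)%:E)%E.
Proof.
move=> b0.
have := @lebesgue_affine R b 0 (fun x => ((1 + x ^+ 2)^-1)%:E) (lt0r_neq0 b0).
rewrite integralT_oneDsqr gtr0_norm// -EFinM mulrC => <-.
- by apply: eq_integral => x _; rewrite addr0 exprMn.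
- apply/measurable_EFinP; apply: continuous_measurable_fun; exact: (@continuous_oneDsqrV R).
- by move=> x; rewrite lee_fin invr_ge0 addr_ge0// sqr_ge0.
Qed.

(** Bernoulli's inequality (1 + s)^(j/2) >= 1 + (j/2) s, written with y^2 = 1 + s to stay with
    integer powers. *)
Lemma bernoulli_half (y : R) j : 1 <= y -> (2 <= j)%N -> 1 + j%:R / 2 * (y ^+ 2 - 1) <= y ^+ j.
Proof.
move=> y1; elim: j => // -[|[|j]] IH // _.
  by rewrite divff// mul1r; lra.
have {IH} := IH isT; set J := j.+2; move=> IH.
rewrite [y ^+ J.+1]exprS -[in J.+1%:R]addn1 natrD.
have J2 : 2 <= J%:R :> R by rewrite ler_nat.
have h1 : y * (1 + J%:R / 2 * (y ^+ 2 - 1)) <= y * y ^+ J by rewrite ler_wpM2l//; lra.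
apply: (le_trans _ h1).
have y2 : 1 <= y ^+ 2 by rewrite exprn_ege1.
have h3 : 1 * (y ^+ 2 - 1) <= J%:R / 2 * (y ^+ 2 - 1) by rewrite ler_wpM2r; lra.
have h4 : 0 <= (y - 1) * (J%:R / 2 * (y ^+ 2 - 1) - 1 * (y ^+ 2 - 1)) by rewrite mulr_ge0; lra.
have h5 : 0 <= (y - 1) * (y ^+ 2 - (y + 1) / 2) by rewrite mulr_ge0; nra.
nra.
Qed.

Definition cauchy_cst (j : nat) : R := pi * Num.sqrt (2 / j%:R).

Lemma cauchy_cst_ge0 j : 0 <= cauchy_cst j.
Proof. by rewrite mulr_ge0// pi_ge0. Qed.

Lemma measurable_cauchy d (Z : measurableType d) (f : Z -> RB) j :
  measurable_fun setT f -> measurable_fun setT (fun z => (Num.sqrt (f z))^-1 ^+ j : RB).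
Proof.
move=> mf; apply: measurable_funX.
have ms : measurable_fun setT (fun x : RB => Num.sqrt x : RB).
  by apply: continuous_measurable_fun; exact: sqrt_continuous.
exact: (measurableT_comp (@measurable_inv R) (measurableT_comp ms mf)).
Qed.

(** By [bernoulli_half], (1 + t^2/a)^(j/2) >= 1 + j t^2 / (2a), which leaves a Cauchy integral. Its
    value pi / b contributes sqrt(a) and so lowers the power of 1 / sqrt(a) by one. *)
Lemma integral_cauchy_le (a : R) j : 0 < a -> (2 <= j)%N ->
  (\int[mu]_t (((Num.sqrt (a + t ^+ 2))^-1) ^+ j)%:E <=
   (cauchy_cst j * ((Num.sqrt a)^-1) ^+ j.-1)%:E)%E.
Proof.
move=> a0 j2; have j0 : 0 < j%:R :> R by rewrite ltr0n (leq_trans _ j2).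
have sa0 : 0 < Num.sqrt a by rewrite sqrtr_gt0.
pose b := Num.sqrt (j%:R / (2 * a)).
have b0 : 0 < b by rewrite sqrtr_gt0 divr_gt0// mulr_gt0.
have b2 : b ^+ 2 = j%:R / (2 * a) by rewrite sqr_sqrtr// ltW// divr_gt0// mulr_gt0.
apply: (@le_trans _ _ (\int[mu]_t ((((Num.sqrt a)^-1) ^+ j)%:E * ((1 + b ^+ 2 * t ^+ 2)^-1)%:E))%E).
  apply: ge0_le_integral => //.
  - apply/measurable_EFinP; apply: measurable_cauchy.
    by apply: measurable_funD => //; exact: measurable_funX.
  - apply: measurable_funeM; apply/measurable_EFinP.
    apply: measurableT_comp; first exact: measurable_inv.
    by apply: measurable_funD => //; apply: measurable_funM => //; exact: measurable_funX.
  - move=> t _; rewrite -EFinM lee_fin !exprVn -invfM lef_pV2 ?posrE; last 2 first.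
    + by rewrite exprn_gt0// sqrtr_gt0 ltr_wpDr// sqr_ge0.
    + by rewrite mulr_gt0 ?exprn_gt0// ltr_wpDr// mulr_ge0 ?sqr_ge0// ltW.
    pose y := Num.sqrt (1 + t ^+ 2 / a).
    have ta : 0 <= t ^+ 2 / a by rewrite divr_ge0 ?sqr_ge0// ltW.
    have y1 : 1 <= y by rewrite -sqrtr1 ler_wsqrtr// lerDl.
    have y2 : y ^+ 2 = 1 + t ^+ 2 / a by rewrite sqr_sqrtr// addr_ge0.
    have -> : Num.sqrt (a + t ^+ 2) = Num.sqrt a * y.
      rewrite -sqrtrM; last exact: ltW.
      by rewrite mulrDr mulr1 mulrCA divff ?mulr1// gt_eqF.
    rewrite exprMn ler_wpM2l ?exprn_ge0//.
    apply: (le_trans _ (bernoulli_half y1 j2)).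
    rewrite lerD2l b2 y2 (addrC 1) addrK le_eqVlt; apply/orP; left; apply/eqP; field.
    by rewrite gt_eqF.
have mg : measurable_fun setT (fun t : RB => ((1 + b ^+ 2 * t ^+ 2)^-1)%:E : \bar R).
  apply/measurable_EFinP.
  apply: measurableT_comp; first exact: measurable_inv.
  by apply: measurable_funD => //; apply: measurable_funM => //; exact: measurable_funX.
rewrite ge0_integralZl//; try (by rewrite lee_fin exprn_ge0// invr_ge0);
  try by move=> t _; rewrite lee_fin invr_ge0 addr_ge0// mulr_ge0// sqr_ge0.
rewrite integralT_scaled_oneDsqr// -EFinM lee_fin.
have -> : b^-1 = Num.sqrt (2 / j%:R) * Num.sqrt a.
  rewrite -sqrtrM; last by rewrite divr_ge0// ltW.
  by rewrite /b -sqrtrV ?divr_ge0 ?mulr_ge0// ?ltW// invf_div mulrAC.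
rewrite /cauchy_cst -[in X in X * _](prednK (ltnW j2)) exprS.
rewrite le_eqVlt; apply/orP; left; apply/eqP.
by field; rewrite gt_eqF.
Qed.

(** Every integration uses up one coordinate and one power, so the exponent l + k comes down to l,
    with the constants of index l + 1 to l + k. *)
Lemma iint_cauchy_le k l (a : R) : 0 < a -> (0 < l)%N ->
  (iint (fun z : 'cV[R]_k => (((Num.sqrt (a + sqnorm z))^-1) ^+ (l + k))%:E) <=
   ((\prod_(i < k) cauchy_cst (l + i).+1) * ((Num.sqrt a)^-1) ^+ l)%:E)%E.
Proof.
elim: k l a => [|k IH] l a a0 l0.
  by rewrite /= big_ord0 mul1r addn0 /sqnorm big_ord0 addr0.
rewrite /=.
have sqE t (v : 'cV[R]_k) : sqnorm (col_mx (const_mx t : 'cV[R]_1) v : 'cV[R]_k.+1) = t ^+ 2 + sqnorm v.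
  transitivity (\sum_(i < 1 + k) (col_mx (const_mx t : 'cV[R]_1) v) i ord0 ^+ 2) => //.
  rewrite big_split_ord /= big_ord1 col_mxEu mxE; congr (_ + _).
  by apply: eq_bigr => i _; rewrite col_mxEd.
apply: (@le_trans _ _ (\int[mu]_t ((\prod_(i < k) cauchy_cst (l.+1 + i).+1)%:E *
    (((Num.sqrt (a + t ^+ 2))^-1) ^+ l.+1)%:E))%E).
  apply: ge0_le_integral => //.
  - by move=> t _; apply: iint_ge0 => v; rewrite lee_fin exprn_ge0// invr_ge0.
  - apply: (@measurable_iint_slice R k (fun z => (((Num.sqrt (a + sqnorm z))^-1) ^+ (l + k.+1))%:E)).
      apply/measurable_EFinP; apply: measurable_cauchy; apply: measurable_funD => //.
      exact: (@measurable_sqnorm R k.+1 _ _ id).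
    by move=> z; rewrite lee_fin exprn_ge0// invr_ge0.
  - apply: measurable_funeM; apply/measurable_EFinP; apply: measurable_cauchy.
    by apply: measurable_funD => //; exact: measurable_funX.
  - move=> t _; rewrite -EFinM.
    have at0 : 0 < a + t ^+ 2 by rewrite ltr_wpDr// sqr_ge0.
    apply: (le_trans _ (IH l.+1 _ at0 isT)).
    rewrite le_eqVlt; apply/orP; left; apply/eqP; apply: eq_iint => v.
    by rewrite sqE addrA addnS addSn.
have mg : measurable_fun setT (fun t : RB => (((Num.sqrt (a + t ^+ 2))^-1) ^+ l.+1)%:E : \bar R).
  apply/measurable_EFinP; apply: measurable_cauchy.
  by apply: measurable_funD => //; exact: measurable_funX.
rewrite ge0_integralZl//; try (by rewrite lee_fin prodr_ge0// => i _; exact: cauchy_cst_ge0);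
  try by move=> t _; rewrite lee_fin exprn_ge0// invr_ge0.
apply: (@le_trans _ _ ((\prod_(i < k) cauchy_cst (l.+1 + i).+1)%:E *
   (cauchy_cst l.+1 * ((Num.sqrt a)^-1) ^+ l)%:E)%E).
  apply: lee_wpmul2l; first by rewrite lee_fin prodr_ge0// => i _; exact: cauchy_cst_ge0.
  exact: integral_cauchy_le.
rewrite -EFinM lee_fin big_ord_recl addn0 mulrA le_eqVlt; apply/orP; left; apply/eqP.
congr (_ * _); rewrite mulrC; congr (_ * _); apply: eq_bigr => i _.
by rewrite /= /bump leq0n addnA addn1.
Qed.

End cauchy_integrals.

Section cofactor_vector.
Variables (R : realType) (k : nat).
Local Notation RB := (measurableTypeR R).
Local Notation mu := (@lebesgue_measure R).
Implicit Type Y : 'M[R]_(1 + k, k).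

(** The generalized cross product of the columns of [Y]; the zero column is a placeholder, as
    cofactors along the first column ignore its content. *)
Definition cofv Y : 'cV[R]_(1 + k) := \col_r cofactor (row_mx 0 Y) r ord0.

Lemma det_row_mx (w : 'cV[R]_(1 + k)) Y : \det (row_mx w Y) = dot w (cofv Y).
Proof.
rewrite (expand_det_col _ ord0); apply: eq_bigr => i _; congr (_ * _).
  by rewrite -[RHS](row_mxEl w Y); congr (row_mx w Y _ _); exact/val_inj.
rewrite [RHS]mxE /cofactor; congr (_ * \det _); apply/matrixP => a b; rewrite !mxE.
have -> : lift ord0 b = rshift 1 b by exact/val_inj.
by case: splitP => // c /= cE; have := ltn_ord c; rewrite -cE.
Qed.

Lemma dot_col_cofv Y j : dot (col j Y) (cofv Y) = 0.
Proof.
rewrite -det_row_mx -det_tr.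
apply: (@determinant_alternate _ _ _ (lshift k ord0) (rshift 1 j)) => [|r].
  by rewrite eq_lrshift.
by rewrite !mxE -/(row_mx _ _) (unsplitK (inl _)) (unsplitK (inr _)) mxE.
Qed.

Lemma sqnorm_mul_orth Y (c : 'cV[R]_(1 + k)) (t : R) (z : 'cV[R]_k) :
  (forall j, dot (col j Y) c = 0) ->
  sqnorm (t *: c + Y *m z) = t ^+ 2 * sqnorm c + sqnorm (Y *m z).
Proof.
move=> H; rewrite sqnormD sqnormZ dotZl.
suff -> : dot c (Y *m z) = 0 by rewrite !mulr0 addr0.
have -> : Y *m z = \sum_j z j ord0 *: col j Y.
  apply/matrixP => a b; rewrite [b]ord1 mxE summxE; apply: eq_bigr => j _.
  by rewrite !mxE mulrC.
by rewrite dot_sumr big1// => j _; rewrite dotZr dotC H mulr0.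
Qed.

(** This is (2 pi)^(k/2) / |cofv Y|, and +oo for degenerate [Y]. In this form Tonelli gives access
    to the expectation of the inverse norm. *)
Definition gauss_int Y : \bar R :=
  iint (fun z : 'cV[R]_k => (expR (- (1 / 2) * sqnorm (Y *m z)))%:E).

Lemma sqrt2pi_gt0 : 0 < Num.sqrt (2 * pi) :> R.
Proof. by rewrite sqrtr_gt0 mulr_gt0// pi_gt0. Qed.

Lemma gdenE n (y : 'cV[R]_n) :
  gden y = ((Num.sqrt (2 * pi))^-1) ^+ n * expR (- (1 / 2) * sqnorm y).
Proof.
rewrite /gden; under eq_bigr do rewrite gpdfE.
rewrite big_split /= prodr_const card_ord; congr (_ * _).
rewrite -expR_sum /sqnorm mulr_sumr; congr expR; apply: eq_bigr => i _; lra.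
Qed.

Lemma measurable_exp_sq n d (Z : measurableType d) (f : Z -> 'cV[R]_n) t :
  measurable_fun setT f ->
  measurable_fun setT (fun z => (expR (t * sqnorm (f z)))%:E : \bar R).
Proof.
move=> mf; apply/measurable_EFinP; apply: measurableT_comp => //; apply: measurable_funM => //.
exact: measurable_sqnorm.
Qed.

Lemma iint_exp_sq n : iint (fun y : 'cV[R]_n => (expR (- (1 / 2) * sqnorm y))%:E) =
  ((Num.sqrt (2 * pi)) ^+ n)%:E.
Proof.
have s0 := sqrt2pi_gt0.
have := @iint_gden R n; under eq_iint do rewrite gdenE EFinM.
rewrite iintZl; first last.
- by rewrite lee_fin exprn_ge0// invr_ge0 ltW.
- by move=> x; rewrite lee_fin expR_ge0.
- exact: measurable_exp_sq.
move=> h; rewrite -[LHS]mul1e -[X in X%:E]( mulfV (lt0r_neq0 (exprn_gt0 n s0))).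
by rewrite EFinM -muleA -exprVn h mule1.
Qed.

Lemma measurable_mulY Y : measurable_fun setT (fun z : 'cV[R]_k => Y *m z).
Proof. exact: (@measurable_mulmx R _ _ _ _ Y id). Qed.

(** Completing [Y] by the unit vector along its cross product gives a matrix of determinant |cofv
    Y|. As this vector is orthogonal to the columns, the gaussian integral in dimension k + 1
    factors into a one-dimensional one and [gauss_int Y]. *)
Lemma gauss_int_cofv Y : cofv Y != 0 ->
  gauss_int Y = ((Num.sqrt (2 * pi)) ^+ k / Num.sqrt (sqnorm (cofv Y)))%:E.
Proof.
move=> c0; set c := cofv Y.
have cs0 : 0 < sqnorm c.
  by rewrite lt0r sqnorm_ge0 andbT; apply: contra c0 => /eqP h; apply/eqP; exact: sqnorm_eq0 h.
pose r := Num.sqrt (sqnorm c).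
have r0 : 0 < r by rewrite sqrtr_gt0.
have r2 : r ^+ 2 = sqnorm c by rewrite sqr_sqrtr// ltW.
pose u := r^-1 *: c.
have u1 : sqnorm u = 1 by rewrite sqnormZ -r2 exprVn mulVf// expf_neq0// gt_eqF.
have uY j : dot (col j Y) u = 0 by rewrite dotZr dot_col_cofv mulr0.
have detA : \det (row_mx u Y) = r.
  by rewrite det_row_mx dotZl -sqnorm_dot -r2 expr2 mulrA mulVf ?mul1r// gt_eqF.
have detA0 : \det (row_mx u Y) != 0 by rewrite detA gt_eqF.
have := @iint_linear R (1 + k) (row_mx u Y) (fun x => (expR (- (1 / 2) * sqnorm x))%:E) 0 detA0.
rewrite iint_exp_sq detA gtr0_norm// => H.
have {}H := H (measurable_exp_sq _ (@measurable_id _ _ setT)) (fun x => expR_ge0 _).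
have E : iint (fun x : 'cV[R]_(1 + k) => (expR (- (1 / 2) * sqnorm (row_mx u Y *m x + 0)))%:E) =
   ((Num.sqrt (2 * pi))%:E * gauss_int Y)%E.
  transitivity (\int[mu]_t ((expR (- (1/2) * t ^+ 2))%:E * gauss_int Y))%E.
    apply: eq_integral => t _; rewrite /gauss_int -iintZl; first last.
    - by rewrite lee_fin expR_ge0.
    - by move=> x; rewrite lee_fin expR_ge0.
    - exact: (measurable_exp_sq _ (measurable_mulY Y)).
    apply: eq_iint => z; rewrite -EFinM -expRD addr0; congr (EFin (expR _)).
    rewrite (mul_row_col u Y (const_mx t) z) -mulrDr; congr (_ * _).
    have -> : u *m const_mx t = t *: u.
      apply/matrixP => a b; rewrite mxE [RHS]mxE big_ord1 [const_mx _ _ _]mxE [b]ord1 mulrC.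
      by congr (_ * u _ _); exact/val_inj.
    by rewrite sqnorm_mul_orth// u1 mulr1.
  have mg : measurable_fun setT (fun t : RB => (expR (- (1 / 2) * t ^+ 2))%:E : \bar R).
    by apply/measurable_EFinP; apply: measurableT_comp => //; apply: measurable_funM.
  rewrite ge0_integralZr//; try (by apply: iint_ge0 => x; rewrite lee_fin expR_ge0);
    try by move=> t _; rewrite lee_fin expR_ge0.
  congr (_ * _)%E.
  have := iint_exp_sq 1; rewrite /= => h; rewrite -[RHS]h.
  apply: eq_integral => t _; congr (EFin (expR (_ * _))).
  rewrite /sqnorm big_ord1 (_ : ord0 = lshift 0 (ord0 : 'I_1)); last exact/val_inj.
  by rewrite (@col_mxEu _ 1 0) mxE.
rewrite E exprS EFinM muleA -EFinM in H.
have s0 := sqrt2pi_gt0.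
have : (((Num.sqrt (2 * pi))^-1)%:E * ((Num.sqrt (2 * pi))%:E * gauss_int Y) =
   ((Num.sqrt (2 * pi))^-1)%:E * ((r^-1 * Num.sqrt (2 * pi))%:E * (Num.sqrt (2 * pi) ^+ k)%:E))%E.
  by rewrite H.
rewrite muleA -EFinM mulVf ?gt_eqF// mul1e => ->.
rewrite -!EFinM; congr EFin; rewrite -/r; field.
by rewrite !gt_eqF.
Qed.

Lemma gauss_int_gt0 Y : (0 < gauss_int Y)%E.
Proof.
pose S := \sum_a \sum_b `|Y a b|.
have S0 : 0 <= S by apply: sumr_ge0 => a _; apply: sumr_ge0.
pose e := expR (- (1 / 2) * ((1 + k)%:R * S ^+ 2)).
apply: (@lt_le_trans _ _ (iint (fun x : 'cV[R]_k => (e%:E * (\prod_i \1_(`[0, 1]%classic) (x i ord0))%:E)%E))).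
  rewrite iintZl.
  - by rewrite iint_cube// subr0 expr1n mule1 lte_fin expR_gt0.
  - apply/measurable_EFinP; apply: measurable_prod => i _.
    apply: (measurableT_comp (f := fun t : RB => \1_(`[0, 1]%classic) t : RB)).
      by apply: measurable_indic; exact: measurable_itv.
    exact: measurable_coord.
  - by move=> x; rewrite lee_fin prodr_ge0.
  - by rewrite lee_fin expR_ge0.
apply: le_iint.
- apply: measurable_funeM; apply/measurable_EFinP; apply: measurable_prod => i _.
  apply: (measurableT_comp (f := fun t : RB => \1_(`[0, 1]%classic) t : RB)).
    by apply: measurable_indic; exact: measurable_itv.
  exact: measurable_coord.
- exact: (measurable_exp_sq _ (measurable_mulY Y)).
- by move=> x; rewrite -EFinM lee_fin mulr_ge0 ?expR_ge0// prodr_ge0.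
- move=> x; rewrite -EFinM lee_fin.
  have [h|h] := pselect (forall i, 0 <= x i ord0 <= 1); last first.
    have [i hi] : exists i, ~ (0 <= x i ord0 <= 1).
      by apply: contrapT => /forallNP h'; apply: h => i; exact: contrapT.
    by rewrite (bigD1 i)//= indicE memNset ?mul0r ?mulr0 ?expR_ge0//= in_itv.
  rewrite big1 ?mulr1 => [|i _]; last by rewrite indicE mem_set//= in_itv /= h.
  rewrite ler_expR ler_wnM2l; [by []|lra|].
  rewrite /sqnorm mulr_natl -[X in _ <= _ *+ X]card_ord -sumr_const; apply: ler_sum => a _.
  rewrite -[leLHS]ger0_norm ?sqr_ge0// normrX lerXn2r ?nnegrE//.
  rewrite mxE; apply: le_trans (ler_norm_sum _ _ _) _.
  apply: (@le_trans _ _ (\sum_b `|Y a b|)).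
    apply: ler_sum => b _; rewrite normrM ler_piMr//.
    by have /andP[x0 x1] := h b; rewrite ger0_norm.
  by rewrite /S (bigD1 a)//= lerDl; apply: sumr_ge0 => a' _; apply: sumr_ge0.
Qed.

(** A kernel vector yields a linear change of variables of determinant 2 that does not change the
    integrand. The integral equals half of itself and is positive, so it is infinite. *)
Lemma gauss_int_infty Y : cofv Y = 0 -> gauss_int Y = +oo%E.
Proof.
move=> c0.
have [v v0 Yv] : exists2 v : 'cV[R]_k, v != 0 & Y *m v = 0.
  have [fr|nfr] := boolP (row_free Y^T); last first.
    move: nfr; rewrite -kermx_eq0 => /rowV0Pn[v vY v0].
    exists v^T; first by apply: contra v0 => /eqP e; rewrite -[v]trmxK e trmx0.
    by apply: trmx_inj; rewrite trmx_mul trmxK trmx0; apply/sub_kermxP.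
  (* Independent columns could be completed to an invertible matrix by a vector outside their span,
     whereas vanishing cofactors make every such determinant zero. *)
  exfalso.
  have nf : ~~ row_full Y^T.
    rewrite /row_full; have := fr; rewrite /row_free => /eqP ->.
    by rewrite neq_ltn ltnSn.
  have [u uY] : exists u : 'rV[R]_(1 + k), ~~ (u <= Y^T)%MS.
    move: nf; rewrite -sub1mx => /row_subPn[i h]; by exists (row i 1%:M).
  have := det_row_mx u^T Y; rewrite c0 dot0r => /eqP; rewrite -det_tr tr_row_mx trmxK.
  apply/negP; rewrite -unitfE -unitmxE -row_free_unit.
  rewrite -kermx_eq0; apply/rowV0P => w /sub_kermxP wK.
  have := wK; rewrite -[w](@hsubmxK _ 1 1 k) mul_row_col => e.
  have a0 : lsubmx (w : 'rV[R]_(1 + k)) = 0.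
    apply/eqP; apply: contraNT uY => a0.
    have [a aE] : exists a, lsubmx (w : 'rV[R]_(1 + k)) = a%:M.
      by exists (lsubmx (w : 'rV[R]_(1 + k)) ord0 ord0); exact: mx11_scalar.
    have an0 : a != 0 by apply: contra a0 => /eqP a0; rewrite aE a0 raddf0.
    move: e; rewrite aE mul_scalar_mx => /eqP; rewrite addr_eq0 => /eqP e.
    have -> : u = a^-1 *: (a *: u) by rewrite scalerA mulVf// scale1r.
    by rewrite e scalemx_sub// eqmx_opp submxMl.
  move: e; rewrite a0 mul0mx add0r => e.
  have : rsubmx (w : 'rV[R]_(1 + k)) = 0.
    by apply/eqP; move: fr; rewrite -kermx_eq0 => /rowV0P h; apply/eqP; apply: h; apply/sub_kermxP.
  by move=> ->; rewrite row_mx0.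
have [j vj] : exists j, v j ord0 != 0.
  apply: contrapT => /forallNP h; move/negP: v0; apply; apply/eqP/matrixP => i l.
  by rewrite [l]ord1 [RHS]mxE; apply/eqP/negP => /negP; exact: h.
(* [B] sends z to z + (z_j / v_j) v: it moves only along the kernel of [Y], and doubles v. *)
pose B : 'M[R]_k := 1%:M + (v j ord0)^-1 *: (v *m delta_mx (ord0 : 'I_1) j).
have BE a b : B a b = (a == b)%:R + (v j ord0)^-1 * (v a ord0 * (b == j)%:R).
  by rewrite !mxE big_ord1 !mxE eqxx.
have detB : \det B = 2.
  rewrite (expand_det_row _ j) (bigD1 j)//= big1 ?addr0.
    rewrite /cofactor -signr_odd addnn odd_double expr0 mul1r.
    rewrite (_ : row' j (col' j B) = 1%:M).
      by rewrite det1 mulr1 BE !eqxx mulr1 mulVf.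
    apply/matrixP => a b; rewrite mxE [LHS]mxE BE mxE (inj_eq (@lift_inj _ j)).
    by rewrite [_ == j]eq_sym (negPf (neq_lift _ _)) !mulr0 addr0.
  by move=> c /negPf cj; rewrite BE cj eq_sym cj !mulr0 addr0 mul0r.
have detB0 : \det B != 0 by rewrite detB.
have YB z : Y *m (B *m z + 0) = Y *m z.
  rewrite addr0 /B mulmxDl mul1mx mulmxDr -scalemxAl -scalemxAr !mulmxA Yv !mul0mx.
  by rewrite scaler0 addr0.
have := @iint_linear R k B (fun z => (expR (- (1 / 2) * sqnorm (Y *m z)))%:E) 0 detB0
  (measurable_exp_sq _ (measurable_mulY Y)) (fun x => expR_ge0 _).
under eq_iint do rewrite YB.
rewrite -/(gauss_int Y) detB ger0_norm//.
have := gauss_int_gt0 Y; case: (gauss_int Y) => [r| |] //.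
rewrite lte_fin => r0; rewrite -EFinM => -[] h.
by exfalso; move: r0; rewrite lt_neqAle => /andP[/eqP]; lra.
Qed.

Lemma gauss_int_lt Y (L : R) : 0 < L -> (gauss_int Y < L%:E)%E ->
  0 < sqnorm (cofv Y) /\ (2 * pi) ^+ k < L ^+ 2 * sqnorm (cofv Y).
Proof.
move=> L0; have [c0|c0] := eqVneq (cofv Y) 0; first by rewrite gauss_int_infty.
rewrite gauss_int_cofv// lte_fin => h.
have cs0 : 0 < sqnorm (cofv Y).
  by rewrite lt0r sqnorm_ge0 andbT; apply: contra c0 => /eqP e; apply/eqP; exact: sqnorm_eq0 e.
split => //; have r0 : 0 < Num.sqrt (sqnorm (cofv Y)) by rewrite sqrtr_gt0.
move: h; rewrite ltr_pdivrMr// => h.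
have s0 := sqrt2pi_gt0.
have : (Num.sqrt (2 * pi) ^+ k) ^+ 2 < (L * Num.sqrt (sqnorm (cofv Y))) ^+ 2.
  by rewrite ltrXn2r// ?nnegrE ?exprn_ge0// ?mulr_ge0// ltW.
rewrite -exprM mulnC exprM sqr_sqrtr; last by rewrite mulr_ge0// pi_ge0.
by rewrite [(L * _) ^+ 2]exprMn sqr_sqrtr// ltW.
Qed.

End cofactor_vector.

Lemma measurable_det (R : realType) n d (Z : measurableType d) (f : Z -> 'M[R]_n) :
  (forall i j, measurable_fun setT (fun z => f z i j : measurableTypeR R)) ->
  measurable_fun setT (fun z => \det (f z) : measurableTypeR R).
Proof.
move=> mf; apply: measurable_sum => s; apply: measurable_funM => //.
by apply: measurable_prod => i _; exact: mf.
Qed.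

Lemma ler_sum_inj (R : realType) (I J : finType) (h : J -> I) (F : I -> R) :
  injective h -> (forall i, 0 <= F i) -> \sum_j F (h j) <= \sum_i F i.
Proof.
move=> hinj F0.
have -> : \sum_j F (h j) = \sum_(i in [set h j | j in [set: J]]%SET) F i.
  rewrite big_imset /=; first by apply: eq_bigl => j; rewrite inE.
  by move=> a b _ _; exact: hinj.
by rewrite [leRHS](bigID (mem [set h j | j in [set: J]]%SET)) /= lerDl sumr_ge0.
Qed.

Section determinant_event.
Variables (R : realType) (d : measure_display) (T : measurableType d).
Variables (P : probability T R) (m k : nat) (G : 'I_m -> T -> 'cV[R]_(1 + k)).
Hypothesis hG : std_gaussian_family P G.
Local Notation RB := (measurableTypeR R).
Local Notation mu := (@lebesgue_measure R).
Variables (io : 'I_m) (kap : R) (iot : 'I_(1 + k) -> 'I_m).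
Hypotheses (iot_inj : injective iot) (iot_io : forall c, iot c != io).
Implicit Type M : 'M[R]_(1 + k, m).

(** Edges of the simplex with apex [kap] times column [io]: 1 puts the apex at that gaussian point,
    0 at the origin. The first edge is kept apart in [wcol] because the determinant is expanded
    along it. *)
Definition ysub M : 'M[R]_(1 + k, k) :=
  \matrix_(r, c) (M r (iot (rshift 1 c)) - kap * M r io).
Definition wcol M : 'cV[R]_(1 + k) :=
  \col_r (M r (iot (lshift k ord0)) - kap * M r io).
Definition shift_det M : R := \det (row_mx (wcol M) (ysub M)).

Let mcoord r i : measurable_fun setT (fun M : 'M[R]_(1 + k, m) => M r i : RB).
Proof. exact: measurable_coord. Qed.

Lemma measurable_ysub r c : measurable_fun setT (fun M => ysub M r c : RB).
Proof.
under eq_fun do rewrite mxE.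
by apply: measurable_funB; [exact: mcoord|apply: measurable_funM => //; exact: mcoord].
Qed.

Lemma measurable_wcol r c : measurable_fun setT (fun M => wcol M r c : RB).
Proof.
under eq_fun do rewrite mxE.
by apply: measurable_funB; [exact: mcoord|apply: measurable_funM => //; exact: mcoord].
Qed.

Lemma measurable_cofv : measurable_fun setT (fun M => cofv (ysub M)).
Proof.
apply: measurable_mxP => r c; under eq_fun do rewrite mxE.
apply: measurable_funM => //; apply: measurable_det => i j.
under eq_fun do rewrite !mxE.
case: (fintype.split (lift ord0 j : 'I_(1 + k))) => a; last exact: measurable_ysub.
by under eq_fun do rewrite mxE; exact: measurable_cst.
Qed.

Lemma measurable_shift_det : measurable_fun setT (shift_det : _ -> RB).
Proof.
apply: measurable_det => i j; under eq_fun do rewrite mxE.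
by case: (fintype.split (j : 'I_(1 + k))) => a; [exact: measurable_wcol|exact: measurable_ysub].
Qed.

Definition zcoef (z : 'cV[R]_k) (i : 'I_m) : R :=
  \sum_c (iot (rshift 1 c) == i)%:R * z c ord0 - kap * (i == io)%:R * \sum_c z c ord0.

Lemma ysub_lin_comb M z : ysub M *m z = lin_comb (index_enum _) (zcoef z) M.
Proof.
apply/matrixP => r q; rewrite [q]ord1 mxE summxE.
under [RHS]eq_bigr do rewrite !mxE /zcoef mulrBl mulr_suml.
rewrite sumrB exchange_big /=.
have -> : \sum_(i < m) kap * (i == io)%:R * (\sum_c z c ord0) * M r i =
   kap * (\sum_c z c ord0) * M r io.
  rewrite (bigD1 io)//= eqxx mulr1 [X in _ + X]big1 ?addr0// => i /negPf ->.
  by rewrite mulr0 !mul0r.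
rewrite mulr_sumr mulr_suml -sumrB; apply: eq_bigr => c _.
rewrite (bigD1 (iot (rshift 1 c)))//= eqxx mul1r big1 ?addr0; last first.
  by move=> i /negPf; rewrite eq_sym => ->; rewrite !mul0r.
by rewrite [ysub _ _ _]mxE; ring.
Qed.

(** The base vertices are distinct and differ from the apex, so they alone contribute |z|^2; the
    shared apex column only adds to the variance. *)
Lemma sum_zcoef_ge z : sqnorm z <= \sum_(i <- index_enum 'I_m) zcoef z i ^+ 2.
Proof.
have e c : zcoef z (iot (rshift 1 c)) = z c ord0.
  rewrite /zcoef (negPf (iot_io _)) mulr0 mul0r subr0.
  rewrite (bigD1 c)//= eqxx mul1r big1 ?addr0// => b bc.
  by rewrite (inj_eq iot_inj) (inj_eq (@rshift_inj _ _)) (negPf bc) mul0r.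
rewrite /sqnorm; under eq_bigr do rewrite -e.
apply: (@ler_sum_inj _ _ _ (fun c => iot (rshift 1 c)) (fun i => zcoef z i ^+ 2)) => [|i].
  by move=> a b /iot_inj /rshift_inj.
exact: sqr_ge0.
Qed.

Let mz : measurable_fun setT (fun p : T * 'cV[R]_k =>
  (expR (- (1 / 2) * sqnorm (ysub (gmx G p.1) *m p.2)))%:E : \bar R).
Proof.
apply: measurable_exp_sq; apply: measurable_mxP => r q; under eq_fun do rewrite mxE.
apply: measurable_sum => c; apply: measurable_funM.
  apply: (measurableT_comp (@measurable_ysub r c)).
  by apply: measurableT_comp => //; exact: (measurable_gmx hG).
apply: (measurableT_comp (f := fun v : 'cV[R]_k => v c q : RB)) => //.
exact: measurable_coord.
Qed.

(** For fixed z the vector [ysub M *m z] is gaussian with variance at least |z|^2 per coordinate, so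
    its transform is at most (1 + |z|^2)^(-n/2). With n = 1 + k, [iint_cauchy_le] applies for l =
    1. *)
Lemma expected_gauss_int :
  (\int[P]_w gauss_int (ysub (gmx G w)) <= (\prod_(i < k) cauchy_cst R (1 + i).+1)%:E)%E.
Proof.
rewrite /gauss_int (@iint_tonelli R k _ T P (fun p => (expR (- (1 / 2) * sqnorm (ysub (gmx G p.1) *m p.2)))%:E))//.
have := @iint_cauchy_le R k 1 1 ltr01 isT.
rewrite sqrtr1 invr1 expr1n mulr1; apply: le_trans.
apply: le_iint.
- have := @measurable_fun_fubini_tonelli_G _ _ T 'cV[R]_k R P _ mz; apply.
  by move=> p; rewrite lee_fin expR_ge0.
- apply/measurable_EFinP; apply: measurable_cauchy; apply: measurable_funD => //.
  exact: (@measurable_sqnorm R k _ _ id).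
- by move=> z; apply: integral_ge0 => w _; rewrite lee_fin expR_ge0.
- move=> z.
  have sg0 := sum_zcoef_ge z; have z0 := sqnorm_ge0 z.
  have h : 2 * (- (1 / 2)) * \sum_(i <- index_enum 'I_m) zcoef z i ^+ 2 < 1 by lra.
  have := @exp_moment R d T P m (1 + k) G hG (index_enum _) (zcoef z) (- (1/2)) 0 (index_enum_uniq _) h.
  rewrite (_ : sqnorm 0 = 0); last by rewrite sqnorm_dot dot0r.
  rewrite mulr0 mul0r expR0 mulr1 => E.
  have -> : (\int[P]_w (expR (- (1 / 2) * sqnorm (ysub (gmx G w) *m z)))%:E)%E =
    (\int[P]_w (expR (- (1 / 2) * sqnorm (0 + lin_comb (index_enum 'I_m) (zcoef z) (gmx G w))))%:E)%E.
    by apply: eq_integral => w _; rewrite add0r ysub_lin_comb.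
  rewrite E lee_fin lerXn2r ?nnegrE ?invr_ge0//.
  set S := \sum_(i <- _) _ in sg0 h E *.
  have S1 : 1 - 2 * - (1 / 2) * S = 1 + S by lra.
  rewrite S1 lef_pV2 ?posrE ?sqrtr_gt0; try lra.
  by apply: ler_wsqrtr; lra.
Qed.

Lemma measurable_gauss_int : measurable_fun setT (fun w => gauss_int (ysub (gmx G w))).
Proof. by apply: (measurable_iint mz) => p; rewrite lee_fin expR_ge0. Qed.

Lemma ysub_upd M j t : ysub (upd M j (iot (lshift k ord0)) t) = ysub M.
Proof.
apply/matrixP => r c; rewrite [LHS]mxE [RHS]mxE [upd _ _ _ _ _ _]mxE [upd _ _ _ _ _ _]mxE.
rewrite (inj_eq iot_inj) eq_rlshift andbF eq_sym.
by rewrite [io == _]eq_sym (negPf (iot_io _)) andbF.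
Qed.

Lemma shift_det_upd M j t : shift_det (upd M j (iot (lshift k ord0)) t) =
  cofv (ysub M) j ord0 * t + (shift_det M - cofv (ysub M) j ord0 * M j (iot (lshift k ord0))).
Proof.
rewrite /shift_det !det_row_mx ysub_upd /dot (bigD1 j)//= [X in _ + (X - _)](bigD1 j)//=.
rewrite [wcol _ j _]mxE [upd _ _ _ _ _ _]mxE [upd _ _ _ _ _ _]mxE !eqxx /=.
rewrite [io == _]eq_sym (negPf (iot_io _)) [wcol M j _]mxE.
have -> : \sum_(i < 1 + k | i != j) wcol (upd M j (iot (lshift k ord0)) t) i ord0 * cofv (ysub M) i ord0 =
   \sum_(i < 1 + k | i != j) wcol M i ord0 * cofv (ysub M) i ord0.
  apply: eq_bigr => i /negPf ij; congr (_ * _).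
  by rewrite [LHS]mxE [RHS]mxE [upd _ _ _ _ _ _]mxE [upd _ _ _ _ _ _]mxE ij.
by ring.
Qed.

Lemma gpdf_le1 (t : R) : gpdf t <= 1.
Proof.
rewrite gpdfE -[leRHS]mulr1 ler_pM ?invr_ge0 ?expR_ge0//.
  rewrite invf_le1 ?sqrt2pi_gt0// -[leLHS]sqrtr1 ler_wsqrtr//.
  by have := @pi_ge2 R; lra.
by rewrite -expR0 ler_expR mulNr oppr_le0 mulr_ge0 ?sqr_ge0.
Qed.

Lemma small_ball_1d (c r e : R) : c != 0 -> 0 <= e ->
  (\int[mu]_t (\1_[set t | (c * t + r) ^+ 2 < (e * c) ^+ 2] t * gpdf t)%:E <= (2 * e)%:E)%E.
Proof.
move=> c0 e0.
have mS : measurable [set t : RB | (c * t + r) ^+ 2 < (e * c) ^+ 2].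
  apply: measurable_lt_fun => //; apply: measurable_funX; exact: measurable_affine.
apply: (@le_trans _ _ (\int[mu]_t (\1_(`[- r / c - e, - r / c + e]%classic) t)%:E)%E).
  apply: ge0_le_integral => //.
  - by move=> t _; rewrite lee_fin mulr_ge0// gpdf_ge0.
  - apply/measurable_EFinP; apply: measurable_funM; last exact: measurable_gpdf.
    exact: measurable_indic.
  - by apply/measurable_EFinP; apply: measurable_indic; exact: measurable_itv.
  - move=> t _; rewrite lee_fin; have [h|h] := pselect ((c * t + r) ^+ 2 < (e * c) ^+ 2); last first.
      by rewrite indic_notin// mul0r.
    rewrite indic_in// mul1r indic_in ?gpdf_le1//= in_itv /=.
    have hn : `|c * t + r| <= e * `|c|.
      rewrite -[e]ger0_norm// -normrM -(@ler_pXn2r _ 2) ?nnegrE// -!normrX.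
      by rewrite !ger0_norm ?sqr_ge0// ltW.
    have ht : `|t + r / c| <= e.
      have -> : t + r / c = (c * t + r) / c by field.
      by rewrite normrM normfV ler_pdivrMr ?normr_gt0.
    by move: ht; rewrite ler_norml mulNr => /andP[h1 h2]; apply/andP; split; lra.
rewrite integral_indic//= setIT lebesgue_measure_itv /= lte_fin.
by case: ltP => h; rewrite ?lee_fin -?EFinD ?lee_fin; lra.
Qed.

Definition small_det (del : R) : set T :=
  [set w | 0 < sqnorm (cofv (ysub (gmx G w))) /\
       shift_det (gmx G w) ^+ 2 < del ^+ 2 * sqnorm (cofv (ysub (gmx G w)))].

(** Some coordinate j of the cofactor vector carries at least 1/n of its squared norm. The
    determinant is affine in entry j of the first column with that cofactor as slope, so resampling
    this entry reduces to [small_ball_1d]; the union over j gives the second factor n. *)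
Lemma shift_det_small_ball (del : R) : 0 < del ->
  measurable (small_det del) /\ (P (small_det del) <= (2 * (1 + k)%:R ^+ 2 * del)%:E)%E.
Proof.
move=> del0.
pose c M := cofv (ysub M); pose n : R := (1 + k)%:R.
have n1 : 1 <= n by rewrite ler1n.
have msq : measurable_fun setT (fun M => sqnorm (c M) : RB).
  by apply: measurable_sqnorm; exact: measurable_cofv.
pose A j : set 'M[R]_(1 + k, m) := [set M | 0 < sqnorm (c M)] `&`
  ([set M | sqnorm (c M) <= n * c M j ord0 ^+ 2] `&`
   [set M | shift_det M ^+ 2 < del ^+ 2 * sqnorm (c M)]).
pose A0 : set 'M[R]_(1 + k, m) := [set M | 0 < sqnorm (c M)] `&`
   [set M | shift_det M ^+ 2 < del ^+ 2 * sqnorm (c M)].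
have m1 : measurable [set M | 0 < sqnorm (c M)] by exact: measurable_lt_fun.
have m3 : measurable [set M | shift_det M ^+ 2 < del ^+ 2 * sqnorm (c M)].
  apply: measurable_lt_fun; last exact: measurable_funM.
  by apply: measurable_funX; exact: measurable_shift_det.
have mA j : measurable (A j).
  apply: measurableI => //; apply: measurableI => //; apply: measurable_le_fun => //.
  apply: measurable_funM => //; apply: measurable_funX.
  by apply: (measurableT_comp (f := fun v : 'cV[R]_(1 + k) => v j ord0 : RB)); [exact: measurable_coord|exact: measurable_cofv].
have mA0 : measurable A0 by exact: measurableI.
have pre (B : set 'M[R]_(1 + k, m)) : measurable B -> measurable (gmx G @^-1` B).
  by move=> mB; have := measurable_gmx hG measurableT mB; rewrite setTI.
split; first exact: (pre _ mA0).
have PA j : (P (gmx G @^-1` A j) <= (2 * (n * del))%:E)%E.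
  have -> : P (gmx G @^-1` A j) = (\int[P]_w (\1_(A j) (gmx G w))%:E)%E.
    transitivity (\int[P]_w (\1_(gmx G @^-1` A j) w)%:E)%E; last by apply: eq_integral.
    by rewrite integral_indic//= ?setIT//; exact: (pre _ (mA j)).
  rewrite (replace_entry hG j (iot (lshift k ord0)) (F := fun M => (\1_(A j) M)%:E)); first last.
  - by move=> M; rewrite lee_fin.
  - by apply/measurable_EFinP; exact: measurable_indic.
  have -> : (2 * (n * del))%:E = (\int[P]_w (2 * (n * del))%:E)%E.
    by rewrite integral_cst//= probability_setT mule1.
  apply: ge0_le_integral => //.
  - by move=> w _; apply: integral_ge0 => t _; rewrite -EFinM lee_fin mulr_ge0// gpdf_ge0.
  - apply: (@measurable_fun_fubini_tonelli_F _ _ T RB R mu (fun p => ((\1_(A j) (upd (gmx G p.1) j (iot (lshift k ord0)) p.2))%:E * (gpdf p.2)%:E)%E)).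
      apply: emeasurable_funM; last first.
        by apply/measurable_EFinP; apply: (measurableT_comp (@measurable_gpdf R)).
      apply/measurable_EFinP; apply: (measurableT_comp (f := fun M => \1_(A j) M : RB)).
        exact: measurable_indic.
      by apply: measurable_upd => //; apply: measurableT_comp => //; exact: (measurable_gmx hG).
    by move=> p; rewrite -EFinM lee_fin mulr_ge0// gpdf_ge0.
  - move=> w _; set M := gmx G w.
    have [c0|c0] := eqVneq (c M j ord0) 0.
      rewrite (eq_integral (fun=> 0%E)) => [|t _].
        by rewrite integral0 lee_fin !mulr_ge0// ?(ltW del0)// (le_trans ler01).
      rewrite indic_notin ?mul0e// => -[/= h1 [h2 _]].
      by move: h1 h2; rewrite /c ysub_upd -/(c M) c0 expr0n mulr0 => h1 /(lt_le_trans h1); rewrite ltxx.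
    pose r := shift_det M - c M j ord0 * M j (iot (lshift k ord0)).
    have nd0 : 0 <= n * del by rewrite mulr_ge0 ?(ltW del0)// (le_trans ler01).
    have := @small_ball_1d (c M j ord0) r (n * del) c0 nd0; apply: le_trans.
    apply: ge0_le_integral => //.
    + by move=> t _; rewrite -EFinM lee_fin mulr_ge0// gpdf_ge0.
    + apply: emeasurable_funM; last by apply/measurable_EFinP; exact: measurable_gpdf.
      apply/measurable_EFinP; apply: (measurableT_comp (f := fun M => \1_(A j) M : RB)).
        exact: measurable_indic.
      by apply: measurable_upd => //; exact: measurable_cst.
    + apply/measurable_EFinP; apply: measurable_funM; last exact: measurable_gpdf.
      apply: measurable_indic; apply: measurable_lt_fun => //; apply: measurable_funX.
      exact: measurable_affine.
    + move=> t _; rewrite -EFinM lee_fin ler_wpM2r ?gpdf_ge0//.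
      have [h|h] := pselect (A j (upd M j (iot (lshift k ord0)) t)); last by rewrite indic_notin.
      rewrite indic_in// indic_in//.
      case: h => /= h1 [h2 h3]; move: h1 h2 h3; rewrite shift_det_upd /c ysub_upd -/(c M) -/r.
      move=> h1 h2 h3; apply: (lt_le_trans h3).
      rewrite !exprMn mulrAC mulrC ler_wpM2r ?sqr_ge0//.
      apply: (le_trans h2); rewrite ler_wpM2r ?sqr_ge0//.
      (* The radius n del is used in place of sqrt(n) del, which loses only a polynomial factor and
         avoids a square root. *)
      by rewrite expr2 ler_peMl// (le_trans ler01).
have := @prob_union_bound R d T P 'I_(1 + k) [set: 'I_(1 + k)]%SET (fun j => gmx G @^-1` A j)
  (gmx G @^-1` A0) (2 * (n * del)) (pre _ mA0) (fun j => pre _ (mA j)).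
rewrite cardsT card_ord -/n => H; apply: (le_trans (H _ _)).
- move=> w [h1 h2]; set M := gmx G w.
  have [j hj] : exists j, sqnorm (c M) <= n * c M j ord0 ^+ 2.
    apply: contrapT => /forallNP h.
    have : \sum_(j < 1 + k) n * c M j ord0 ^+ 2 < \sum_(j < 1 + k) sqnorm (c M).
      apply: ltr_sum => [|j _]; first by apply/hasP; exists ord0; rewrite ?mem_index_enum.
      by rewrite ltNge; apply/negP; exact: h.
    by rewrite -mulr_sumr sumr_const card_ord -mulr_natl ltxx.
  by exists j; rewrite ?inE//; split => //; split.
- by move=> j _; exact: PA.
by rewrite lee_fin expr2; nra.
Qed.

End determinant_event.

(** n^n / n! is one term of the exponential series at n. *)
Lemma expR_fact_ge (R : realType) n : n%:R ^+ n <= expR n%:R * n`!%:R :> R.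
Proof.
case: n => [|n]; first by rewrite expr0 expR0 mul1r.
have := @expR_ge1Dxn R n.+1%:R n (ler0n _ _).
rewrite -ler_pdivrMr ?ltr0n ?fact_gt0// => h; apply: le_trans h.
by rewrite lerDr.
Qed.

Lemma pi_le_expR2 (R : realType) : pi <= expR 2 :> R.
Proof.
have h1 := @pihalf_lt2 R; have h2 := @expR_ge1Dx R 1.
have -> : expR (2 : R) = expR 1 ^+ 2 by rewrite -expRM_natr mul1r.
by nra.
Qed.

Section determinant_bound.
Variables (R : realType) (d : measure_display) (T : measurableType d).
Variables (P : probability T R) (m k : nat) (G : 'I_m -> T -> 'cV[R]_(1 + k)).
Hypothesis hG : std_gaussian_family P G.
Variables (io : 'I_m) (kap : R) (iot : 'I_(1 + k) -> 'I_m).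
Hypotheses (iot_inj : injective iot) (iot_io : forall c, iot c != io).
Local Notation n := (1 + k)%N.

Lemma prod_cauchy_sqr : (\prod_(i < k) cauchy_cst R (1 + i).+1) ^+ 2 * n`!%:R = (2 * pi ^+ 2) ^+ k.
Proof.
elim: k => [|j IH]; first by rewrite big_ord0 !expr0 expr1n mul1r.
rewrite big_ord_recr /= exprMn [RHS]exprS -IH !add1n [j.+2`!]factS natrM.
rewrite /cauchy_cst exprMn sqr_sqrtr ?divr_ge0//.
have j2 : j.+2%:R != 0 :> R by rewrite pnatr_eq0.
by field.
Qed.

(** Origin of the 7: Markov's threshold for the gaussian integral costs e^(2n) after squaring, pi^k
    <= e^(2n), n^n <= e^n n!, and the small ball of radius e^(-n) costs e^(2n) after squaring. *)
Definition det_good : set T :=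
  [set w | expR (- 7 * n%:R) * n%:R ^+ n <= shift_det io kap iot (gmx G w) ^+ 2].

Lemma det_goodP : measurable det_good /\
  (P (~` det_good) <= (3 * n%:R ^+ 2 * expR (- n%:R))%:E)%E.
Proof.
pose b : R := \prod_(i < k) cauchy_cst R (1 + i).+1.
pose L := expR n%:R * b.
have b0 : 0 < b by apply: prodr_gt0 => i _; rewrite mulr_gt0 ?pi_gt0// sqrtr_gt0 divr_gt0.
have L0 : 0 < L by rewrite mulr_gt0 ?expR_gt0.
pose J w := gauss_int (ysub io kap iot (gmx G w)).
have mJ : measurable_fun setT J by exact: (measurable_gauss_int hG).
pose BJ : set T := [set w | (L%:E <= J w)%E].
have mB : measurable BJ.
  rewrite -[X in measurable X]setTI; exact: emeasurable_fun_c_infty.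
have [mS PS] := shift_det_small_ball hG kap iot_inj iot_io (expR_gt0 (- n%:R : R)).
have mD : measurable det_good.
  apply: measurable_le_fun; first exact: measurable_cst.
  apply: measurable_funX.
  by apply: (measurableT_comp (@measurable_shift_det R m k io kap iot)); exact: (measurable_gmx hG).
split=> //.
have sub : ~` det_good `<=` BJ `|` small_det G io kap iot (expR (- n%:R)).
  move=> w nD; have [h|h] := leP L%:E (J w); [by left|right].
  have [c0 hc] := gauss_int_lt L0 h.
  split=> //; rewrite ltNge; apply/negP => hs; apply: nD; rewrite /det_good /=.
  apply: le_trans hs.
  set q := sqnorm _ in c0 hc *.
  have pib : (2 * pi) ^+ k * n`!%:R < expR n%:R ^+ 2 * (2 * pi ^+ 2) ^+ k * q.
    rewrite -prod_cauchy_sqr -/b.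
    have -> : expR n%:R ^+ 2 * (b ^+ 2 * n`!%:R) * q = L ^+ 2 * q * n`!%:R by rewrite /L; ring.
    by rewrite ltr_pM2r ?ltr0n ?fact_gt0.
  have pik : 0 < (2 * pi) ^+ k :> R by rewrite exprn_gt0// mulr_gt0// pi_gt0.
  have h2 : n`!%:R < expR n%:R ^+ 2 * pi ^+ k * q.
    rewrite -(ltr_pM2l pik); apply: (lt_le_trans pib); rewrite le_eqVlt; apply/orP; left; apply/eqP.
    by rewrite !exprMn; ring.
  have h3 : pi ^+ k <= expR n%:R ^+ 2 :> R.
    rewrite -expRM_natr mulrC expRM_natr; apply: (@le_trans _ _ (expR 2 ^+ k)).
      by rewrite lerXn2r ?nnegrE ?pi_ge0 ?expR_ge0// pi_le_expR2.
    by apply: ler_weXn2l; rewrite ?leq_addl// -[leLHS]expR0 ler_expR.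
  have e0 : 0 < expR n%:R :> R by exact: expR_gt0.
  have h4 : n`!%:R <= expR n%:R ^+ 4 * q.
    apply: (le_trans (ltW h2)); rewrite ler_wpM2r ?(ltW c0)// -[4%N]/(2 + 2)%N exprD.
    by rewrite ler_wpM2l ?exprn_ge0 ?expR_ge0.
  have h5 : n%:R ^+ n <= expR n%:R ^+ 5 * q.
    apply: (le_trans (expR_fact_ge _ _)); rewrite exprS -mulrA ler_wpM2l ?expR_ge0//.
  have -> : expR (- 7 * n%:R) = (expR n%:R ^+ 7)^-1 :> R by rewrite -expRM_natl mulNr expRN.
  rewrite expRN mulrC ler_pdivrMr ?exprn_gt0//.
  apply: (le_trans h5); rewrite le_eqVlt; apply/orP; left; apply/eqP.
  by field; rewrite gt_eqF.
apply: (le_trans (le_measure _ _ _ sub)); rewrite ?inE//.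
- exact: measurableC.
- exact: measurableU.
apply: (le_trans (measureU2 _ _ _)) => //.
have HJ : (P BJ <= (expR (- n%:R))%:E)%E.
  apply: (le_trans (markov_ge0 P mJ _ L0 mB)).
    by move=> w; apply: iint_ge0 => z; rewrite lee_fin expR_ge0.
  apply: (@le_trans _ _ ((L^-1)%:E * b%:E)%E).
    by rewrite lee_pmul2l ?lte_fin ?invr_gt0//; exact: (expected_gauss_int hG kap iot_inj iot_io).
  by rewrite -EFinM lee_fin /L invfM expRN -mulrA mulVf ?mulr1// gt_eqF.
have n1 : 1 <= n%:R ^+ 2 :> R by rewrite exprn_ege1// ler1n.
apply: (le_trans (leeD HJ PS)); rewrite -EFinD lee_fin.
have := expR_gt0 (- n%:R : R); set e := expR _; move=> e0; nra.
Qed.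
End determinant_bound.

(** * Simplices inside the hull *)

Section simplex_in_hull.
Variables (R : realType) (n : nat) (I : finType) (p : I -> 'cV[R]_n).

Lemma hull_sum (J : finType) (P : J -> 'cV[R]_n) (b : J -> R) :
  (forall k, 0 <= b k) -> \sum_k b k = 1 -> (forall k, convex_hull p (P k)) ->
  convex_hull p (\sum_k b k *: P k).
Proof.
move=> b0 b1 hP; have [l hl] := choice hP.
exists (fun i => \sum_k b k * l k i); split; last split.
- by move=> i; apply: sumr_ge0 => k _; rewrite mulr_ge0//; case: (hl k) => h _; exact: h.
- rewrite exchange_big /= -b1; apply: eq_bigr => k _.
  by rewrite -mulr_sumr; case: (hl k) => _ [-> _]; rewrite mulr1.
- under [RHS]eq_bigr do rewrite scaler_suml.
  rewrite exchange_big /=; apply: eq_bigr => k _.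
  case: (hl k) => _ [_ {1}->]; rewrite scaler_sumr.
  by apply: eq_bigr => i _; rewrite scalerA.
Qed.

Lemma hull_sub (J : finType) (P : J -> 'cV[R]_n) :
  (forall k, convex_hull p (P k)) -> convex_hull P `<=` convex_hull p.
Proof. by move=> hP x [l [l0 [l1 ->]]]; exact: hull_sum. Qed.

Variable P : 'I_(1 + n) -> 'cV[R]_n.
Hypotheses (hP : forall k, convex_hull p (P k)) (dP : \det (lift_mx P) != 0).

Lemma simplex_sub_hull : simplex P `<=` convex_hull p.
Proof.
move=> x Sx; have [b1 ->] := lift_mx_bary x dP.
by apply: hull_sum => // k; exact: Sx.
Qed.

(** All barycentric coordinates of the centroid are positive, and they stay so nearby by
    continuity. *)
Lemma hull_interior : (convex_hull p)° !=set0.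
Proof.
pose l : 'cV[R]_(1 + n) := const_mx (n.+1%:R^-1).
pose x0 := \sum_i l i ord0 *: P i; exists x0.
have l1 : \sum_i l i ord0 = 1.
  under eq_bigr do rewrite mxE.
  by rewrite sumr_const card_ord -[_ *+ _]mulr_natl mulfV// pnatr_eq0.
have bx0 : bary P x0 = l by exact: bary_unique.
have H : \forall x \near x0, forall k, 0 <= bary P x k ord0.
  apply: (@filter_forall _ _ (fun k x => 0 <= bary P x k ord0) (nbhs x0) (nbhs_filter x0)) => k.
  have cb : continuous (fun x => bary P x k ord0 : R).
    have -> : (fun x => bary P x k ord0 : R) = (fun x => \sum_j invmx (lift_mx P) k j * homog x j ord0).
      by apply/funext => x; rewrite mxE.
    move=> x.
    apply: (@continuous_big _ _ _ _ _ _ _ _ (fun j (x : 'cV[R]_n) => invmx (lift_mx P) k j * homog x j ord0)).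
      exact: add_continuous.
    move=> j _ y.
    apply: (@continuous_comp _ _ _ (fun x : 'cV[R]_n => homog x j ord0) (fun t => invmx (lift_mx P) k j * t)); last exact: mulrl_continuous.
    rewrite /homog; case: (split_ordP j) => a ->.
      have -> : (fun x : 'cV[R]_n => col_mx (const_mx 1 : 'cV[R]_1) x (lshift n a) ord0) = fun=> 1.
        by apply/funext => z; rewrite col_mxEu mxE.
      exact: cst_continuous.
    have -> : (fun x : 'cV[R]_n => col_mx (const_mx 1 : 'cV[R]_1) x (rshift 1 a) ord0) = fun x => x a ord0.
      by apply/funext => z; rewrite col_mxEd.
    exact: coord_continuous.
  have : open ((fun x => bary P x k ord0 : R) @^-1` [set t | 0 < t]).
    by apply: open_comp; [move=> x _; exact: cb|exact: open_gt].
  rewrite openE => /(_ x0); rewrite /= bx0 mxE invr_gt0 ltr0Sn => /(_ isT) h.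
  by near=> x; apply: ltW; near: x; exact: h.
by near=> x; apply: simplex_sub_hull; near: x; exact: H.
Unshelve. all: by end_near. Qed.

Lemma vol_hull_ge : (0 < n)%N ->
  ((`|\det (lift_mx P)| * n%:R^-1 ^+ n)%:E <= vol (convex_hull p))%E.
Proof.
move=> n0; apply: (@le_trans _ _ (vol (simplex P))); last first.
  by apply: le_vol; [exact: measurable_simplex|exact: measurable_hull|exact: simplex_sub_hull].
rewrite vol_simplex// lee_fin ler_wpM2l//.
by rewrite -lee_fin fineK ?Wsimp_fin ?Wsimp_ge.
Qed.

End simplex_in_hull.

Lemma det_lift_mx (R : realType) n (P : 'I_(1 + n) -> 'cV[R]_n) :
  \det (lift_mx P) = \det (\matrix_(r, c) (P (rshift 1 c) r ord0 - P (lshift n ord0) r ord0)).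
Proof.
set Y := \matrix_(r, c) _.
have e : lift_mx P *m block_mx 1%:M (const_mx (-1)) 0 1%:M = block_mx 1%:M 0 (P (lshift n ord0)) Y.
  have -> : lift_mx P = block_mx 1%:M (const_mx 1) (P (lshift n ord0)) (\matrix_(r, c) P (rshift 1 c) r ord0).
    apply/matrixP => i j; rewrite mxE /homog.
    case: (split_ordP i) => a ->; case: (split_ordP j) => b ->.
    - by rewrite col_mxEu block_mxEul !mxE [a]ord1 [b]ord1 eqxx.
    - by rewrite col_mxEu block_mxEur !mxE.
    - by rewrite col_mxEd block_mxEdl [b]ord1.
    - by rewrite col_mxEd block_mxEdr mxE.
  rewrite mulmx_block !mulmx0 !mulmx1 !mul1mx !addr0; congr block_mx.
    by apply/matrixP => i j; rewrite !mxE addNr.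
  apply/matrixP => i j; rewrite [LHS]mxE [(_ *m _) i j]mxE big_ord1 !mxE.
  by rewrite mulrN1 addrC.
have := congr1 determinant e; rewrite det_mulmx det_ublock det_lblock !det1 !mul1r mulr1.
by [].
Qed.

Lemma shift_detE (R : realType) m k (io : 'I_m) (kap : R) (iot : 'I_(1 + k) -> 'I_m) (M : 'M[R]_(1 + k, m)) :
  shift_det io kap iot M = \det (\matrix_(r, c) (M r (iot c) - kap * M r io)).
Proof.
congr determinant; apply/matrixP => i j; rewrite [RHS]mxE.
by case: (split_ordP j) => a ->; rewrite ?row_mxEl ?row_mxEr mxE// [a]ord1.
Qed.

(** * Separation probabilities and the volume of the hull *)

(** Reading one vector as a family of one-dimensional ones lets [exp_moment] compute expectations of
    functions of its inner product with a fixed x. *)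
Lemma gaussian_row (R : realType) (d : measure_display) (T : measurableType d)
    (P : probability T R) m n (G : 'I_m -> T -> 'cV[R]_n) (i : 'I_m) :
  std_gaussian_family P G ->
  std_gaussian_family P (fun (j : 'I_n) w => const_mx (G i w j ord0) : 'cV[R]_1).
Proof.
move=> [h1 [h2 h3]]; split; last split.
- by move=> j r; under eq_fun do rewrite mxE; exact: h1.
- by move=> j r B mB; under eq_fun do rewrite mxE; exact: h2.
- move=> B mB.
  pose B' i' j : set R := if i' == i then B j ord0 else setT.
  have mB' i' j : measurable (B' i' j) by rewrite /B'; case: ifP.
  have -> : [set w | forall (j : 'I_n) (r : 'I_1), B j r ((const_mx (G i w j ord0) : 'cV[R]_1) r ord0)] =
      [set w | forall i' j, B' i' j (G i' w j ord0)].
    apply/seteqP; split => w /= H.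
      by move=> i' j; rewrite /B'; case: eqP => // ->; have := H j ord0; rewrite mxE.
    by move=> j r; rewrite mxE [r]ord1; have := H i j; rewrite /B' eqxx.
  rewrite (h3 _ mB') (bigD1 i)//= [X in (_ * X)%E]big1 ?mule1; last first.
    move=> i' /negPf ii; apply: big1 => j _; rewrite /B' ii preimage_setT.
    exact: probability_setT.
  apply: eq_bigr => j _; rewrite big_ord1 /B' eqxx; congr (P _).
  by apply/seteqP; split => w /=; rewrite mxE.
Qed.

Section symmetrization.
Variables (R : realType) (d : measure_display) (T : measurableType d).
Variables (P : probability T R) (m n : nat) (G : 'I_m -> T -> 'cV[R]_n).
Hypothesis hG : std_gaussian_family P G.
Local Notation RB := (measurableTypeR R).
Variable x : 'cV[R]_n.

(* With this weight, the density at x + z becomes a multiple of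
   exp (- (|z|^2 + <x,z>^2) / 2), which is even in z. *)
Definition symw y : R := expR (- (1 / 2) * (dot x (y - x) - 1) ^+ 2).
Definition symp : R := (Num.sqrt (1 + sqnorm x))^-1 * expR (- ((1 + sqnorm x) / 2)).

Lemma symw_ge0 y : 0 <= symw y. Proof. exact: expR_ge0. Qed.

Lemma symw_le1 y : symw y <= 1.
Proof. by rewrite /symw -expR0 ler_expR mulNr oppr_le0 mulr_ge0 ?sqr_ge0. Qed.

Lemma measurable_symw : measurable_fun setT (symw : _ -> RB).
Proof.
apply: measurableT_comp => //; apply: measurable_funM => //.
apply: measurable_funX; apply: measurable_funB => //.
have -> : (fun y => dot x (y - x)) = fun y => dot x y - dot x x by apply/funext => y; rewrite dotBr.
by apply: measurable_funB => //; exact: measurable_dot.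
Qed.

(** The Lebesgue integral is realized as an expectation over column [i], where [symw] is the
    exponential of the square of -(1 + |x|^2) + <x, G_i>, a one-dimensional case of [exp_moment]. *)
Lemma iint_symw (i : 'I_m) : iint (fun y => (gden y * symw y)%:E) = symp%:E.
Proof.
have ms := measurable_symw.
have -> : iint (fun y => (gden y * symw y)%:E) = (\int[P]_w (symw (col i (gmx G w)))%:E)%E.
  rewrite (replace_col hG i (F := fun M => (symw (col i M))%:E)).
  - have e w : iint (fun y => ((gden y)%:E * (symw (col i (setcol (gmx G w) i y)))%:E)%E) =
        iint (fun y => (gden y * symw y)%:E).
      apply: eq_iint => y; rewrite -EFinM; congr (_ * symw _)%:E.
      by apply/matrixP => r q; rewrite !mxE eqxx [q]ord1.
    by under eq_integral do rewrite e; rewrite integral_cst//= probability_setT mule1.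
  - by apply/measurable_EFinP; apply: (measurableT_comp ms); exact: measurable_col.
  - by move=> M; rewrite lee_fin symw_ge0.
pose u : 'cV[R]_1 := const_mx (- (1 + sqnorm x)).
have hx := sqnorm_ge0 x.
have se : \sum_(j <- index_enum 'I_n) x j ord0 ^+ 2 = sqnorm x by [].
have ht : 2 * (- (1 / 2)) * \sum_(j <- index_enum 'I_n) x j ord0 ^+ 2 < 1 by rewrite se; lra.
have := exp_moment (gaussian_row i hG) u (index_enum_uniq _) ht.
rewrite se expr1 => H.
have -> : (\int[P]_w (symw (col i (gmx G w)))%:E)%E = (\int[P]_w (expR (- (1 / 2) *
   sqnorm (u + lin_comb (index_enum 'I_n) (fun j => x j ord0)
   (gmx (fun (j : 'I_n) w => const_mx (G i w j ord0) : 'cV[R]_1) w))))%:E)%E.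
  apply: eq_integral => w _; congr (expR (_ * _))%:E.
  rewrite [in RHS]/sqnorm big_ord1 !mxE summxE dotBr -sqnorm_dot.
  congr (_ ^+ 2); rewrite /dot.
  have -> : \sum_(j <- index_enum 'I_n) (x j ord0 *: col j (gmx (fun (j : 'I_n) w => const_mx (G i w j ord0) : 'cV[R]_1) w)) ord0 ord0 =
     \sum_j x j ord0 * (col i (gmx G w)) j ord0.
    by apply: eq_bigr => j _; rewrite !mxE.
  by ring.
rewrite H; congr (_ * expR _)%:E; first by congr (Num.sqrt _)^-1; lra.
rewrite /sqnorm big_ord1 mxE -/(sqnorm x) sqrrN.
have h0 : 1 + sqnorm x != 0 by rewrite gt_eqF// ltr_pwDl.
have -> : 1 - 2 * - (1 / 2) * sqnorm x = 1 + sqnorm x by lra.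
by field.
Qed.

Lemma gden_symw y : gden (- y + 2 *: x) * symw (- y + 2 *: x) = gden y * symw y.
Proof.
rewrite !gdenE -!mulrA -!expRD; congr (_ * expR _).
rewrite -[y](subrK x); move: (y - x) => z.
have -> : - (z + x) + 2 *: x = x - z by rewrite scaler_nat mulr2n opprD addrACA addNr addr0 addrC.
have -> : x - z - x = - z by rewrite addrAC subrr add0r.
rewrite addrK [z + x]addrC !sqnormD !dotNr.
have -> : sqnorm (- z) = sqnorm z by rewrite -scaleN1r sqnormZ sqrrN expr1n mul1r.
by field.
Qed.

Lemma iint_reflect (f : 'cV[R]_n -> R) : measurable_fun setT (f : _ -> RB) -> (forall y, 0 <= f y) ->
  iint (fun y => (gden y * symw y * f (- y + 2 *: x))%:E) = iint (fun y => (gden y * symw y * f y)%:E).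
Proof.
move=> mf f0.
have := @iint_linear R n (- 1%:M) (fun y => (gden y * symw y * f y)%:E) (2 *: x).
rewrite -scaleN1r detZ det1 mulr1 normrX normrN1 expr1n invr1 mul1e => <-.
- apply: eq_iint => y; rewrite -gden_symw.
  by rewrite scaleN1r mulNmx mul1mx.
- by rewrite expf_neq0// oppr_eq0 oner_neq0.
- apply/measurable_EFinP; apply: measurable_funM => //; apply: measurable_funM; last exact: measurable_symw.
  exact: measurable_gden.
- by move=> y; rewrite lee_fin !mulr_ge0// ?symw_ge0// gden_ge0.
Qed.

(** The share [symw] of the gaussian mass is invariant under reflection in x, so in it f may be
    averaged over y and 2x - y; the share 1 - [symw] is left alone. *)
Lemma iint_symmetrize (f : 'cV[R]_n -> R) : measurable_fun setT (f : _ -> RB) -> (forall y, 0 <= f y) ->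
  (2%:E * iint (fun y => (gden y * f y)%:E) =
  iint (fun y => (gden y * (2 * (1 - symw y) * f y + symw y * (f y + f (- y + 2 *: x))))%:E))%E.
Proof.
move=> mf f0; have mg := @measurable_gden R n _ _ id (@measurable_id _ _ setT).
have ms := measurable_symw.
have mr : measurable_fun setT (fun y : 'cV[R]_n => f (- y + 2 *: x) : RB).
  apply: (measurableT_comp mf); apply: measurable_mxP => i j; under eq_fun do rewrite !mxE.
  apply: measurable_funD => //; apply: measurableT_comp => //; exact: measurable_coord.
transitivity (iint (fun y => (gden y * ((2 - symw y) * f y))%:E) + iint (fun y => (gden y * symw y * f (- y + 2 *: x))%:E))%E; last first.
  rewrite -iintD; first by apply: eq_iint => y; rewrite -EFinD; congr _%:E; ring.
  - by apply/measurable_EFinP; apply: measurable_funM => //; apply: measurable_funM => //; apply: measurable_funB.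
  - by apply/measurable_EFinP; apply: measurable_funM => //; apply: measurable_funM.
  - by move=> y; rewrite lee_fin !mulr_ge0// ?gden_ge0//; have := symw_le1 y; lra.
  - by move=> y; rewrite lee_fin !mulr_ge0// ?symw_ge0// gden_ge0.
rewrite iint_reflect// -iintD.
- rewrite -iintZl//; first by apply: eq_iint => y; rewrite -EFinD -EFinM; congr _%:E; ring.
  + by apply/measurable_EFinP; apply: measurable_funM.
  + by move=> y; rewrite lee_fin mulr_ge0// gden_ge0.
- by apply/measurable_EFinP; apply: measurable_funM => //; apply: measurable_funM => //; apply: measurable_funB.
- by apply/measurable_EFinP; apply: measurable_funM => //; apply: measurable_funM.
- by move=> y; rewrite lee_fin !mulr_ge0// ?gden_ge0//; have := symw_le1 y; lra.
- by move=> y; rewrite lee_fin !mulr_ge0// ?symw_ge0// gden_ge0.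
Qed.

End symmetrization.

Lemma dot_mulmx (R : realType) a b (A : 'M[R]_(a, b)) u v : dot u (A *m v) = dot (A^T *m u) v.
Proof.
rewrite /dot; under eq_bigr => i _ do rewrite [(A *m v) i ord0]mxE mulr_sumr.
rewrite exchange_big /=; apply: eq_bigr => l _.
rewrite [(A^T *m u) l _]mxE mulr_suml; apply: eq_bigr => r _.
by rewrite [A^T _ _]mxE; ring.
Qed.

Section wendel.
Variables (R : realType) (d : measure_display) (T : measurableType d).
Variables (P : probability T R) (m n : nat) (G : 'I_m -> T -> 'cV[R]_n).
Hypothesis hG : std_gaussian_family P G.
Local Notation RB := (measurableTypeR R).
Variable x : 'cV[R]_n.

(** Separation of x from the columns in [s] by a functional [B *m al], that is, one in the span of
    the columns of [B]. Letting [B] vary makes induction on the subspace possible. *)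
Definition sep_in k (B : 'M[R]_(n, k)) (s : seq 'I_m) : set 'M[R]_(n, m) :=
  [set M | exists al : 'cV[R]_k, forall i, i \in s -> 0 < dot al (B^T *m (col i M - x))].

Lemma measurable_sep_in k (B : 'M[R]_(n, k)) s : measurable (sep_in B s).
Proof.
have -> : sep_in B s = [set M | strictly_separated (fun i : seq_sub s => B^T *m col (ssval i) M) (B^T *m x)].
  apply/seteqP; split => M /= [al H]; exists al => i.
    by rewrite -mulmxBr; apply: H; case: i.
  by move=> si; have := H (SeqSub si); rewrite -mulmxBr.
apply: measurable_separated => // i.
by apply: measurable_mulmx; exact: measurable_col.
Qed.

Definition sep_head k (B : 'M[R]_(n, k)) (s : seq 'I_m) (y : 'cV[R]_n) : set 'M[R]_(n, m) :=
  [set M | exists2 al : 'cV[R]_k, 0 < dot al (B^T *m (y - x)) &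
     forall i, i \in s -> 0 < dot al (B^T *m (col i M - x))].

Lemma sep_in_setcol k (B : 'M[R]_(n, k)) i s y M : i \notin s ->
  sep_in B (i :: s) (setcol M i y) <-> sep_head B s y M.
Proof.
move=> si.
have e1 : col i (setcol M i y) = y by apply/matrixP => r q; rewrite !mxE eqxx [q]ord1.
have e2 l : l \in s -> col l (setcol M i y) = col l M.
  move=> sl; apply/matrixP => r q; rewrite !mxE; case: eqP => // li.
  by rewrite li (negPf si) in sl.
split=> [[al H]|[al H1 H2]]; exists al.
- by have := H i; rewrite e1; apply; rewrite mem_head.
- by move=> l sl; have := H l; rewrite e2//; apply; rewrite inE sl orbT.
- by move=> l; rewrite inE => /predU1P[->|sl]; rewrite ?e1// e2// H2.
Qed.

Lemma measurable_sep_head k (B : 'M[R]_(n, k)) s y : measurable (sep_head B s y).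
Proof.
have -> : sep_head B s y = [set M | strictly_separated (fun i : option (seq_sub s) =>
    B^T *m (if i is Some j then col (ssval j) M else y)) (B^T *m x)].
  apply/seteqP; split => M /=.
    move=> [al H1 H2]; exists al => -[i|]; rewrite -mulmxBr//.
    by apply: H2; case: i.
  move=> [al H]; exists al => [|i si].
    by have := H None; rewrite -mulmxBr.
  by have := H (Some (SeqSub si)); rewrite -mulmxBr.
apply: measurable_separated => // -[i|]; last exact: measurable_cst.
by apply: measurable_mulmx; exact: measurable_col.
Qed.

(* Convexity: a functional from each half of the cone combine to one on the
   dividing hyperplane. *)
Lemma sep_head_split k (B : 'M[R]_(n, k)) s y M :
  (\1_(sep_head B s y) M + \1_(sep_head B s (- y + 2 *: x)) M : R) <=
  \1_(sep_in B s) M + \1_(sep_in (B *m (row_base (kermx (B^T *m (y - x))))^T) s) M.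
Proof.
set c := B^T *m (y - x); set K := kermx c.
have cN : B^T *m (- y + 2 *: x - x) = - c.
  rewrite /c -mulmxN; congr (_ *m _).
  by rewrite scaler_nat mulr2n addrA addrK opprB addrC.
have hs z : sep_head B s z M -> sep_in B s M by move=> [al _ H]; exists al.
have i0 (A : set 'M[R]_(n, m)) : 0 <= (\1_A M : R) by [].
have [h1|h1] := pselect (sep_head B s y M); last first.
  rewrite indic_notin// add0r.
  have [h2|h2] := pselect (sep_head B s (- y + 2 *: x) M); last first.
    by rewrite indic_notin// addr_ge0.
  by rewrite indic_in// indic_in ?lerDl//; exact: hs h2.
have [h2|h2] := pselect (sep_head B s (- y + 2 *: x) M); last first.
  by rewrite indic_in// [X in 1 + X]indic_notin// addr0 indic_in ?lerDl//; exact: hs h1.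
rewrite indic_in// indic_in// indic_in; last exact: hs h1.
rewrite lerD2l indic_in//.
case: h1 h2 => [al a0 aH] [be b0 bH].
rewrite cN dotNr in b0; rewrite -/c in a0.
(* Both coefficients are positive and the combination is orthogonal to c, so it still separates [s]
   and comes from the smaller subspace. *)
pose ga := (- dot be c) *: al + dot al c *: be.
have gc : dot ga c = 0 by rewrite /ga dotDl !dotZl; ring.
have /submxP[D eD] : (ga^T <= row_base K)%MS.
  rewrite eq_row_base; apply/sub_kermxP/matrixP => i j.
  rewrite [i]ord1 [j]ord1 [RHS]mxE; transitivity (dot ga c) => //.
  by rewrite [LHS]mxE; apply: eq_bigr => l _; rewrite mxE.
exists D^T => i si.
have -> : dot D^T ((B *m (row_base K)^T)^T *m (col i M - x)) = dot ga (B^T *m (col i M - x)).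
  rewrite trmx_mul trmxK -mulmxA; set v := B^T *m _.
  have -> : ga = (row_base K)^T *m D^T by rewrite -trmx_mul -eD trmxK.
  by rewrite -dot_mulmx.
rewrite /ga dotDl !dotZl addr_gt0// mulr_gt0//; [exact: aH|exact: bH].
Qed.

Lemma probE (A : set 'M[R]_(n, m)) : measurable A ->
  P (gmx G @^-1` A) = (\int[P]_w (\1_A (gmx G w))%:E)%E.
Proof.
move=> mA; transitivity (\int[P]_w (\1_(gmx G @^-1` A) w)%:E)%E; last by apply: eq_integral.
rewrite integral_indic//= ?setIT//.
by have := measurable_gmx hG measurableT mA; rewrite setTI.
Qed.

Lemma symp_le1 : symp x <= 1.
Proof.
have hx := sqnorm_ge0 x.
rewrite /symp -[leRHS]mulr1 ler_pM ?invr_ge0 ?expR_ge0//.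
  have s1 : 1 <= Num.sqrt (1 + sqnorm x) by rewrite -[leLHS]sqrtr1; apply: ler_wsqrtr; lra.
  by rewrite invf_le1// (lt_le_trans ltr01).
by rewrite -[leRHS]expR0 ler_expR; lra.
Qed.

(** Let K be the bound for [s]. A fixed y costs at most K, and the pair y, 2x - y at most K + K/2,
    since the second term of [sep_head_split] lives in dimension k - 1. With weights 2 (1 - [symw])
    and [symw] the total is 2 - [symw] / 2 times K, whose gaussian mean is 2 K (1 - [symp] / 4). *)
Lemma sep_prob s k (B : 'M[R]_(n, k)) : uniq s ->
  (P (gmx G @^-1` sep_in B s) <= (2 ^+ k * (1 - symp x / 4) ^+ size s)%:E)%E.
Proof.
set q := 1 - symp x / 4.
have q0 : 0 <= q by have := symp_le1; rewrite /q; lra.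
elim: s k B => [|i s IH] k B.
  move=> _; rewrite expr0 mulr1; apply: (le_trans (probability_le1 _ _)).
    by have := measurable_gmx hG measurableT (measurable_sep_in B [::]); rewrite setTI.
  by rewrite lee_fin exprn_ege1// ler1n.
move=> /= /andP[si us].
pose K : R := 2 ^+ k * q ^+ size s.
have K0 : 0 <= K by rewrite mulr_ge0 ?exprn_ge0.
have mS := measurable_sep_in B (i :: s).
have mI (A : set 'M[R]_(n, m)) : measurable A -> measurable_fun setT (fun w => \1_A (gmx G w) : RB).
  move=> mA; apply: (measurableT_comp (f := fun M => \1_A M : RB)); first exact: measurable_indic.
  exact: (measurable_gmx hG).
have E1 y : (\int[P]_w (\1_(sep_head B s y) (gmx G w))%:E <= K%:E)%E.
  apply: le_trans (IH k B us); rewrite probE; last exact: measurable_sep_in.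
  apply: ge0_le_integral => //.
  - by apply/measurable_EFinP; apply: mI; exact: measurable_sep_head.
  - by apply/measurable_EFinP; apply: mI; exact: measurable_sep_in.
  - move=> w _; rewrite lee_fin; have [h|h] := pselect (sep_head B s y (gmx G w)); last by rewrite indic_notin.
    by rewrite !indic_in//; case: h => al _ h; exists al.
have E2 y : (\int[P]_w (\1_(sep_head B s y) (gmx G w) + \1_(sep_head B s (- y + 2 *: x)) (gmx G w))%:E
    <= (3 / 2 * K)%:E)%E.
  (* If y - x is orthogonal to the subspace, neither y nor its reflection is strictly separable, so
     both events are empty. *)
  have [c0|c0] := eqVneq (B^T *m (y - x)) 0.
    have K2 : 0 <= 3 / 2 * K by lra.
    rewrite (eq_integral (fun=> 0%E)) ?integral0 ?lee_fin// => w _.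
    rewrite indic_notin ?add0r => [|[al]]; last by rewrite c0 dot0r ltxx.
    rewrite indic_notin// => -[al].
    rewrite (_ : - y + 2 *: x - x = - (y - x)) ?mulmxN ?c0 ?oppr0 ?dot0r ?ltxx//.
    by rewrite scaler_nat mulr2n addrA addrK opprB addrC.
  set c := B^T *m (y - x) in c0 *.
  have rK : \rank (kermx c) = k.-1 /\ (0 < k)%N.
    have : (0 < \rank c)%N by rewrite lt0n mxrank_eq0.
    rewrite mxrank_ker; have := rank_leq_col c; have := rank_leq_row c.
    by case: (\rank c) => [//|[|//]] h _ _; rewrite subn1; split => //; case: (k) h.
  have H' := IH _ (B *m (row_base (kermx c))^T) us.
  have H := IH _ B us.
  apply: (@le_trans _ _ (\int[P]_w (\1_(sep_in B s) (gmx G w) + \1_(sep_in (B *m (row_base (kermx c))^T) s) (gmx G w))%:E)%E).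
    apply: ge0_le_integral => //.
    - by apply/measurable_EFinP; apply: measurable_funD; apply: mI; exact: measurable_sep_head.
    - by apply/measurable_EFinP; apply: measurable_funD; apply: mI; exact: measurable_sep_in.
    - by move=> w _; rewrite lee_fin; exact: sep_head_split.
  under eq_integral do rewrite EFinD.
  rewrite ge0_integralD//=; try by apply/measurable_EFinP; apply: mI; exact: measurable_sep_in.
  rewrite -!probE; try exact: measurable_sep_in.
  apply: (le_trans (leeD H H')); rewrite -EFinD lee_fin -/K /K.
  case: rK => -> ; case: (k) => // k' _; rewrite /= exprS; set Q := q ^+ _.
  by rewrite le_eqVlt; apply/orP; left; apply/eqP; field.
pose f w y : R := \1_(sep_in B (i :: s)) (setcol (gmx G w) i y).
have fE w y : f w y = \1_(sep_head B s y) (gmx G w).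
  have [h|h] := pselect (sep_head B s y (gmx G w)).
    by rewrite /f !indic_in//; apply/sep_in_setcol.
  by rewrite /f !indic_notin// => /(sep_in_setcol B y (gmx G w) si).
have f0 w y : 0 <= f w y by [].
have mf : measurable_fun setT (fun p : T * 'cV[R]_n => f p.1 p.2 : RB).
  apply: (measurableT_comp (f := fun M => \1_(sep_in B (i :: s)) M : RB)); first exact: measurable_indic.
  by apply: measurable_setcol => //; apply: (measurableT_comp (measurable_gmx hG)).
have mfw w : measurable_fun setT (f w : _ -> RB).
  exact: (measurableT_comp mf (@measurable_pair1 _ _ T 'cV[R]_n w)).
have mfy y : measurable_fun setT (fun w => f w y : RB).
  exact: (measurableT_comp mf (@measurable_pair2 _ _ T 'cV[R]_n y)).
pose g (p : T * 'cV[R]_n) : R := gden p.2 * (2 * (1 - symw x p.2) * f p.1 p.2 +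
  symw x p.2 * (f p.1 p.2 + f p.1 (- p.2 + 2 *: x))).
have s0 := symw_ge0 x; have s1 := symw_le1 x.
have s2 y : 0 <= 1 - symw x y by rewrite subr_ge0.
have g0 p : 0 <= g p.
  by rewrite mulr_ge0 ?gden_ge0// addr_ge0// !mulr_ge0// addr_ge0.
have m2 : measurable_fun setT (fun p : T * 'cV[R]_n => symw x p.2 : RB).
  by apply: (measurableT_comp (@measurable_symw R n x)).
have mg : measurable_fun setT (g : _ -> RB).
  apply: measurable_funM; first exact: measurable_gden.
  apply: measurable_funD; apply: measurable_funM => //.
    by apply: measurable_funM => //; apply: measurable_funB.
  apply: measurable_funD => //.
  apply: (measurableT_comp mf (g := fun p : T * 'cV[R]_n => (p.1, - p.2 + 2 *: x))).
  apply: measurable_fun_pair => //; apply: measurable_mxP => r l; under eq_fun do rewrite !mxE.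
  apply: measurable_funD => //; apply: measurableT_comp => //.
  by apply: (measurableT_comp (f := fun y : 'cV[R]_n => y r l : RB)) => //; exact: measurable_coord.
have step : (2%:E * P (gmx G @^-1` sep_in B (i :: s)) = iint (fun y => \int[P]_w (g (w, y))%:E))%E.
  rewrite probE// (replace_col hG i (F := fun M => (\1_(sep_in B (i :: s)) M)%:E)); first last.
  - by move=> M; rewrite lee_fin.
  - by apply/measurable_EFinP; exact: measurable_indic.
  rewrite -(@iint_tonelli R n _ T P (fun p => (g p)%:E)); first last.
  - by move=> p; rewrite lee_fin.
  - exact/measurable_EFinP.
  rewrite -ge0_integralZl//; first last.
  - by move=> w _; apply: iint_ge0 => y; rewrite -EFinM lee_fin mulr_ge0// gden_ge0.
  - apply: (@measurable_iint R n _ T (fun p => ((gden p.2)%:E * (f p.1 p.2)%:E)%E)).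
      by apply/measurable_EFinP; apply: measurable_funM => //; exact: measurable_gden.
    by move=> p; rewrite -EFinM lee_fin mulr_ge0// gden_ge0.
  apply: eq_integral => w _; rewrite -(iint_symmetrize x (mfw w) (f0 w)).
  by congr (_ * _)%E; apply: eq_iint => y; rewrite -EFinM.
have bnd y : (\int[P]_w (g (w, y))%:E <= (gden y * (2 - symw x y / 2) * K)%:E)%E.
  have c1 : (0 <= (gden y * (2 * (1 - symw x y)))%:E)%E by rewrite lee_fin !mulr_ge0 ?gden_ge0.
  have c2 : (0 <= (gden y * symw x y)%:E)%E by rewrite lee_fin mulr_ge0 ?gden_ge0.
  have -> : (\int[P]_w (g (w, y))%:E = (gden y * (2 * (1 - symw x y)))%:E * (\int[P]_w (f w y)%:E) +
     (gden y * symw x y)%:E * (\int[P]_w (f w y + f w (- y + 2 *: x))%:E))%E.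
    have M1 : measurable_fun setT (fun w => (f w y)%:E : \bar R) by apply/measurable_EFinP; exact: mfy.
    have M2 : measurable_fun setT (fun w => (f w y + f w (- y + 2 *: x))%:E : \bar R).
      by apply/measurable_EFinP; apply: measurable_funD; exact: mfy.
    have N1 w : [set: T] w -> (0 <= (f w y)%:E)%E by move=> _; rewrite lee_fin; exact: f0.
    have N2 w : [set: T] w -> (0 <= (f w y + f w (- y + 2 *: x))%:E)%E by move=> _; rewrite lee_fin addr_ge0.
    rewrite -(ge0_integralZl P measurableT M1 N1 c1) -(ge0_integralZl P measurableT M2 N2 c2).
    rewrite -ge0_integralD//; try exact: measurable_funeM;
      try (by move=> w wT; rewrite mule_ge0//; first [exact: N1|exact: N2]).
    - by apply: eq_integral => w _; rewrite -!EFinM -EFinD; congr _%:E; rewrite /g /=; ring.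
  have F1 : (\int[P]_w (f w y)%:E <= K%:E)%E.
    by apply: le_trans (E1 y); under eq_integral do rewrite fE.
  have F2 : (\int[P]_w (f w y + f w (- y + 2 *: x))%:E <= (3 / 2 * K)%:E)%E.
    by apply: le_trans (E2 y); under eq_integral do rewrite !fE.
  apply: (le_trans (leeD (lee_wpmul2l c1 F1) (lee_wpmul2l c2 F2))).
  rewrite -!EFinM -EFinD lee_fin le_eqVlt; apply/orP; left; apply/eqP; by field.
have mgd := @measurable_gden R n _ _ id (@measurable_id _ _ setT).
have h2 y : 0 <= 2 - symw x y / 2 by have := s1 y; lra.
have mX : measurable_fun setT (fun y : 'cV[R]_n => (gden y * (2 - symw x y / 2) * K)%:E : \bar R).
  apply/measurable_EFinP; apply: measurable_funM => //; apply: measurable_funM => //.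
  by apply: measurable_funB => //; apply: measurable_funM => //; exact: measurable_symw.
have fin : iint (fun y : 'cV[R]_n => (gden y * (2 - symw x y / 2) * K)%:E) = (2 * (K * q))%:E.
  have mgs : measurable_fun setT (fun y : 'cV[R]_n => (gden y * symw x y)%:E : \bar R).
    by apply/measurable_EFinP; apply: measurable_funM => //; exact: measurable_symw.
  (* The [symw] term is added back on the left, so that only sums of nonnegative integrals occur. *)
  have e : (iint (fun y : 'cV[R]_n => (gden y * (2 - symw x y / 2) * K)%:E) + (K / 2 * symp x)%:E = (2 * K)%:E)%E.
    rewrite EFinM -(iint_symw hG x i) -iintZl//; first last.
    - by rewrite lee_fin; lra.
    - by move=> y; rewrite lee_fin mulr_ge0 ?gden_ge0.
    rewrite -iintD//.
    - rewrite -[RHS]mule1 -(iint_gden R n) -iintZl//.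
      + by apply: eq_iint => y; rewrite -!EFinM -EFinD; congr _%:E; field.
      + exact/measurable_EFinP.
      + by move=> y; rewrite lee_fin gden_ge0.
      + by rewrite lee_fin; lra.
    - exact: measurable_funeM.
    - by move=> y; rewrite lee_fin; apply: mulr_ge0 => //; rewrite mulr_ge0 ?gden_ge0.
    - move=> y; rewrite -EFinM lee_fin; apply: mulr_ge0; first lra.
      by rewrite mulr_ge0 ?gden_ge0.
  move: e; case: (iint _) => [r||]//; rewrite -EFinD => -[e]; congr _%:E.
  by rewrite /q; lra.
have : (2%:E * P (gmx G @^-1` sep_in B (i :: s)) <= (2 * (K * q))%:E)%E.
  rewrite step -fin; apply: le_iint => //.
  - have := @measurable_fun_fubini_tonelli_G _ _ T 'cV[R]_n R P (fun p => (g p)%:E); apply.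
      exact/measurable_EFinP.
    by move=> p; rewrite lee_fin.
  - by move=> y; apply: integral_ge0 => w _; rewrite lee_fin.
by rewrite EFinM lee_pmul2l// exprS [q * _]mulrC mulrA.
Qed.
End wendel.

Section volume_event.
Variables (R : realType) (d : measure_display) (T : measurableType d).
Variables (P : probability T R) (n N : nat) (G : 'I_N.+1 -> T -> 'cV[R]_n).
Hypothesis hG : std_gaussian_family P G.
Local Notation RB := (measurableTypeR R).

(** The points G_1, ..., G_N lie in both bodies, so a lower bound on the volume of their hull serves
    twice. *)
Definition tail_pts w (i : 'I_N) : 'cV[R]_n := G (lift ord0 i) w.

Lemma col_gmx (w : T) (i : 'I_N.+1) : col i (gmx G w) = G i w.
Proof. by apply/matrixP => r q; rewrite !mxE [q]ord1. Qed.

Lemma symp_ge (x : 'cV[R]_n) : expR (- sqnorm x - 1 / 2) <= symp x.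
Proof.
have s0 := sqnorm_ge0 x; rewrite /symp; set s := sqnorm x in s0 *.
have h : Num.sqrt (1 + s) <= expR (s / 2).
  have -> : expR (s / 2) = Num.sqrt (expR s).
    by rewrite [in RHS](_ : s = s / 2 * 2) ?expRM_natr ?sqrtr_sqr ?ger0_norm ?expR_ge0//; field.
  by apply: ler_wsqrtr; exact: expR_ge1Dx.
have -> : - s - 1 / 2 = - (s / 2) + - ((1 + s) / 2) by field.
rewrite expRD ler_wpM2r ?expR_ge0// expRN lef_pV2 ?posrE ?expR_gt0//.
by rewrite sqrtr_gt0; lra.
Qed.

(** The hypothesis turns (1 - symp/4)^N into at most e^(-2n), and 2^n <= e^n leaves e^(-n). *)
Lemma separated_prob x : 8 * n%:R <= symp x * N%:R ->
  (P [set w | strictly_separated (tail_pts w) x] <= (expR (- n%:R))%:E)%E.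
Proof.
move=> H; have p1 := symp_le1 x.
pose s := [seq lift ord0 i | i <- enum 'I_N].
have us : uniq s by rewrite map_inj_uniq ?enum_uniq//; exact: lift_inj.
have := sep_prob hG x (1%:M : 'M[R]_n) us.
have -> : gmx G @^-1` sep_in x 1%:M s = [set w | strictly_separated (tail_pts w) x].
  apply/seteqP; split => w /= [al h]; exists al.
    move=> i; have := h (lift ord0 i); rewrite trmx1 mul1mx col_gmx; apply.
    by rewrite map_f// mem_enum.
  by move=> i /mapP[j _ ->]; rewrite trmx1 mul1mx col_gmx; exact: h.
move/le_trans; apply; rewrite lee_fin size_map size_enum_ord.
have h1 : 2 ^+ n <= expR n%:R :> R.
  rewrite -[n%:R]mul1r expRM_natr lerXn2r ?nnegrE ?expR_ge0//.
  by have := @expR_ge1Dx R 1; lra.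
have h2 : (1 - symp x / 4) ^+ N <= expR (- 2 * n%:R).
  apply: (@le_trans _ _ (expR (- (symp x / 4)) ^+ N)).
    rewrite lerXn2r ?nnegrE ?expR_ge0//; first by lra.
    exact: expR_ge1Dx.
  by rewrite -expRM_natr ler_expR; lra.
apply: (@le_trans _ _ (expR n%:R * expR (- 2 * n%:R))).
  by rewrite ler_pM ?exprn_ge0//; lra.
by rewrite -expRD ler_expR; lra.
Qed.

Variable rho : R.
Hypothesis rho0 : 0 < rho.
Hypothesis Hrho : forall x : 'cV[R]_n, (forall j, - rho <= x j ord0 <= rho) ->
  8 * n%:R <= symp x * N%:R.

Definition cube_ind (x : 'cV[R]_n) : R := \prod_j \1_(`[- rho, rho]%classic) (x j ord0).

Lemma cube_ind_ge0 x : 0 <= cube_ind x. Proof. by apply: prodr_ge0. Qed.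

Lemma cube_ind_le1 x : cube_ind x <= 1.
Proof. by apply: prodr_ile1 => j _; rewrite indicE ler0n lern1 leq_b1. Qed.

Lemma measurable_cube_ind : measurable_fun setT (cube_ind : _ -> RB).
Proof.
apply: measurable_prod => j _; apply: (measurableT_comp (f := fun t : RB => \1_(`[- rho, rho]%classic) t : RB)).
  by apply: measurable_indic; exact: measurable_itv.
exact: measurable_coord.
Qed.

(** The volume of the part of the cube outside the hull; its mean is at most an e^(-n) share of the
    cube. *)
Definition missed w : \bar R :=
  iint (fun x : 'cV[R]_n => (cube_ind x * \1_[set x | strictly_separated (tail_pts w) x] x)%:E).

Definition vol_good : set T := [set w | (missed w < ((2 * rho) ^+ n / 2)%:E)%E].

Let mf : measurable_fun setT (fun q : T * 'cV[R]_n =>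
  cube_ind q.2 * \1_[set x | strictly_separated (tail_pts q.1) x] q.2 : RB).
Proof.
apply: measurable_funM; first by apply: (measurableT_comp measurable_cube_ind).
have -> : (fun q : T * 'cV[R]_n => \1_[set x | strictly_separated (tail_pts q.1) x] q.2 : R) =
   \1_[set q | strictly_separated (tail_pts q.1) q.2].
  by apply/funext => q; rewrite !indicE; congr _%:R; apply/idP/idP => /set_mem h; apply/mem_set.
apply: measurable_indic; apply: measurable_separated => // i.
apply: (measurableT_comp (f := fun w => tail_pts w i)) => //.
have -> : (fun w => tail_pts w i) = fun w => col (lift ord0 i) (gmx G w).
  by apply/funext => w; rewrite col_gmx.
by apply: measurable_col; exact: (measurable_gmx hG).
Qed.

Let f0 (q : T * 'cV[R]_n) :
  (0 <= (cube_ind q.2 * \1_[set x | strictly_separated (tail_pts q.1) x] q.2)%:E)%E.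
Proof. by rewrite lee_fin mulr_ge0// cube_ind_ge0. Qed.

Let mfE : measurable_fun setT (fun q : T * 'cV[R]_n =>
  (cube_ind q.2 * \1_[set x | strictly_separated (tail_pts q.1) x] q.2)%:E : \bar R).
Proof. by apply/measurable_EFinP; exact: mf. Qed.

Lemma measurable_missed : measurable_fun setT missed.
Proof. exact: (measurable_iint mfE f0). Qed.

Lemma iint_cube_ind : iint (fun x => (cube_ind x)%:E) = ((2 * rho) ^+ n)%:E.
Proof.
have r : - rho <= rho by rewrite -subr_ge0 opprK addr_ge0 // ltW.
by rewrite iint_cube//; congr (_ ^+ _)%:E; ring.
Qed.

Lemma expected_missed : (\int[P]_w missed w <= (expR (- n%:R) * (2 * rho) ^+ n)%:E)%E.
Proof.
rewrite /missed (@iint_tonelli R n _ T P (fun q => (cube_ind q.2 * \1_[set x | strictly_separated (tail_pts q.1) x] q.2)%:E))//.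
have mc : measurable_fun setT (fun x => (cube_ind x)%:E : \bar R).
  by apply/measurable_EFinP; exact: measurable_cube_ind.
rewrite EFinM -iint_cube_ind -iintZl ?lee_fin ?expR_ge0//; last first.
  by move=> x; rewrite lee_fin cube_ind_ge0.
apply: le_iint => //.
- have := @measurable_fun_fubini_tonelli_G _ _ T 'cV[R]_n R P (fun q => (cube_ind q.2 * \1_[set x | strictly_separated (tail_pts q.1) x] q.2)%:E); exact.
- exact: measurable_funeM.
- by move=> x; apply: integral_ge0 => w _; exact: (f0 (w, x)).
move=> x.
have [h|h] := pselect (forall j, - rho <= x j ord0 <= rho); last first.
  have c0 : cube_ind x = 0.
    move/existsNP: h => [j h].
    have nj : ~ `[- rho, rho]%classic (x j ord0) by rewrite /= in_itv.
    by rewrite /cube_ind (bigD1 j)//= indic_notin// mul0r.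
  by rewrite c0 mule0; under eq_integral do rewrite mul0r; rewrite integral0.
have c1 : cube_ind x = 1.
  by apply: big1 => j _; rewrite indic_in//= in_itv /=; exact: h.
rewrite c1 mule1; apply: le_trans (separated_prob (Hrho h)).
have mS : measurable [set w | strictly_separated (tail_pts w) x].
  apply: measurable_separated => // i.
  have -> : (fun w => tail_pts w i) = fun w => col (lift ord0 i) (gmx G w).
    by apply/funext => w; rewrite col_gmx.
  by apply: measurable_col; exact: (measurable_gmx hG).
rewrite -[X in (_ <= P X)%E]setIT -integral_indic//.
rewrite le_eqVlt; apply/orP; left; apply/eqP; apply: eq_integral => w _; rewrite mul1r.
by rewrite !indicE; congr (_%:R)%:E; apply/idP/idP => /set_mem h'; apply/mem_set.
Qed.

Lemma vol_goodP : measurable vol_good /\ (P (~` vol_good) <= (2 * expR (- n%:R))%:E)%E.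
Proof.
pose L := (2 * rho) ^+ n / 2.
have r2 : 0 < (2 * rho) ^+ n by rewrite exprn_gt0// mulr_gt0.
have L0 : 0 < L by rewrite divr_gt0.
have mB : measurable [set w | (L%:E <= missed w)%E].
  rewrite -[X in measurable X]setTI; apply: emeasurable_fun_c_infty => //.
  exact: measurable_missed.
have e : ~` vol_good = [set w | (L%:E <= missed w)%E].
  by apply/seteqP; split => w; rewrite /vol_good /= -/L leNgt => /negP.
split; first by rewrite -[vol_good]setCK e; exact: measurableC.
rewrite e; apply: (le_trans (markov_ge0 P measurable_missed _ L0 mB)).
  by move=> w; apply: iint_ge0 => x; exact: (f0 (w, x)).
apply: (@le_trans _ _ ((L^-1)%:E * (expR (- n%:R) * (2 * rho) ^+ n)%:E)%E).
  by rewrite lee_pmul2l ?lte_fin ?invr_gt0//; exact: expected_missed.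
rewrite -EFinM lee_fin le_eqVlt; apply/orP; left; apply/eqP.
by rewrite /L; field; rewrite gt_eqF.
Qed.

Lemma vol_good_ge w : vol_good w ->
  (((2 * rho) ^+ n / 2)%:E <= vol (convex_hull (tail_pts w)))%E.
Proof.
rewrite /vol_good /= => h.
have mh := measurable_hull (tail_pts w).
have : (((2 * rho) ^+ n)%:E <= vol (convex_hull (tail_pts w)) + missed w)%E.
  have m1 : measurable_fun setT (fun x => (\1_(convex_hull (tail_pts w)) x)%:E : \bar R).
    by apply/measurable_EFinP; exact: measurable_indic.
  have m2 := measurableT_comp mfE (@measurable_pair1 _ _ T 'cV[R]_n w).
  rewrite -iint_cube_ind -iintD//.
  - apply: le_iint => //.
    + by apply/measurable_EFinP; exact: measurable_cube_ind.
    + exact: emeasurable_funD.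
    + by move=> x; rewrite lee_fin cube_ind_ge0.
    + move=> x; rewrite -EFinD lee_fin.
      have [Kx|Kx] := pselect (convex_hull (tail_pts w) x).
        by rewrite indic_in// (le_trans (cube_ind_le1 x))// lerDl mulr_ge0// cube_ind_ge0.
      by rewrite indic_notin// add0r indic_in ?mulr1//; exact: notin_separated.
  - by move=> x; exact: (f0 (w, x)).
have := vol_hull_fin (tail_pts w); case: (vol _) => [v||]// _.
have : (0 <= missed w)%E by apply: iint_ge0 => x; exact: (f0 (w, x)).
move: h; case: (missed w) => [r||]//; rewrite !lte_fin !lee_fin => h1 h2 h3; lra.
Qed.

End volume_event.

(** * Assembling the events *)

Section moment_bound.
Variables (R : realType) (d : measure_display) (T : measurableType d).
Variables (m n : nat) (G : 'I_m -> T -> 'cV[R]_n).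
Variables (k : nat) (B0 : R) (w : T).
Hypothesis good : quad_good G k B0 w.

(** A signed sum over an injectively indexed family is encoded as a pattern on all indices, null off
    the image of [S]. *)
Lemma quad_signed (J : finType) (S : {set J}) (h : J -> 'I_m) (c : J -> bool) :
  {in S &, injective h} -> (#|S| <= k)%N ->
  sqnorm (\sum_(j in S) (-1) ^+ c j *: G (h j) w) <= B0.
Proof.
move=> hinj cS.
pose e : {ffun 'I_m -> 'I_3} := [ffun i =>
  if [pick j in S | h j == i] is Some j then (if c j then inord 2 else inord 1) else ord0].
have eh j : j \in S -> sgn3 R (e (h j)) = (-1) ^+ c j.
  move=> jS; rewrite ffunE; case: pickP => [j' /andP[j'S /eqP hj]|/(_ j)]; last by rewrite jS eqxx.
  rewrite (hinj _ _ j'S jS hj) /sgn3; case: (c j); rewrite !inordK//= ?expr1 ?expr0.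
    by rewrite add0r.
  by rewrite subr0.
have e0 i : i \notin h @: S -> e i = ord0.
  move=> iS; rewrite ffunE; case: pickP => // j /andP[jS /eqP hj].
  by move: iS; rewrite -hj imset_f.
have : sqnorm (\sum_i sgn3 R (e i) *: G i w) <= B0.
  apply: good; apply: leq_trans cS; rewrite -(card_in_imset hinj).
  apply: subset_leq_card; apply/fintype.subsetP => i; rewrite inE; apply: contraR => /e0 ->.
  by rewrite eqxx.
rewrite (bigID (mem (h @: S))) /= [X in _ + X]big1 ?addr0; last first.
  by move=> i /e0 ->; rewrite /sgn3 subrr scale0r.
rewrite big_imset//=.
by under eq_bigr => j jS do rewrite eh//.
Qed.

Lemma quad_sum_sqnorm (J : finType) (S : {set J}) (h : J -> 'I_m) :
  {in S &, injective h} -> (#|S| <= k)%N -> \sum_(j in S) sqnorm (G (h j) w) <= B0.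
Proof.
move=> hinj cS; have [c [H|]] := greedy_signs (enum S) (fun j => G (h j) w); last by rewrite enum_uniq.
rewrite !big_enum /= in H; apply: (le_trans H); exact: quad_signed.
Qed.

(** G_i and -G_i may both occur, so [h] need not be injective; it is on the vertices of either sign.
    With u and v the two partial sums, the squared norms contribute 2 B0 and |u + v|^2 <= 2|u|^2 +
    2|v|^2 contributes 4 B0. *)
Lemma signed_points_moment (J : finType) (h : J -> 'I_m) (b : J -> bool) :
  injective (fun j => (h j, b j)) -> (#|J| <= k)%N ->
  \sum_j sqnorm (((if b j then 1 else -1) : R) *: G (h j) w) +
  sqnorm (\sum_j ((if b j then 1 else -1) : R) *: G (h j) w) <= 6 * B0.
Proof.
move=> inj cJ.
pose S c : {set J} := [set j | b j == c]%SET.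
have hS c : {in S c &, injective h}.
  by move=> i j; rewrite !inE => /eqP bi /eqP bj hij; apply: inj; rewrite /= hij bi bj.
have cS c : (#|S c| <= k)%N by apply: leq_trans cJ; exact: max_card.
have s1 c := quad_sum_sqnorm (hS c) (cS c).
have s2 c := quad_signed (fun=> ~~ c) (hS c) (cS c).
have D (V : nmodType) (F : J -> V) : \sum_j F j = \sum_(j in S true) F j + \sum_(j in S false) F j.
  rewrite (bigID (fun j => b j)) /=; by congr (_ + _); apply: eq_bigl => j; rewrite inE; case: (b j).
have e2 : \sum_j sqnorm (((if b j then 1 else -1) : R) *: G (h j) w) = \sum_j sqnorm (G (h j) w).
  by apply: eq_bigr => j _; rewrite sqnormZ; case: (b j); rewrite ?sqrrN expr1n mul1r.
have e3 c : \sum_(j in S c) ((if b j then 1 else -1) : R) *: G (h j) w =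
    \sum_(j in S c) (-1) ^+ (~~ c) *: G (h j) w.
  by apply: eq_bigr => j; rewrite inE => /eqP ->; case: c.
rewrite e2 !D !e3.
have := s1 true; have := s1 false; have := s2 true; have := s2 false.
set u := \sum_(j in S true) _ *: _; set v := \sum_(j in S false) _ *: _ => hv hu h1 h2.
have : 0 <= sqnorm (u - v) by exact: sqnorm_ge0.
rewrite !sqnormD dotNr -[- v]scaleN1r sqnormZ sqrrN expr1n mul1r; lra.
Qed.

End moment_bound.

(** Trades the real exponent -2/n for an inequality between integer powers. *)
Lemma powR_neg2n_le (R : realType) n (V c : R) : (0 < n)%N -> 0 < V -> 0 < c ->
  1 <= V ^+ 2 * c ^+ n -> V `^ (- (2 / n%:R)) <= c.
Proof.
move=> n0 V0 c0 H.
have n0' : n%:R != 0 :> R by rewrite pnatr_eq0 -lt0n.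
have cn : 0 < c ^+ n by rewrite exprn_gt0.
have V2 : 0 < V ^+ 2 by rewrite exprn_gt0.
have -> : c = (c ^+ n) `^ (n%:R^-1).
  by rewrite -powR_mulrn ?(ltW c0)// -powRrM mulfV// powRr1// ltW.
have -> : V `^ (- (2 / n%:R)) = ((V ^+ 2)^-1) `^ (n%:R^-1).
  rewrite -powR_mulrn ?(ltW V0)// -powRN -powRrM; congr (_ `^ _).
  by rewrite mulNr.
apply: ge0_ler_powR; rewrite ?nnegrE ?invr_ge0 ?ler0n ?(ltW V2) ?(ltW cn)//.
by rewrite -[leLHS]mulr1 ler_pdivrMl.
Qed.

Lemma isotropic_bound (R : realType) n (I : finType) (p : I -> 'cV[R]_n) (i0 : I) (L V c : R) :
  (0 < n)%N -> 0 <= L -> 0 < V -> 0 < c ->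
  (forall q : 'I_(1 + n) -> I, injective q ->
     \sum_k sqnorm (p (q k)) + sqnorm (\sum_k p (q k)) <= 6 * (32 * n.+1%:R * n%:R * L)) ->
  (V%:E <= vol (convex_hull p))%E -> 1 <= V ^+ 2 * (c * n%:R) ^+ n ->
  isotropic_constant (convex_hull p) <= Num.sqrt (192 * L * c).
Proof.
move=> n0 L0 V0 c0 HB HV H.
have n1 : 0 < n%:R :> R by rewrite ltr0n.
apply: (le_trans (isotropic_constant_le i0 n0 HB _ V0 HV)); first by rewrite !mulr_ge0.
apply: ler_wsqrtr.
have hV := powR_neg2n_le n0 V0 (mulr_gt0 c0 n1) H.
have hV0 : 0 <= V `^ (- (2 / n%:R)) by exact: powR_ge0.
have -> : 6 * (32 * n.+1%:R * n%:R * L) / (n.+1%:R * n.+2%:R) = 192 * L * (n%:R / n.+2%:R) :> R.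
  have a0 : n.+1%:R != 0 :> R by rewrite pnatr_eq0.
  have b0 : n.+2%:R != 0 :> R by rewrite pnatr_eq0.
  by move: a0 b0; move: n.+1%:R n.+2%:R => a b a0 b0; field; do ?[apply/andP; split]; assumption.
have h1 : n%:R / n.+2%:R <= 1 :> R by rewrite ler_pdivrMr ?ltr0n// mul1r ler_nat; exact: (leq_trans (leqnSn _)).
have L1 : 0 <= 192 * L by rewrite mulr_ge0.
move: hV hV0; set Z := V `^ _ => hV hV0.
rewrite ler_pdivrMr//; apply: (@le_trans _ _ (192 * L * Z)).
  by rewrite -[leLHS]mulrA ler_wpM2l// ler_piMl.
by rewrite -[leRHS]mulrA ler_wpM2l.
Qed.

(** With tau = n/N, counting patterns costs e^(l (n+1) + 4n) for l = log(N/n), and the transform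
    costs 2^n <= e^n. The 32 makes the Markov exponent 8 n (1 + l), which beats these costs by at
    least n. *)
Lemma quad_prob_bound (R : realType) (d : measure_display) (T : measurableType d)
    (P : probability T R) n N (G : 'I_N.+1 -> T -> 'cV[R]_n) (L : R) :
  std_gaussian_family P G -> (0 < n)%N -> (n <= N)%N -> L = 1 + ln (N%:R / n%:R) ->
  let Q := quad_good G n.+1 (32 * n.+1%:R * n%:R * L) in
  measurable Q /\ (P (~` Q) <= (expR (- n%:R))%:E)%E.
Proof.
move=> hG n0 nN eL Q.
have n1 : 1 <= n%:R :> R by rewrite ler1n.
have nNr : n%:R <= N%:R :> R by rewrite ler_nat.
have np : 0 < n%:R :> R by rewrite ltr0n.
have Np : 0 < N%:R :> R by apply: lt_le_trans nNr.
pose tau : R := n%:R / N%:R.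
have ht : 0 < tau <= 1 by rewrite divr_gt0//= ler_pdivrMr// mul1r.
have [mQ PQ] := quad_good_prob hG (32 * n.+1%:R * n%:R * L) (ltn0Sn n) ht.
split=> //; apply: (le_trans PQ); rewrite lee_fin.
set l := ln (N%:R / n%:R) in eL.
have l0 : 0 <= l by rewrite ln_ge0// ler_pdivlMr// mul1r.
have e1 : tau ^- n.+1 = expR (l * n.+1%:R).
  by rewrite expRM_natr lnK ?posrE ?divr_gt0// -exprVn /tau invf_div.
have e2 : (1 + 2 * tau) ^+ N.+1 <= expR (4 * n%:R).
  apply: (@le_trans _ _ (expR (2 * tau) ^+ N.+1)).
    rewrite lerXn2r ?nnegrE ?expR_ge0//; last exact: expR_ge1Dx.
    by case/andP: ht => h _; lra.
  rewrite -expRM_natr ler_expR /tau -[N.+1%:R]natr1.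
  have -> : 2 * (n%:R / N%:R) * (N%:R + 1) = 2 * n%:R + 2 * (n%:R / N%:R) :> R by field; rewrite gt_eqF.
  by case/andP: ht => _; rewrite /tau => h; lra.
have e3 : 2 ^+ n <= expR n%:R :> R.
  rewrite -[n%:R]mul1r expRM_natr lerXn2r ?nnegrE ?expR_ge0//.
  by have := @expR_ge1Dx R 1; lra.
have e4 : - (32 * n.+1%:R * n%:R * L) / (4 * n.+1%:R) = - (8 * n%:R * L) :> R.
  have a0 : n.+1%:R != 0 :> R by rewrite pnatr_eq0.
  by move: a0; move: n.+1%:R => a a0; field.
rewrite e1 e4.
apply: (@le_trans _ _ (expR (l * n.+1%:R) * expR (4 * n%:R) * (expR n%:R * expR (- (8 * n%:R * L))))).
  rewrite ler_pM ?mulr_ge0 ?expR_ge0 ?exprn_ge0//.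
  - by case/andP: ht => h _; lra.
  - by rewrite ler_wpM2l ?expR_ge0.
  - by rewrite ler_wpM2r ?expR_ge0.
rewrite -!expRD ler_expR eL -[n.+1%:R]natr1; nra.
Qed.

Lemma prob_setCI (R : realType) (d : measure_display) (T : measurableType d)
    (P : probability T R) (A B : set T) (a b : R) :
  measurable A /\ (P (~` A) <= a%:E)%E -> measurable B /\ (P (~` B) <= b%:E)%E ->
  measurable (A `&` B) /\ (P (~` (A `&` B)) <= (a + b)%:E)%E.
Proof.
move=> [mA hA] [mB hB]; split; first exact: measurableI.
rewrite setCI EFinD; apply: (le_trans (measureU2 _ _ _)); rewrite ?leeD//; exact: measurableC.
Qed.

(** The bound 192 (1 + l) c at l = 7, c = e^7, the larger of the two regimes. The 73 added to it
    later makes room for the probability constant 72 with a strict inequality. *)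
Definition iso_cst (R : realType) : R := 1536 * expR 7.

Lemma iso_cst_gt0 (R : realType) : 0 < iso_cst R.
Proof. by have h : 0 < expR 7 :> R := expR_gt0 _; rewrite /iso_cst; lra. Qed.

Lemma sqrt_iso_cst (R : realType) (t : R) : t <= iso_cst R -> Num.sqrt t < iso_cst R + 73.
Proof.
move=> h; have e1 : 1 <= expR 7 :> R by rewrite -[leLHS]expR0 ler_expR.
have c1 : 1 <= iso_cst R by rewrite /iso_cst; lra.
apply: (@le_lt_trans _ _ (Num.sqrt (iso_cst R ^+ 2))).
  by apply: ler_wsqrtr; apply: (le_trans h); rewrite expr2 ler_peMl//; lra.
by rewrite sqrtr_sqr ger0_norm; lra.
Qed.

Lemma body_bound (R : realType) n (I : finType) (p : I -> 'cV[R]_n) (i0 : I)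
    (Q : 'I_(1 + n) -> 'cV[R]_n) (l rho : R) :
  (0 < n)%N -> 0 <= l -> (forall k, convex_hull p (Q k)) ->
  expR (- 7 * n%:R) * n%:R ^+ n <= \det (lift_mx Q) ^+ 2 ->
  (forall q : 'I_(1 + n) -> I, injective q ->
     \sum_k sqnorm (p (q k)) + sqnorm (\sum_k p (q k)) <= 6 * (32 * n.+1%:R * n%:R * (1 + l))) ->
  (7 <= l -> [/\ 0 < rho, rho ^+ 2 = l / (2 * n%:R) &
     (((2 * rho) ^+ n / 2)%:E <= vol (convex_hull p))%E]) ->
  convex_body (convex_hull p) /\ isotropic_constant (convex_hull p) < iso_cst R + 73.
Proof.
move=> n0 l0 hQ hD HB HV.
have np : 0 < n%:R :> R by rewrite ltr0n.
have D2 : 0 < \det (lift_mx Q) ^+ 2.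
  by apply: lt_le_trans hD; rewrite mulr_gt0 ?expR_gt0 ?exprn_gt0.
have D0 : \det (lift_mx Q) != 0 by move: D2; rewrite exprn_even_gt0.
have L0 : 0 <= 1 + l by lra.
split; first (split; [exact: hull_compact|split; [|exact: hull_interior hQ D0]]).
  by move=> x y t; exact: hull_convex.
have [h|h] := leP 7 l.
- have [rho0 rho2 hv] := HV h.
  have lp : 0 < l by lra.
  have V0 : 0 < (2 * rho) ^+ n / 2 by rewrite divr_gt0// exprn_gt0// mulr_gt0.
  (* Since 4 rho^2 = 2 l / n, the choice c = 2 / l gives V^2 (c n)^n = 4^n / 4 >= 1, and the factor
     1 + l of the second moment cancels up to a constant. *)
  have c0 : 0 < 2 / l by rewrite divr_gt0.
  apply: (le_lt_trans (isotropic_bound i0 n0 L0 V0 c0 HB hv _)).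
    have -> : ((2 * rho) ^+ n / 2) ^+ 2 * (2 / l * n%:R) ^+ n = 4 ^+ n / 4.
      have -> : ((2 * rho) ^+ n / 2) ^+ 2 = (4 * rho ^+ 2) ^+ n / 4.
        by rewrite expr_div_n -exprM mulnC exprM; congr (_ ^+ n / _); ring.
      rewrite mulrAC -exprMn rho2; congr (_ ^+ n / _).
      by field; rewrite !gt_eqF.
    by rewrite ler_pdivlMr// mul1r -{1}[4 in leLHS]expr1 ler_weXn2l// ler1n.
  apply: sqrt_iso_cst; rewrite /iso_cst.
  have -> : 192 * (1 + l) * (2 / l) = 384 * (1 + l^-1) :> R by field; rewrite gt_eqF.
  have l1 : l^-1 <= 1 by rewrite invf_le1//; lra.
  have e1 : 1 <= expR 7 :> R by rewrite -[leLHS]expR0 ler_expR.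
  by lra.
(* Here c = e^7 compensates the e^(-7n) of [det_good]; the bound l < 7 is used separately, for the
   factor 1 + l. *)
- have V0 : 0 < `|\det (lift_mx Q)| * n%:R^-1 ^+ n by rewrite mulr_gt0 ?normr_gt0// exprn_gt0// invr_gt0.
  apply: (le_lt_trans (isotropic_bound i0 n0 L0 V0 (expR_gt0 7) HB (vol_hull_ge hQ D0 n0) _)).
    rewrite exprMn -normrX ger0_norm ?sqr_ge0// exprMn -exprM mulnC exprM.
    have nn : n%:R ^+ n != 0 :> R by rewrite expf_neq0// gt_eqF.
    have -> : \det (lift_mx Q) ^+ 2 * (n%:R^-1 ^+ 2) ^+ n * (expR 7 ^+ n * n%:R ^+ n) =
       \det (lift_mx Q) ^+ 2 * (expR 7 ^+ n / n%:R ^+ n).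
      by rewrite -exprM mulnC exprM exprVn; field.
    rewrite -[leLHS](_ : expR (- 7 * n%:R) * n%:R ^+ n * (expR 7 ^+ n / n%:R ^+ n) = 1); last first.
      rewrite expRM_natr expRN exprVn; field.
      by rewrite nn expf_neq0// gt_eqF ?expR_gt0.
    by rewrite ler_wpM2r// divr_ge0 ?exprn_ge0 ?expR_ge0.
  apply: sqrt_iso_cst; rewrite /iso_cst.
  by rewrite ler_wpM2r ?expR_ge0//; lra.
Qed.

Section gaussian_polytopes.
Variables (R : realType) (d : measure_display) (T : measurableType d).
Variables (P : probability T R) (k N : nat) (G : 'I_N.+1 -> T -> 'cV[R]_(1 + k)).
Hypothesis hG : std_gaussian_family P G.
Local Notation n := (1 + k)%N.
Hypothesis nN : (n <= N)%N.

Let iot (c : 'I_n) : 'I_N.+1 := lift ord0 (widen_ord nN c).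

Let iot_inj : injective iot.
Proof. by move=> a b /lift_inj /(congr1 val) /= h; exact: val_inj. Qed.

Let iot_io c : iot c != ord0. Proof. by rewrite eq_sym neq_lift. Qed.

Definition apex_pts (kap : R) w (j : 'I_(1 + n)) : 'cV[R]_n :=
  if fintype.split j is inr c then G (iot c) w else kap *: G ord0 w.

Lemma det_apex_pts kap w :
  \det (lift_mx (apex_pts kap w)) = shift_det ord0 kap iot (gmx G w).
Proof.
rewrite det_lift_mx shift_detE; congr determinant; apply/matrixP => r c.
rewrite [LHS]mxE [RHS]mxE /apex_pts.
have -> : fintype.split (rshift 1 c) = inr c := @unsplitK 1 n (inr c).
have -> : fintype.split (lshift n ord0) = inl ord0 := @unsplitK 1 n (inl ord0).
by rewrite !mxE.
Qed.

Let l : R := ln (N%:R / n%:R).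
(** Chosen so that the cube has |x|^2 <= n rho^2 = l / 2, the range in which reflection still
    retains enough mass. *)
Let rho : R := Num.sqrt (l / (2 * n%:R)).
Let Vg : set T := if 7 <= l then vol_good G rho else setT.

Definition good_event : set T :=
  quad_good G n.+1 (32 * n.+1%:R * n%:R * (1 + l)) `&`
  (det_good G ord0 0 iot `&` (det_good G ord0 1 iot `&` Vg)).

Let np : 0 < n%:R :> R. Proof. by rewrite ltr0n. Qed.
Let nNr : n%:R <= N%:R :> R. Proof. by rewrite ler_nat. Qed.

Let rho2 : 7 <= l -> 0 < rho /\ rho ^+ 2 = l / (2 * n%:R).
Proof.
move=> h; have h0 : 0 < l / (2 * n%:R) by rewrite divr_gt0// ?mulr_gt0//; lra.
by rewrite sqrtr_gt0 sqr_sqrtr// ltW.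
Qed.

(** Origin of the threshold 7: on the cube symp(x) N >= n e^(l/2 - 1/2) >= n e^3 >= 8 n. *)
Lemma rho_hyp : 7 <= l -> forall x : 'cV[R]_n,
  (forall j, - rho <= x j ord0 <= rho) -> 8 * n%:R <= symp x * N%:R.
Proof.
move=> h x hx; have [r0 r2] := rho2 h.
have sx : sqnorm x <= l / 2.
  apply: (@le_trans _ _ (\sum_(j < n) rho ^+ 2)).
    apply: ler_sum => j _; rewrite -real_normK ?num_real// lerXn2r ?nnegrE// ?(ltW r0)//.
    by rewrite ler_norml.
  rewrite sumr_const card_ord r2 -[_ *+ _]mulr_natl le_eqVlt; apply/orP; left; apply/eqP.
  by field; rewrite gt_eqF.
have eN : N%:R = n%:R * expR l.
  rewrite lnK ?posrE ?divr_gt0 ?(lt_le_trans np)//.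
  by field; rewrite gt_eqF.
rewrite eN mulrCA [8 * _]mulrC ler_wpM2l ?(ltW np)//.
apply: (@le_trans _ _ (expR (- sqnorm x - 1 / 2) * expR l)); last first.
  by rewrite ler_wpM2r ?expR_ge0// symp_ge.
rewrite -expRD; apply: (@le_trans _ _ (expR (1 * 3%:R))); last by rewrite ler_expR; lra.
rewrite expRM_natr; have e2 : 2 <= expR 1 :> R by have := @expR_ge1Dx R 1; lra.
apply: (@le_trans _ _ (2 ^+ 3)); first by rewrite -natrX ler_nat.
by rewrite lerXn2r ?nnegrE ?expR_ge0.
Qed.

(** The events contribute 1, 3 n^2, 3 n^2 and 2 times e^(-n), and n^2 >= 1. *)
Lemma good_event_prob : measurable good_event /\
  (P (~` good_event) <= (9 * n%:R ^+ 2 * expR (- n%:R))%:E)%E.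
Proof.
have HV : measurable Vg /\ (P (~` Vg) <= (2 * expR (- n%:R))%:E)%E.
  rewrite /Vg; case: ifP => h; last first.
    by rewrite setCT measure0 lee_fin mulr_ge0 ?expR_ge0.
  have [r0 _] := rho2 h; exact: (vol_goodP hG r0 (rho_hyp h)).
have H0 := det_goodP hG 0 iot_inj iot_io.
have H1 := det_goodP hG 1 iot_inj iot_io.
have HQ := quad_prob_bound hG (ltn0Sn k) nN (erefl (1 + l)).
have [mE PE] := prob_setCI HQ (prob_setCI H0 (prob_setCI H1 HV)).
split=> //; apply: (le_trans PE); rewrite lee_fin.
have n1 : 1 <= n%:R ^+ 2 :> R by rewrite exprn_ege1// ler1n.
have e0 := expR_gt0 (- n%:R : R).
by move: e0 n1; move: (expR _) (n%:R ^+ 2) => e q e0 q1; nra.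
Qed.

Lemma good_event_bodies w : good_event w ->
  let K := convex_hull (fun i : 'I_N.+1 => G i w) in
  let Tb := convex_hull (fun p : 'I_N * bool =>
               (if p.2 then 1 else -1) *: G (lift ord0 p.1) w) in
  (convex_body K /\ isotropic_constant K < iso_cst R + 73) /\
  (convex_body Tb /\ isotropic_constant Tb < iso_cst R + 73).
Proof.
move=> [hq [h0 [h1 hv]]] K Tb.
have N0 : (0 < N)%N by apply: leq_trans nN.
have l0 : 0 <= l by rewrite ln_ge0// ler_pdivlMr// mul1r.
have tailv (I : finType) (p : I -> 'cV[R]_n) : (forall i, convex_hull p (tail_pts G w i)) ->
    7 <= l -> [/\ 0 < rho, rho ^+ 2 = l / (2 * n%:R) &
     (((2 * rho) ^+ n / 2)%:E <= vol (convex_hull p))%E].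
  move=> hp h; have [r0 r2] := rho2 h; split=> //.
  move: hv; rewrite /Vg h => /(vol_good_ge hG r0) /le_trans; apply.
  apply: le_vol; [exact: measurable_hull|exact: measurable_hull|exact: hull_sub].
have pT i : convex_hull (fun p : 'I_N * bool => ((if p.2 then 1 else -1) : R) *: G (lift ord0 p.1) w) (G (lift ord0 i) w).
  have := hull_vertex (fun p : 'I_N * bool => ((if p.2 then 1 else -1) : R) *: G (lift ord0 p.1) w) (i, true).
  by rewrite /= scale1r.
split.
- apply: (@body_bound R n _ _ ord0 (apex_pts 1 w) l rho) => //.
  + move=> j; rewrite /apex_pts; case: (fintype.split j) => [_|c]; rewrite ?scale1r.
      exact: (hull_vertex (fun i : 'I_N.+1 => G i w)).
    exact: (hull_vertex (fun i : 'I_N.+1 => G i w)).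
  + by rewrite det_apex_pts.
  + move=> q qinj.
    have := @signed_points_moment R d T N.+1 n G n.+1 _ w hq _ q (fun=> true).
    rewrite card_ord => H; have := H _ (leqnn _).
    under eq_bigr do rewrite scale1r.
    under [\sum_j _ *: _]eq_bigr do rewrite scale1r.
    by apply => a b [/qinj].
  + by apply: tailv => i; exact: (hull_vertex (fun i : 'I_N.+1 => G i w)).
- apply: (@body_bound R n _ _ (Ordinal N0, true) (apex_pts 0 w) l rho) => //.
  + move=> j; rewrite /apex_pts; case: (fintype.split j) => [_|c]; last exact: pT.
    (* The apex at the origin is the midpoint of G_1 and -G_1. *)
    rewrite scale0r.
    set p := (fun p : 'I_N * bool => _).
    have := @hull_convex R n _ p _ _ (1 / 2) (hull_vertex p (Ordinal N0, true)) (hull_vertex p (Ordinal N0, false)).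
    rewrite /p /= scale1r scaleN1r (_ : 1 - 1 / 2 = 1 / 2 :> R); last by field.
    by rewrite scalerN subrr; apply; lra.
  + by rewrite det_apex_pts.
  + move=> q qinj.
    have := @signed_points_moment R d T N.+1 n G n.+1 _ w hq _ (fun j => lift ord0 (q j).1) (fun j => (q j).2).
    rewrite card_ord => H; apply: (H _ (leqnn _)).
    move=> a b h; have /lift_inj e1 := congr1 fst h; have e2 : (q a).2 = (q b).2 := congr1 snd h.
    apply: qinj.
    by rewrite [q a]surjective_pairing [q b]surjective_pairing e1 e2.
  + exact: tailv.
Qed.

End gaussian_polytopes.

Theorem theorem1p1 (R : realType) :
  exists C c : R, 0 < C /\ 0 < c /\
  forall (n N : nat), (1 <= n)%N -> (n <= N)%N ->
  forall (d : measure_display) (T : measurableType d) (P : probability T R)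
         (G : 'I_N.+1 -> T -> 'cV[R]_n),
  std_gaussian_family P G ->
  exists E : set T, measurable E /\
    (forall w, E w ->
       let K := convex_hull (fun i : 'I_N.+1 => G i w) in
       let Tb := convex_hull (fun p : 'I_N * bool =>
                    (if p.2 then 1 else -1) *: G (lift ord0 p.1) w) in
       convex_body K /\ convex_body Tb /\
       isotropic_constant K < C /\ isotropic_constant Tb < C) /\
    ((1 - C * expR (- c * n%:R))%:E < P E)%E.
Proof.
have i0 := iso_cst_gt0 R.
exists (iso_cst R + 73), (1 / 2); split; [lra|split; [lra|]].
move=> [//|k] N _ nN d T P G hG.
have [mE PE] := @good_event_prob R d T P k N G hG nN.
exists (good_event G nN); split=> //; split.
  move=> w Ew K Tb; have [[h1 h2] [h3 h4]] := good_event_bodies hG Ew.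
  by split; [exact: h1|split; [exact: h3|split; [exact: h2|exact: h4]]].
have PEC := probability_setC P mE.
have fE : P (good_event G nN) \is a fin_num by exact: fin_num_measure.
rewrite PEC -(fineK fE) -EFinB lee_fin in PE.
rewrite -(fineK fE) lte_fin.
set x : R := k.+1%:R; rewrite -/x in PE.
have x0 : 0 <= x / 2 by rewrite divr_ge0.
(* Half of the exponent pays for the polynomial: x^2 <= 8 e^(x/2) turns 9 x^2 e^(-x) into 72
   e^(-x/2). *)
have h8 : x ^+ 2 <= 8 * expR (x / 2).
  have := @expR_ge1Dxn R (x / 2) 1 x0; rewrite expr_div_n -natrX.
  by rewrite (_ : 2`! = 2)// => h; lra.
have ee : expR (- x) = expR (- (1 / 2) * x) * expR (- (x / 2)) by rewrite -expRD; congr expR; field.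
have e1 : expR (x / 2) * expR (- (x / 2)) = 1 by rewrite -expRD subrr expR0.
have q0 := expR_gt0 (- (1 / 2) * x); have q1 := expR_gt0 (- (x / 2)).
have : 9 * x ^+ 2 * expR (- x) <= 72 * expR (- (1 / 2) * x).
  rewrite ee; set a := expR (- (1 / 2) * x) in q0 *; set b := expR (- (x / 2)) in q1 e1 *.
  have : x ^+ 2 * b <= 8.
    by have := ler_wpM2r (ltW q1) h8; rewrite -[leRHS]mulrA e1 mulr1.
  by nra.
have : 0 < (iso_cst R + 1) * expR (- (1 / 2) * x) by rewrite mulr_gt0//; lra.
by lra.
Qed.
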